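(* Let $m\ge2$, $n=m(m-1)/2$, let $\mathbb{G}$ be the free step-two homogeneous Carnot group of $m$ generators $X_1,\dots,X_m$ with the Riemannian metric $g$ for which the Jacobian basis $(X_i)_{1\le i\le m},(\Gamma_{h,k})_{1\le k<h\le m}$ is orthonormal, let $\nabla=\nabla^g$ be its Levi-Civita connection, and let $\Delta=\mathrm{span}\{X_1,\dots,X_m\}$. Then: (i) The affine $\Delta$-horizontal holonomy group $\mathcal{H}^{\nabla}_{\Delta_R}$ is a Lie subgroup of $\mathrm{SE}(m+n)$ of dimension $2(m+n)$. (ii) The $\Delta$-horizontal holonomy group $H^{\nabla}_{\Delta}$ is a Lie subgroup of $\mathrm{SO}(m+n)$ of dimension $m+n$. Moreover, the connected component of the identity $(H^{\nabla}_{\Delta})_0$ of $H^{\nabla}_{\Delta}$ is compact.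
   Context: Let $N=m+n$ and $\mathcal{I}=\{(h,k):1\le k<h\le m\}$. $\mathbb{G}=(\mathbb{R}^{m+n},\star)$, with points $(v,\gamma)$, $v\in\mathbb{R}^m$, $\gamma=(\gamma_{h,k})_{(h,k)\in\mathcal{I}}$, and $(v,\gamma)\star(v',\gamma')=\big((v_i+v_i')_i,(\gamma_{h,k}+\gamma'_{h,k}+\frac12(v_hv'_k-v_kv'_h))_{(h,k)\in\mathcal{I}}\big)$. Jacobian basis: $X_h=\frac{\partial}{\partial v_h}+\frac12\sum_{h<i\le m}v_i\frac{\partial}{\partial\gamma_{i,h}}-\frac12\sum_{1\le j<h}v_j\frac{\partial}{\partial\gamma_{h,j}}$, $\Gamma_{h,k}=\frac{\partial}{\partial\gamma_{h,k}}$. $\Delta$-admissible curves are absolutely continuous (a.c.) curves a.e. tangent to $\Delta$. $(P^\nabla)_s^t(\gamma)$ is parallel transport along $\gamma$ from $\gamma(s)$ to $\gamma(t)$. $H^\nabla_\Delta|_x=\{(P^\nabla)_0^1(\gamma):\gamma:[0,1]\to\mathbb{G}\text{ a.c. }\Delta\text{-admissible loop based at }x\}\subset\mathrm{SO}(T_x\mathbb{G})$, and $H^\nabla_\Delta\subset\mathrm{SO}(m+n)$ is the corresponding subgroup (up to conjugation, independent of $x$). Let $Q=\{(x,\hat x;A):x\in\mathbb{G},\hat x\in\mathbb{R}^N,A:T_x\mathbb{G}\to\mathbb{R}^N\text{ an orientation-preserving linear isometry}\}$, $\pi_{Q,\mathbb{G}}(x,\hat x;A)=x$. For $q=(x,\hat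 x;A)$ and $X\in T_x\mathbb{G}$, $\mathscr{L}_R(X)|_q=\frac{d}{dt}\big|_0\big(\gamma(t),\hat x+tAX;A\circ(P^\nabla)_t^0(\gamma)\big)$ for any curve $\gamma$ with $\gamma(0)=x,\dot\gamma(0)=X$; $\Delta_R|_q=\mathscr{L}_R(\Delta|_x)|_q$; $\mathcal{O}_{\Delta_R}(q)$ is the set of endpoints of a.c. curves in $Q$ starting at $q$ and a.e. tangent to $\Delta_R$. $\mathrm{SE}(N)=\mathbb{R}^N\rtimes\mathrm{SO}(N)$ acts on $Q$ by $\mu((\hat y,C),(x,\hat x;A))=(x,C\hat x+\hat y;C\circ A)$, freely and transitively on fibers of $\pi_{Q,\mathbb{G}}$. $\mathcal{H}^\nabla_{\Delta_R|q}$ is the unique subgroup of $\mathrm{SE}(N)$ with $\mu(\mathcal{H}^\nabla_{\Delta_R|q}\times\{q\})=\mathcal{O}_{\Delta_R}(q)\cap\pi_{Q,\mathbb{G}}^{-1}(\pi_{Q,\mathbb{G}}(q))$; these are conjugate for different $q$, and $\mathcal{H}^\nabla_{\Delta_R}$ denotes this group up to conjugation. A Lie subgroup is a subgroup which is an immersed submanifold and a Lie group for the induced structure; the identity component refers to this Lie group structure. *)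

(* Defs.v *)
From HB Require Import structures.
From mathcomp Require Import all_boot all_order all_algebra.
From mathcomp Require Import all_classical all_reals all_analysis.
From mathcomp Require Import ring.
Set Implicit Arguments.
Unset Strict Implicit.
Unset Printing Implicit Defensive.
Import Order.TTheory GRing.Theory Num.Theory.
Import numFieldNormedType.Exports.
Local Open Scope classical_set_scope.
Local Open Scope ring_scope.

(* Class C^k on an open set U of a finite-dimensional space: a map is C^(k+1)
   iff it is differentiable and all its directional derivatives are C^k. *)
Fixpoint Ck_on (R : realType) (V W : normedModType R) (k : nat) (U : set V)
    (f : V -> W) : Prop :=
  match k with
  | 0%N => forall x, U x -> {for x, continuous f}
  | k'.+1 => (forall x, U x -> differentiable f x) /\
             (forall v : V, Ck_on k' U (fun x => 'D_v f x))
  end.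

Definition smooth_on (R : realType) (V W : normedModType R) (U : set V)
  (f : V -> W) : Prop := forall k, Ck_on k U f.

Definition abs_continuous (R : realType) (V : normedModType R) (a b : R)
    (f : R -> V) : Prop :=
  forall e : R, 0 < e -> exists2 d : R, 0 < d &
    forall (k : nat) (s t : 'I_k -> R),
      (forall i, a <= s i /\ s i <= t i /\ t i <= b) ->
      trivIset setT (fun i => `]s i, t i[%classic) ->
      \sum_(i < k) (t i - s i) < d ->
      \sum_(i < k) `|f (t i) - f (s i)| < e.

Section Immersed.
Context (R : realType) (V : normedModType R) (d : nat).
Implicit Types (H : set V) (E : normedModType R).

(* Smoothness of f : A -> H, A open in E, with respect to the atlas
   (U_j, phi_j): every phi_j^-1 \o f has an open domain and is smooth on it. *)
Definition smooth_into (dom : nat -> set 'cV[R]_d)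
    (phi : nat -> 'cV[R]_d -> V) E (A : set E) (f : E -> V) : Prop :=
  forall j : nat,
    let D := A `&` [set u | (phi j @` dom j) (f u)] in
    open D /\
    exists psi : E -> 'cV[R]_d,
      smooth_on D psi /\ (forall u, D u -> dom j (psi u) /\ phi j (psi u) = f u).

(* A d-dimensional immersed submanifold structure on H, presented by the
   inverses phi_i : U_i -> H of countably many charts.  Countability is second
   countability; Hausdorffness is automatic because the inclusion of H in V is
   continuous for the topology defined by the charts. *)
Record immersed_submanifold H := ImmersedSubmanifold {
  chart_dom : nat -> set 'cV[R]_d;
  chart : nat -> 'cV[R]_d -> V;
  chart_open : forall i, open (chart_dom i);
  chart_smooth : forall i, smooth_on (chart_dom i) (chart i);
  chart_immersion : forall i u, chart_dom i u ->
    injective ('d (chart i) u : 'cV[R]_d -> V);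
  chart_inj : forall i u v, chart_dom i u -> chart_dom i v ->
    chart i u = chart i v -> u = v;
  chart_cover : \bigcup_i (chart i @` chart_dom i) = H;
  chart_compat : forall i,
    smooth_into chart_dom chart (chart_dom i) (chart i)
}.

(* H with the manifold topology, in general finer than the one induced by V:
   O is open iff its trace in each chart is open. *)
Definition immersed_space H (M : immersed_submanifold H) : Type := set_type H.

Section Topology.
Context (H : set V) (M : immersed_submanifold H).
Local Notation T := (immersed_space M).

HB.instance Definition _ := Choice.copy T (set_type H).

Definition immersed_open (O : set T) : Prop :=
  forall i, open [set u | chart_dom M i u /\
                          exists2 y : T, O y & \val y = chart M i u].

Let immersed_openT : immersed_open setT.
Proof.
move=> i; rewrite [X in open X](_ : _ = chart_dom M i); first exact: chart_open.
apply/seteqP; split=> [u []//|u Uu]; split=> //.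
have Hu : chart M i u \in H.
  have Cu : (\bigcup_j (chart M j @` chart_dom M j)) (chart M i u).
    by exists i => //; exists u.
  by apply/mem_set; move: Cu; rewrite [X in X _](chart_cover M).
by exists (Sub (chart M i u) Hu).
Qed.

Let immersed_openI : setI_closed immersed_open.
Proof.
move=> A B oA oB i.
rewrite [X in open X](_ : _ =
  [set u | chart_dom M i u /\ exists2 y : T, A y & \val y = chart M i u] `&`
  [set u | chart_dom M i u /\ exists2 y : T, B y & \val y = chart M i u]).
  exact: openI.
apply/seteqP; split=> [u [Uu [y [Ay By] yu]]|u [[Uu [y Ay yu]] [_ [z Bz zu]]]].
  by split; split=> //; exists y.
split=> //; exists y => //; split=> //.
by have -> : y = z by apply: val_inj; rewrite /= yu zu.
Qed.

Let immersed_open_bigU (I : Type) (f : I -> set T) :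
  (forall i, immersed_open (f i)) -> immersed_open (\bigcup_i f i).
Proof.
move=> of_ i.
rewrite [X in open X](_ : _ = \bigcup_j
  [set u | chart_dom M i u /\ exists2 y : T, f j y & \val y = chart M i u]).
  by apply: bigcup_open => j _; exact: of_.
apply/seteqP; split=> [u [Uu [y [j _ fy] yu]]|u [j _ [Uu [y fy yu]]]].
  by exists j => //; split=> //; exists y.
by split=> //; exists y => //; exists j.
Qed.

HB.instance Definition _ := isOpenTopological.Build T
  immersed_openT immersed_openI immersed_open_bigU.

End Topology.

(* The operations of a Lie group embedded in V, used only on the carrier. *)
Record embedded_group := EmbeddedGroup {
  gcarrier : set V;
  gmul : V -> V -> V;
  ginv : V -> V;
  gone : V
}.

(* H is a subgroup of K, is an immersed submanifold, and is a Lie group for the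
   induced structure.  As K is embedded in V, being immersed in K and being
   contained in K and immersed in V are the same. *)
Record lie_subgroup (K : embedded_group) H := LieSubgroup {
  lie_sub : H `<=` gcarrier K;
  lie_one : H (gone K);
  lie_mul : forall a b, H a -> H b -> H (gmul K a b);
  lie_inv : forall a, H a -> H (ginv K a);
  lie_mfd : immersed_submanifold H;
  lie_mul_smooth : forall i j,
    smooth_into (chart_dom lie_mfd) (chart lie_mfd)
      (chart_dom lie_mfd i `*` chart_dom lie_mfd j)
      (fun u : 'cV[R]_d * 'cV[R]_d =>
         gmul K (chart lie_mfd i u.1) (chart lie_mfd j u.2));
  lie_inv_smooth : forall i,
    smooth_into (chart_dom lie_mfd) (chart lie_mfd) (chart_dom lie_mfd i)
      (fun u => ginv K (chart lie_mfd i u))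
}.

Definition identity_component (K : embedded_group) H (L : lie_subgroup K H) :
    set (immersed_space (lie_mfd L)) :=
  connected_component setT
    (exist _ (gone K) (mem_set (lie_one L)) : immersed_space (lie_mfd L)).

End Immersed.

Arguments identity_component {R V d K H} L _.

Definition SO (R : realType) (N : nat) : embedded_group 'M[R]_N :=
  EmbeddedGroup [set C : 'M[R]_N | C^T *m C = 1%:M /\ \det C = 1]
    mulmx (@invmx R N) 1%:M.

(* (y, C) stands for the rigid motion z |-> C z + y. *)
Definition SE (R : realType) (N : nat) :
    embedded_group ('cV[R]_N * 'M[R]_N)%type :=
  EmbeddedGroup [set h : 'cV[R]_N * 'M[R]_N | gcarrier (SO R N) h.2]
    (fun h k => (h.1 + h.2 *m k.1, h.2 *m k.2))
    (fun h => (- (invmx h.2 *m h.1), invmx h.2))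
    (0, 1%:M).

Section Geometry.
Context (R : realType) (N : nat).
Notation vec := 'cV[R]_N.
Notation mat := 'M[R]_N.

(* A Riemannian metric by its matrix in the coordinate frame; a connection by
   its Christoffel symbols, nabla x i k j = Gamma^k_{ij}(x), so that
   (nabla_{d_i} Y)(x) = d_i Y (x) + nabla x i *m Y x. *)
Definition metric : Type := vec -> mat.
Definition connection : Type := vec -> 'I_N -> mat.

Definition torsion_free (nabla : connection) : Prop :=
  forall x i j k, nabla x i k j = nabla x j k i.

(* d_i g(d_j, d_k) = g(nabla_{d_i} d_j, d_k) + g(d_j, nabla_{d_i} d_k). *)
Definition metric_compatible (g : metric) (nabla : connection) : Prop :=
  forall x i j k,
    'D_(delta_mx i 0 : vec) (fun y => g y j k : R) x =
    \sum_(l < N) (nabla x i l j * g x l k + nabla x i l k * g x j l).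

Definition levi_civita (g : metric) (nabla : connection) : Prop :=
  torsion_free nabla /\ metric_compatible g nabla.

Definition christoffel (g : metric) : connection := fun x i =>
  \matrix_(k, j) (2^-1 * \sum_(l < N) invmx (g x) k l *
    ('D_(delta_mx i 0 : vec) (fun y => g y l j : R) x
     + 'D_(delta_mx j 0 : vec) (fun y => g y l i : R) x
     - 'D_(delta_mx l 0 : vec) (fun y => g y i j : R) x)).

Lemma christoffel_levi_civita (g : metric) :
  (forall x, (g x)^T = g x) -> (forall x, g x \in unitmx) ->
  levi_civita g (christoffel g).
Proof.
move=> gT gU.
have gS y a b : g y a b = g y b a by rewrite -{1}(gT y) mxE.
have gSE a b : (fun y => g y a b) = (fun y => g y b a) by apply/funext=> y.
split=> [x i j k|x i j k].
  rewrite !mxE; congr (_ * _); apply: eq_bigr => l _.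
  by rewrite (gSE i j) [_ + 'D__ _ x]addrC.
pose b i j l := 'D_(delta_mx i 0 : vec) (fun y => g y l j : R) x
     + 'D_(delta_mx j 0 : vec) (fun y => g y l i : R) x
     - 'D_(delta_mx l 0 : vec) (fun y => g y i j : R) x.
have low p q r : \sum_(l < N) christoffel g x p l q * g x r l = 2^-1 * b p q r.
  have -> : \sum_(l < N) christoffel g x p l q * g x r l =
      2^-1 * (g x *m (invmx (g x) *m (\col_l b p q l))) r 0.
    rewrite mxE mulr_sumr; apply: eq_bigr => l _.
    rewrite !mxE mulrC mulrCA; congr (_ * (_ * _)).
    by apply: eq_bigr => l' _; rewrite mxE.
  by rewrite mulmxA mulmxV // mul1mx mxE.
rewrite big_split /=.
under eq_bigr do rewrite (gS x _ k).
rewrite !low /b (gSE k i) (gSE k j) (gSE j i) -mulrDr.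
set p := 'D__ _ x; set q := 'D__ _ x; set r := 'D__ _ x.
have -> : p + q - r + (p + r - q) = 2 * p.
  by ring.
by rewrite mulKf // pnatr_eq0.
Qed.

Definition parallel_along (nabla : connection) (gamma : R -> vec) (a b : R)
    (Y : R -> vec) : Prop :=
  abs_continuous a b Y /\
  \forall t \ae (@lebesgue_measure R), t \in `]a, b[ ->
    exists2 w : vec, is_derive (t : R) (1 : R) gamma w &
      is_derive (t : R) (1 : R) Y
        (- \sum_(i < N) w i 0 *: (nabla (gamma t) i *m Y t)).

(* P is the matrix of the parallel transport along gamma from T_{gamma s} to
   T_{gamma t} (s <= t is not required). *)
Definition parallel_transport (nabla : connection) (gamma : R -> vec)
    (s t : R) (P : mat) : Prop :=
  forall v : vec, exists Y : R -> vec,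
    [/\ parallel_along nabla gamma (Num.min s t) (Num.max s t) Y,
        Y s = v & Y t = P *m v].

Definition distribution : Type := vec -> set vec.

Definition admissible (Delta : distribution) (gamma : R -> vec) : Prop :=
  abs_continuous 0 1 gamma /\
  \forall t \ae (@lebesgue_measure R), t \in `]0, 1[ ->
    exists2 w : vec, is_derive (t : R) (1 : R) gamma w & Delta (gamma t) w.

Definition horizontal_holonomy_at (nabla : connection) (Delta : distribution)
    (x : vec) : set mat :=
  [set P | exists gamma : R -> vec,
     [/\ admissible Delta gamma, gamma 0 = x, gamma 1 = x &
         parallel_transport nabla gamma 0 1 P]].

(* The columns of F form a g-orthonormal basis of T_x. *)
Definition orthonormal_frame (g : metric) (x : vec) (F : mat) : Prop :=
  F^T *m g x *m F = 1%:M.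

(* The holonomy group read in the basis F. *)
Definition horizontal_holonomy (nabla : connection) (Delta : distribution)
    (x : vec) (F : mat) : set mat :=
  [set invmx F *m P *m F | P in horizontal_holonomy_at nabla Delta x].

(* A state (x, xhat, A), with A the matrix of a linear map T_x -> R^N. *)
Notation state := (vec * vec * mat)%type.

Definition rolling_space (g : metric) : set state :=
  [set q | q.2^T *m q.2 = g q.1.1 /\ 0 < \det q.2].

(* w = L_R(X)|_q: the derivative at 0 of (gamma t, xhat + t A X; A \o P_t^0(gamma)),
   which does not depend on the curve gamma with velocity X at x. *)
Definition rolling_lift (nabla : connection) (q : state) (X : vec)
    (w : state) : Prop :=
  exists (gamma : R -> vec) (P : R -> mat) (e : R),
    [/\ 0 < e,
        smooth_on `]- e, e[%classic gamma,
        gamma 0 = q.1.1 /\ is_derive (0 : R) (1 : R) gamma X,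
        (forall t, t \in `]- e, e[ ->
           parallel_transport nabla gamma t 0 (P t)) &
        is_derive (0 : R) (1 : R)
          (fun t => (gamma t, q.1.2 + t *: (q.2 *m X), q.2 *m P t) : state) w].

Definition rolling_distribution (nabla : connection) (Delta : distribution)
    (q : state) : set state :=
  [set w | exists2 X, Delta q.1.1 X & rolling_lift nabla q X w].

Definition rolling_orbit (g : metric) (nabla : connection)
    (Delta : distribution) (q0 : state) : set state :=
  [set q1 | exists q : R -> state,
     [/\ abs_continuous 0 1 q,
         (forall t, t \in `[0, 1] -> rolling_space g (q t)),
         (\forall t \ae (@lebesgue_measure R), t \in `]0, 1[ ->
            exists2 w : state, is_derive (t : R) (1 : R) q w &
              rolling_distribution nabla Delta (q t) w),
         q 0 = q0 & q 1 = q1]].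

Definition SE_action (h : vec * mat) (q : state) : state :=
  (q.1.1, h.2 *m q.1.2 + h.1, h.2 *m q.2).

Definition affine_holonomy (g : metric) (nabla : connection)
    (Delta : distribution) (q : state) : set (vec * mat) :=
  [set h | gcarrier (SE R N) h /\
           rolling_orbit g nabla Delta q (SE_action h q)].

(* The characterization of the affine holonomy group as the unique subset of
   SE(N) with mu(H x {q}) = O(q) \cap pi^-1(pi(q)). *)
Lemma affine_holonomyP (g : metric) (nabla : connection)
    (Delta : distribution) (q : state) (H : set (vec * mat)) :
  rolling_space g q -> H `<=` gcarrier (SE R N) ->
  (H = affine_holonomy g nabla Delta q <->
   SE_action^~ q @` H =
   rolling_orbit g nabla Delta q `&` [set q' | q'.1.1 = q.1.1]).
Proof.
case: q => -[x xh] A [/= AA dA] sH.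
have UA : A \in unitmx by rewrite unitmxE unitfE gt_eqF.
have free h h' : SE_action h (x, xh, A) = SE_action h' (x, xh, A) -> h = h'.
  case: h h' => [y C] [y' C'] /= [e /(congr1 (mulmx^~ (invmx A)))].
  by rewrite /= !mulmxK // => CC'; move: e; rewrite CC' => /addrI ->.
split=> [-> | HO].
  apply/seteqP; split=> [_ [h [_ Oh] <-]|]; first by split.
  move=> [[x' xh'] A'] [Or /= xx']; subst x'.
  have [qc [_ Qc _ _ q1]] := Or.
  have := Qc 1; rewrite q1 in_itv /= ler01 lexx => /(_ isT) [/= AA' dA'].
  have CA : A' *m invmx A *m A = A' by rewrite mulmxKV.
  exists (xh' - A' *m invmx A *m xh, A' *m invmx A); last first.
    by rewrite /SE_action /= CA subrKC.
  split; last by rewrite /SE_action /= CA subrKC.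
  have CC : (A' *m invmx A)^T *m (A' *m invmx A) = 1%:M.
    rewrite trmx_mul mulmxA -[_ *m A']mulmxA AA' -AA trmx_inv mulmxA.
    by rewrite mulVmx ?unitmx_tr // mul1mx mulmxV.
  split=> //=; have d0 : 0 < \det (A' *m invmx A).
    by rewrite det_mulmx det_inv mulr_gt0 // invr_gt0.
  have := congr1 determinant CC; rewrite det_mulmx det_tr det1 => /eqP.
  by rewrite -expr2 sqrf_eq1 => /orP[/eqP //|/eqP d1]; move: d0; rewrite d1 ltr0N1.
apply/seteqP; split=> h.
  move=> Hh; split; first exact: sH.
  suff: (SE_action^~ (x, xh, A) @` H) (SE_action h (x, xh, A)).
    by rewrite HO => -[].
  by exists h.
move=> [_ Oh].
suff: (SE_action^~ (x, xh, A) @` H) (SE_action h (x, xh, A)).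
  by move=> [h' Hh' /free <-].
by rewrite HO; split.
Qed.

End Geometry.

Definition pairs (m : nat) : Type := {p : 'I_m * 'I_m | (p.2 < p.1)%N}.
HB.instance Definition _ m := Finite.copy (pairs m) {p : 'I_m * 'I_m | (p.2 < p.1)%N}.

(* The number n of vertical coordinates, so that R^(m+n) is 'cV_(m + vdim m). *)
Definition vdim (m : nat) : nat := (m * (m - 1)) %/ 2.

Lemma card_pairs m : #|{: pairs m}| = vdim m.
Proof.
rewrite card_sig /vdim subn1 divn2 -bin2 -bin2_sum.
rewrite (eq_card (B := [pred p : 'I_m * 'I_m | (p.2 < p.1)%N])) // -sum1_card.
rewrite -(pair_big_dep predT (fun i j : 'I_m => (j < i)%N) (fun _ _ => 1%N)) /=.
rewrite big_mkord; apply: eq_bigr => i _; rewrite sum1_card.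
have wI : injective (widen_ord (ltnW (ltn_ord i))).
  by move=> a b /(congr1 val) /= ab; apply: val_inj.
rewrite -[RHS]card_ord -[RHS](card_imset _ wI).
apply: eq_card => j; apply/idP/imsetP => [ji|[k _ ->]]; last first.
  by rewrite -topredE; exact: (ltn_ord k).
by exists (Ordinal ji) => //; apply: val_inj.
Qed.

Section Carnot.
Context (R : realType) (m : nat).
Notation point := 'cV[R]_(m + vdim m).

Definition pair_index (p : pairs m) : 'I_(vdim m) :=
  cast_ord (card_pairs m) (enum_rank p).

Definition vcoord (x : point) (i : 'I_m) : R := x (lshift (vdim m) i) 0.
Definition gcoord (x : point) (p : pairs m) : R := x (rshift m (pair_index p)) 0.

Definition dv (i : 'I_m) : point := delta_mx (lshift (vdim m) i) 0.
Definition dgamma (p : pairs m) : point := delta_mx (rshift m (pair_index p)) 0.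

Definition star (x y : point) : point :=
  \sum_(i < m) (vcoord x i + vcoord y i) *: dv i +
  \sum_(p : pairs m)
    (gcoord x p + gcoord y p +
     2^-1 * (vcoord x (val p).1 * vcoord y (val p).2
             - vcoord x (val p).2 * vcoord y (val p).1)) *: dgamma p.

Definition X_field (h : 'I_m) (x : point) : point :=
  dv h
  + 2^-1 *: (\sum_(p : pairs m | (val p).2 == h) vcoord x (val p).1 *: dgamma p)
  - 2^-1 *: (\sum_(p : pairs m | (val p).1 == h) vcoord x (val p).2 *: dgamma p).

Definition Gamma_field (p : pairs m) (x : point) : point := dgamma p.

Definition horizontal : distribution R (m + vdim m) :=
  fun x => [set w | exists u : 'I_m -> R, w = \sum_(h < m) u h *: X_field h x].

Definition index_pair (k : 'I_(vdim m)) : pairs m :=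
  enum_val (cast_ord (esym (card_pairs m)) k).

Lemma pair_indexK : cancel pair_index index_pair.
Proof. by move=> p; rewrite /index_pair cast_ordK enum_rankK. Qed.

Lemma index_pairK : cancel index_pair pair_index.
Proof. by move=> k; rewrite /pair_index enum_valK cast_ordKV. Qed.

(* The matrix with columns X_1(x), ..., X_m(x) and the Gamma_{h,k}(x). *)
Definition jacobian_frame (x : point) : 'M[R]_(m + vdim m) :=
  row_mx (\matrix_(i, h) X_field h x i 0)
         (\matrix_(i, k) Gamma_field (index_pair k) x i 0).

(* The metric with g(X, Y) = <J^-1 X, J^-1 Y>, J the Jacobian frame. *)
Definition carnot_metric : metric R (m + vdim m) :=
  fun x => (invmx (jacobian_frame x))^T *m invmx (jacobian_frame x).

Lemma jacobian_frame_det x : \det (jacobian_frame x) = 1.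
Proof.
have sum0 (P : pred (pairs m)) (f : pairs m -> R) i :
    (\sum_(p | P p) f p *: dgamma p) (lshift (vdim m) i) 0 = 0.
  rewrite summxE big1 // => p _.
  by rewrite !mxE eq_lrshift mulr0.
have -> : jacobian_frame x = block_mx 1%:M 0 (dlsubmx (jacobian_frame x)) 1%:M.
  rewrite -[LHS]submxK /jacobian_frame /ulsubmx /ursubmx /drsubmx.
  rewrite /usubmx /dsubmx; congr block_mx; apply/matrixP => i j.
  - rewrite 2!mxE row_mxEl !mxE !sum0 !mulr0 subr0 addr0.
    by rewrite eq_lshift eqxx andbT.
  - by rewrite 2!mxE row_mxEr !mxE eq_lrshift.
  - by rewrite 2!mxE row_mxEr !mxE eq_rshift index_pairK eqxx andbT.
by rewrite det_lblock !det1 mulr1.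
Qed.

Lemma jacobian_frame_unit x : jacobian_frame x \in unitmx.
Proof. by rewrite unitmxE jacobian_frame_det unitr1. Qed.

Lemma carnot_metric_orthonormal x :
  (jacobian_frame x)^T *m carnot_metric x *m jacobian_frame x = 1%:M.
Proof.
rewrite /carnot_metric mulmxA -trmx_mul mulVmx ?jacobian_frame_unit //.
by rewrite trmx1 mul1mx mulVmx ?jacobian_frame_unit.
Qed.

Lemma carnot_levi_civita :
  levi_civita carnot_metric (christoffel carnot_metric).
Proof.
apply: christoffel_levi_civita => x.
  by rewrite /carnot_metric trmx_mul trmxK.
by rewrite unitmx_mul unitmx_tr unitmx_inv jacobian_frame_unit.
Qed.

(* X_h and Gamma_{h,k} are the left-invariant fields with values d/dv_h and
   d/dgamma_{h,k} at the origin. *)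
Lemma point_sum x :
  x = \sum_(i < m) vcoord x i *: dv i + \sum_(p : pairs m) gcoord x p *: dgamma p.
Proof.
rewrite (reindex index_pair) /=; last first.
  by exists pair_index => ? _; [exact: index_pairK|exact: pair_indexK].
under [X in _ + X]eq_bigr do rewrite /gcoord /dgamma index_pairK.
rewrite [LHS](matrix_sum_delta x) big_split_ord /=.
by congr (_ + _); apply: eq_bigr => i _; rewrite big_ord1.
Qed.

Lemma star_dv (x : point) (t : R) (h : 'I_m) :
  star x (t *: dv h) = x + t *: X_field h x.
Proof.
have vE i : vcoord (t *: dv h) i = t * (i == h)%:R.
  by rewrite /vcoord !mxE eq_lshift eqxx andbT.
have gE p : gcoord (t *: dv h) p = 0.
  by rewrite /gcoord !mxE eq_rlshift mulr0.
rewrite /star.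
under eq_bigr do rewrite vE scalerDl.
under [X in _ + X]eq_bigr do rewrite gE addr0 !vE scalerDl.
rewrite !big_split /= addrACA -point_sum; congr (_ + _).
rewrite /X_field !scalerDr -addrA; congr (_ + _).
  rewrite (bigD1 h) //= eqxx mulr1 big1 ?addr0 // => i /negbTE ->.
  by rewrite mulr0 scale0r.
rewrite scalerN !scaler_sumr [in RHS]big_mkcond [X in _ - X]big_mkcond /= -sumrB.
apply: eq_bigr => p _; case: eqP => _; case: eqP => _;
  rewrite ?(mulr1, mulr0, subr0, sub0r, scale0r, scaler0) //=;
  rewrite !(@scalerA _ point) -?(@scalerBl _ point) -?(@scaleNr _ point);
  congr (_ *: _); ring.
Qed.

Lemma star_dgamma (x : point) (t : R) (p : pairs m) :
  star x (t *: dgamma p) = x + t *: Gamma_field p x.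
Proof.
have vE i : vcoord (t *: dgamma p) i = 0.
  by rewrite /vcoord !mxE eq_lrshift mulr0.
have gE q : gcoord (t *: dgamma p) q = t * (q == p)%:R.
  rewrite /gcoord !mxE eq_rshift eqxx andbT; congr (_ * (nat_of_bool _)%:R).
  exact: (can_eq pair_indexK).
rewrite /star.
under eq_bigr do rewrite vE addr0.
under [X in _ + X]eq_bigr do
  rewrite gE !vE !mulr0 subr0 mulr0 addr0 scalerDl.
rewrite big_split /= addrA -point_sum; congr (_ + _).
rewrite (bigD1 p) //= eqxx mulr1 big1 ?addr0 // => q /negbTE ->.
by rewrite mulr0 scale0r.
Qed.

End Carnot.

Arguments carnot_metric R m x : clear implicits.
Arguments horizontal R m x : clear implicits.

(* Main.v *)
Require Import Defs.
From HB Require Import structures.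
From mathcomp Require Import all_boot all_order all_algebra.
From mathcomp Require Import all_classical all_reals all_analysis.
From mathcomp Require Import ring lra.
Set Implicit Arguments.
Unset Strict Implicit.
Unset Printing Implicit Defensive.
Import Order.TTheory GRing.Theory Num.Theory.
Import numFieldNormedType.Exports.
Local Open Scope classical_set_scope.
Local Open Scope ring_scope.

(** Put N = m + m(m-1)/2 = dim so(1+m).  The proof computes both holonomy
groups exactly: in suitable orthonormal coordinates, they are the image
K = adj(SO(1+m)) of the adjoint representation of SO(1+m), respectively the
semidirect product of R^N and K.

Geometry.  The Jacobian frame is J(x) = 1 + B(x), where B(x) depends linearly
on the horizontal part of x, vanishes on vertical vectors and takes vertical
values, so that B(x) B(y) = 0.  By Koszul's formula, the connection form in
this frame is left-invariant; on a horizontal vector u it is the skew matrix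
om u = B(u) - B(u)^T (Gam_hor).  Hence, if gamma' = J(gamma) u and Y is a
parallel frame along gamma, then a = (J(gamma)^-1 Y)^T solves a' = a om(u)
(frame_ode, frame_parallel).  The same equation governs rolling: the state
(x, xhat, A) with A = O a J(x)^-1 and xhat = O y moves along the rolling
distribution iff x' = J(x) u, y' = a u and a' = a om(u).

Algebra.  R^N is isomorphic to so(1+m) by an S (toskew) which sends horizontal
vectors to the skew matrices supported on the first row and column, and
om(u) z corresponds to -1/2 [S u, S z] (om_adjoint).  So a' = a om(u) is the
image under the adjoint representation of an equation in SO(1+m).

Upper bound.  The squared distance of a(t) to the compact set K is absolutely
continuous, and its derivative is zero a.e. because right translation by K
preserves it and some curve in K has velocity om(u) at 1 (adjSO_invariant).
An absolutely continuous function which is a.e. locally Lipschitz with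
constant M is Lipschitz with constant M (abs_continuous_loc_lip); M = 0 gives
that a stays in K.

Lower bound.  Moving along X_i for the time t multiplies the state (x, y, a),
in the group law (x, y, a)(x', y', a') = (x * x', y + a y', a a'), by
g_i(t) = (t e_i, t e_i, r_i(t)), where r_i(t) is the adjoint action of the
rotation by t/2 in the plane (0, i).  The rotations are periodic while the
translations are not: commutators of g_i(4 pi k) with g_j(t) have a = 1, and
products and conjugates of these yield every (0, y, 1); then all (x, 0, 1) with
x central; and, as r_j(2 pi) conjugates r_i(s) to r_i(-s), all (0, 0, r_i(t)).
Rotations in the planes (0, i) generate SO(1+m), so every (0, y, k) with k in K
is reached (word_all) by a Lipschitz curve (tangent_path_all).

Lie structure.  Near 1, K is parametrized by u |-> adj(cayley(S u)).  The map
adj identifies c and -c, but the matrix c_00 c is a polynomial in adj c, so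
that c is recovered where c_00 > 0.  The inverse of this chart is the
restriction of a smooth map on an open set of matrices; hence finitely many
translates of the chart form an atlas for which the group operations are
smooth (translate_lie_subgroup), and since K is compact, so is its identity
component. *)

(** * Smooth maps between normed spaces *)

Section NearDifferentiable.
Context (R : realType).
Implicit Types V W E : normedModType R.

Lemma near_eq_differentiable V W (f g : V -> W) x :
  {near x, f =1 g} -> differentiable f x -> differentiable g x.
Proof.
move=> fg [[dfc dfe]].
apply/diffP => /=.
apply: (@getPex _ (fun (df : {linear V -> W}) => continuous df /\
  forall y, g y = g (lim (nbhs x)) + df (y - lim (nbhs x))
                  +o_(y \near x) (y - lim (nbhs x)))).
suff H : g = cst (g x) + 'd f x \o center x +o_x (center x).
  by exists ('d f x); split=> //; rewrite lim_id // => y; rewrite {1}H.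
apply/eqaddoE/eqaddoP => e e0.
move: dfe; rewrite lim_id // => /eqaddoP/(_ e e0).
apply: filter_app.
near=> y => /=; rewrite !fctE /= (nbhs_singleton fg).
by have -> : f y = g y by near: y; exact: fg.
Unshelve. all: by end_near. Qed.

End NearDifferentiable.

Section ContinuouslyDifferentiable.
Context (R : realType).
Implicit Types V W E : normedModType R.

(** The closure properties below compute a directional derivative on A by a rule of
    calculus and transfer the regularity of the result along this lemma. *)
Lemma Ck_on_eq V W k (A : set V) (f g : V -> W) :
  open A -> (forall x, A x -> f x = g x) -> Ck_on k A f -> Ck_on k A g.
Proof.
move=> oA; elim: k f g => [|k IH] f g fg.
  move=> fc x Ax; have fgx : {near x, f =1 g}.
    by near=> y; apply: fg; near: y; exact: open_nbhs_nbhs.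
  have fx : f @ x --> f x := fc x Ax.
  rewrite (fg x Ax) in fx; apply: cvg_trans fx.
  by apply: near_eq_cvg; apply: filterS fgx => y ->.
have near_fg x : A x -> {near x, f =1 g}.
  by move=> Ax; near=> y; apply: fg; near: y; exact: open_nbhs_nbhs.
move=> [df dvf]; split=> [x Ax|v].
  exact: (near_eq_differentiable (near_fg x Ax) (df x Ax)).
apply: IH (dvf v) => x Ax; apply: near_eq_derive.
exact: near_fg.
Unshelve. all: by end_near. Qed.

Lemma Ck_onS V W k (A : set V) (f : V -> W) : Ck_on k.+1 A f -> Ck_on k A f.
Proof.
elim: k f => [|k IH] f [df dvf].
  by move=> x Ax; apply/differentiable_continuous/df.
by split=> [|v]; [exact: df|exact: (IH _ (dvf v))].
Qed.

Lemma Ck_on_cst V W k (A : set V) (w : W) : Ck_on k A (fun=> w).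
Proof.
elim: k w => [|k IH] w; first by move=> x _; exact: cst_continuous.
split=> [x _|v]; first exact: differentiable_cst.
suff -> : (fun x => 'D_v (fun=> w) x) = (fun=> 0) :> (V -> W) by exact: IH.
by apply/funext => x; exact: (derive_cst w).
Qed.

Lemma Ck_onD V W k (A : set V) (f g : V -> W) : open A ->
  Ck_on k A f -> Ck_on k A g -> Ck_on k A (fun x => f x + g x).
Proof.
move=> oA; elim: k f g => [|k IH] f g.
  by move=> cf cg x Ax; apply: cvgD; [exact: cf|exact: cg].
move=> [df dvf] [dg dvg]; split=> [x Ax|v].
  by apply: differentiableD; [exact: df|exact: dg].
apply: Ck_on_eq (IH _ _ (dvf v) (dvg v)) => // x Ax.
by rewrite (@deriveD _ _ _ f g) //; apply: diff_derivable; [exact: df|exact: dg].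
Qed.

Lemma Ck_on_linear V W W' k (A : set V) (f : V -> W) (L : {linear W -> W'}) :
  open A -> continuous L -> Ck_on k A f -> Ck_on k A (fun x => L (f x)).
Proof.
move=> oA cL; elim: k f => [|k IH] f.
  move=> cf x Ax; apply: (@continuous_comp _ _ _ f L); first exact: cf.
  exact: cL.
move=> [df dvf]; split=> [x Ax|v].
  apply: (@differentiable_comp _ _ _ _ f L); first exact: df.
  exact: linear_differentiable.
apply: Ck_on_eq (IH _ (dvf v)) => // x Ax.
have dLx : differentiable L (f x) by exact: linear_differentiable.
rewrite [RHS](@deriveE _ _ _ (L \o f)); last first.
  by apply: differentiable_comp => //; exact: df.
rewrite diff_comp //=; last exact: df.
by rewrite diff_lin // deriveE //; exact: df.
Qed.

Lemma Ck_onM V k (A : set V) (f g : V -> R) : open A ->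
  Ck_on k A f -> Ck_on k A g -> Ck_on k A (fun x => f x * g x).
Proof.
move=> oA; elim: k f g => [|k IH] f g.
  by move=> cf cg x Ax; apply: cvgM; [exact: cf|exact: cg].
move=> sf sg; have [df dvf] := sf; have [dg dvg] := sg; split=> [x Ax|v].
  by apply: differentiableM; [exact: df|exact: dg].
have H := Ck_onD oA (IH _ _ (Ck_onS sf) (dvg v)) (IH _ _ (Ck_onS sg) (dvf v)).
apply: Ck_on_eq H => // x Ax.
by rewrite (@deriveM _ _ f g) //; apply: diff_derivable; [exact: df|exact: dg].
Qed.

Lemma Ck_onV V k (A : set V) (f : V -> R) : open A ->
  (forall x, A x -> f x != 0) ->
  Ck_on k A f -> Ck_on k A (fun x => (f x)^-1).
Proof.
move=> oA f0; elim: k => [|k IH].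
  by move=> cf x Ax; apply: cvgV; [exact: f0|exact: cf].
move=> sf; have [df dvf] := sf; split=> [x Ax|v].
  by apply: differentiableV; [exact: df|exact: f0].
have s1 := IH (Ck_onS sf).
have H := Ck_onM oA (Ck_on_cst k A (-1 : R)) (Ck_onM oA (Ck_onM oA s1 s1) (dvf v)).
apply: Ck_on_eq H => // x Ax.
rewrite (@deriveV _ _ f) //; [|exact: f0|by apply: diff_derivable; exact: df].
by rewrite mulN1r -expr2 exprVn -[RHS]/(_ * _) mulNr.
Qed.

Lemma Ck_on_sqrt V k (A : set V) (f : V -> R) : open A ->
  (forall x, A x -> 0 < f x) ->
  Ck_on k A f -> Ck_on k A (fun x => Num.sqrt (f x)).
Proof.
move=> oA f0; elim: k => [|k IH].
  move=> cf x Ax; apply: (@continuous_comp _ _ _ f (@Num.sqrt R)); first exact: cf.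
  exact: sqrt_continuous.
move=> sf; have [df dvf] := sf.
have ds x : A x -> is_derive (f x) (1 : R) (@Num.sqrt R) (2 * Num.sqrt (f x))^-1.
  by move=> Ax; apply: is_derive1_sqrt; exact: f0.
split=> [x Ax|v].
  apply: (@differentiable_comp _ _ _ _ f (@Num.sqrt R)); first exact: df.
  by apply/derivable1_diffP; have [] := ds x Ax.
have s1 := IH (Ck_onS sf).
have H : Ck_on k A (fun x => (2 * Num.sqrt (f x))^-1 * 'D_v f x).
  apply: Ck_onM (dvf v) => //; apply: Ck_onV => //.
    by move=> x Ax; rewrite mulf_neq0 // sqrtr_eq0 -ltNge f0.
  by apply: Ck_onM => //; exact: (Ck_on_cst k A (2 : R)).
apply: Ck_on_eq H => // x Ax.
have dsx : differentiable (@Num.sqrt R) (f x).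
  by apply/derivable1_diffP; have [] := ds x Ax.
rewrite [RHS](@deriveE _ _ _ (@Num.sqrt R \o f)); last first.
  by apply: differentiable_comp => //; exact: df.
rewrite diff_comp //=; last exact: df.
rewrite diff1E // -deriveE; last exact: df.
by rewrite mulrC derive1E; have [_ ->] := ds x Ax.
Qed.

End ContinuouslyDifferentiable.

Section SmoothOn.
Context (R : realType).
Implicit Types V W E : normedModType R.

Lemma smooth_on_lin V W W' (A : set V) (f : V -> W) (L : W -> W') :
  open A -> linear L -> continuous L -> smooth_on A f ->
  smooth_on A (fun x => L (f x)).
Proof.
move=> oA linL cL sf k.
pose LM := GRing.isLinear.Build _ _ _ _ L linL.
pose L' : {linear W -> W'} := HB.pack L LM.
exact: (@Ck_on_linear _ _ _ _ k A f L' oA cL (sf k)).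
Qed.

Lemma smooth_on_cst V W (A : set V) (w : W) : smooth_on A (fun=> w).
Proof. by move=> k; exact: Ck_on_cst. Qed.

Lemma smooth_on_id V (A : set V) : smooth_on A id.
Proof.
move=> [|k]; first by move=> x _; exact: cvg_id.
split=> [x _|v]; first exact: ex_diff.
suff -> : (fun x => 'D_v id x) = (fun=> v) :> (V -> V) by exact: Ck_on_cst.
by apply/funext => x; exact: derive_id.
Qed.

Lemma smooth_on_sub V W (A B : set V) (f : V -> W) :
  B `<=` A -> smooth_on A f -> smooth_on B f.
Proof.
move=> BA sf k; elim: k f {sf}(sf k) => [|k IH] f sf.
  by move=> x /BA; exact: sf.
by case: sf => df dvf; split=> [x /BA|v]; [exact: df|exact: (IH _ (dvf v))].
Qed.

Section Ops.
Context V (A : set V) (oA : open A).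

Lemma smooth_on_eq W (f g : V -> W) :
  (forall x, A x -> f x = g x) -> smooth_on A f -> smooth_on A g.
Proof. by move=> fg sf k; exact: Ck_on_eq fg (sf k). Qed.

Lemma smooth_onD W (f g : V -> W) :
  smooth_on A f -> smooth_on A g -> smooth_on A (fun x => f x + g x).
Proof. by move=> sf sg k; exact: Ck_onD. Qed.

Lemma smooth_onM (f g : V -> R) :
  smooth_on A f -> smooth_on A g -> smooth_on A (fun x => f x * g x).
Proof. by move=> sf sg k; exact: Ck_onM. Qed.

Lemma smooth_onV (f : V -> R) : (forall x, A x -> f x != 0) ->
  smooth_on A f -> smooth_on A (fun x => (f x)^-1).
Proof. by move=> f0 sf k; exact: Ck_onV. Qed.

Lemma smooth_on_sqrt (f : V -> R) : (forall x, A x -> 0 < f x) ->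
  smooth_on A f -> smooth_on A (fun x => Num.sqrt (f x)).
Proof. by move=> f0 sf k; exact: Ck_on_sqrt. Qed.

Lemma smooth_on_sum W I (r : seq I) (P : pred I) (F : I -> V -> W) :
  (forall i, smooth_on A (F i)) ->
  smooth_on A (fun x => \sum_(i <- r | P i) F i x).
Proof.
move=> sF; elim: r => [|i r IH].
  by apply: smooth_on_eq (smooth_on_cst A (0 : W)) => x _; rewrite big_nil.
case Pi: (P i).
  by apply: smooth_on_eq (smooth_onD (sF i) IH) => x _; rewrite big_cons Pi.
by apply: smooth_on_eq IH => x _; rewrite big_cons Pi.
Qed.

Lemma smooth_on_prod I (r : seq I) (P : pred I) (F : I -> V -> R) :
  (forall i, smooth_on A (F i)) ->
  smooth_on A (fun x => \prod_(i <- r | P i) F i x).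
Proof.
move=> sF; elim: r => [|i r IH].
  by apply: smooth_on_eq (smooth_on_cst A (1 : R)) => x _; rewrite big_nil.
case Pi: (P i).
  by apply: smooth_on_eq (smooth_onM (sF i) IH) => x _; rewrite big_cons Pi.
by apply: smooth_on_eq IH => x _; rewrite big_cons Pi.
Qed.

Lemma smooth_on_entry p q (f : V -> 'M[R]_(p, q)) i j :
  smooth_on A f -> smooth_on A (fun x => f x i j).
Proof.
apply: (@smooth_on_lin _ _ _ A f (fun M => M i j)) => //.
  by move=> a u v; rewrite !mxE.
exact: coord_continuous.
Qed.

Lemma smooth_on_mx p q (f : V -> 'M[R]_(p, q)) :
  (forall i j, smooth_on A (fun x => f x i j)) -> smooth_on A f.
Proof.
move=> sf.
have H i j : smooth_on A (fun x => f x i j *: (delta_mx i j : 'M[R]_(p, q))).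
  apply: (@smooth_on_lin _ _ _ A (fun x => f x i j) (fun a => a *: _)) => //.
    by move=> a u v; rewrite scalerDl scalerA.
  exact: scalel_continuous.
apply: smooth_on_eq (smooth_on_sum _ _ (fun i => smooth_on_sum _ _ (H i))).
by move=> x _; rewrite [RHS]matrix_sum_delta.
Qed.

Lemma smooth_on_mulmx p q r (f : V -> 'M[R]_(p, q)) (g : V -> 'M[R]_(q, r)) :
  smooth_on A f -> smooth_on A g -> smooth_on A (fun x => f x *m g x).
Proof.
move=> sf sg; apply: smooth_on_mx => i j.
have H k : smooth_on A (fun x => f x i k * g x k j).
  by apply: smooth_onM; exact: smooth_on_entry.
by apply: smooth_on_eq (smooth_on_sum _ _ H) => x _; rewrite mxE.
Qed.

Lemma smooth_onZ p q (f : V -> R) (g : V -> 'M[R]_(p, q)) :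
  smooth_on A f -> smooth_on A g -> smooth_on A (fun x => f x *: g x).
Proof.
move=> sf sg; apply: smooth_on_mx => i j.
have H := smooth_onM sf (smooth_on_entry i j sg).
by apply: smooth_on_eq H => x _; rewrite mxE.
Qed.

Lemma smooth_onN p q (g : V -> 'M[R]_(p, q)) :
  smooth_on A g -> smooth_on A (fun x => - g x).
Proof.
move=> sg; apply: smooth_on_eq (smooth_onZ (smooth_on_cst A (-1 : R)) sg).
by move=> x _; rewrite scaleN1r.
Qed.

Lemma smooth_on_trmx p q (f : V -> 'M[R]_(p, q)) :
  smooth_on A f -> smooth_on A (fun x => (f x)^T).
Proof.
move=> sf; apply: smooth_on_mx => i j.
by apply: smooth_on_eq (smooth_on_entry j i sf) => x _; rewrite mxE.
Qed.

Lemma smooth_on_det p (f : V -> 'M[R]_p) :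
  smooth_on A f -> smooth_on A (fun x => \det (f x)).
Proof.
move=> sf; apply: smooth_on_sum => s; apply: smooth_onM.
  exact: smooth_on_cst.
by apply: smooth_on_prod => i; exact: smooth_on_entry.
Qed.

Lemma smooth_on_invmx p (f : V -> 'M[R]_p) :
  (forall x, A x -> f x \in unitmx) ->
  smooth_on A f -> smooth_on A (fun x => invmx (f x)).
Proof.
move=> uf sf.
have sadj : smooth_on A (fun x => \adj (f x)).
  apply: smooth_on_mx => i j.
  have H : smooth_on A (fun x => cofactor (f x) j i).
    apply: smooth_onM; first exact: smooth_on_cst.
    apply: smooth_on_det; apply: smooth_on_mx => a b.
    apply: smooth_on_eq (smooth_on_entry (lift j a) (lift i b) sf) => x _.
    by rewrite !mxE.
  by apply: smooth_on_eq H => x _; rewrite mxE.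
have sdet : smooth_on A (fun x => (\det (f x))^-1).
  apply: smooth_onV; last exact: smooth_on_det.
  by move=> x Ax; have := uf x Ax; rewrite unitmxE unitfE.
apply: smooth_on_eq (smooth_onZ sdet sadj) => x Ax.
by rewrite /invmx uf.
Qed.

Lemma smooth_on_fst W W' (f : V -> W * W') :
  smooth_on A f -> smooth_on A (fun x => (f x).1).
Proof.
apply: (@smooth_on_lin _ _ _ A f fst) => //.
by move=> x; exact: cvg_fst.
Qed.

Lemma smooth_on_snd W W' (f : V -> W * W') :
  smooth_on A f -> smooth_on A (fun x => (f x).2).
Proof.
apply: (@smooth_on_lin _ _ _ A f snd) => //.
by move=> x; exact: cvg_snd.
Qed.

Lemma smooth_on_pair W W' (f : V -> W) (g : V -> W') :
  smooth_on A f -> smooth_on A g -> smooth_on A (fun x => (f x, g x)).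
Proof.
move=> sf sg.
have H1 : smooth_on A (fun x => (f x, 0 : W')).
  apply: (@smooth_on_lin _ _ _ A f (fun w => (w, 0))) => //.
    by move=> a u v; congr pair; rewrite /= scaler0 addr0.
  by move=> x; apply: cvg_pair; [exact: cvg_id|exact: cvg_cst].
have H2 : smooth_on A (fun x => (0 : W, g x)).
  apply: (@smooth_on_lin _ _ _ A g (fun w => (0, w))) => //.
    by move=> a u v; congr pair; rewrite /= scaler0 addr0.
  by move=> x; apply: cvg_pair; [exact: cvg_cst|exact: cvg_id].
apply: smooth_on_eq (smooth_onD H1 H2) => x _.
by congr pair; rewrite /= ?addr0 ?add0r.
Qed.

End Ops.

Lemma smooth_on_continuous V W (A : set V) (f : V -> W) x :
  smooth_on A f -> A x -> {for x, continuous f}.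
Proof. by move=> /(_ 0%N); apply. Qed.

Lemma smooth_on_differentiable V W (A : set V) (f : V -> W) x :
  smooth_on A f -> A x -> differentiable f x.
Proof. by move=> /(_ 1%N) [H _]; apply: H. Qed.

Lemma open_preimage_on V W (A : set V) (B : set W) (f : V -> W) :
  open A -> open B -> (forall x, A x -> {for x, continuous f}) ->
  open [set x | A x /\ B (f x)].
Proof.
move=> oA oB cf; rewrite openE => x [Ax Bfx].
near=> y; split; first by near: y; exact: open_nbhs_nbhs.
by near: y; apply: (cf x Ax); exact: open_nbhs_nbhs.
Unshelve. all: by end_near. Qed.

End SmoothOn.

(** * Lie subgroups covered by translates of one chart *)
Section EmbeddedLie.
Context (R : realType) (V : normedModType R) (d : nat).
Context (K : embedded_group V) (H : set V).
Context (U : set 'cV[R]_d) (phi : 'cV[R]_d -> V).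
Context (W : set V) (psi : V -> 'cV[R]_d) (g : nat -> V).

(** Closure under precomposition is what the chain rule would provide for a map
    smooth on an open set.  It also makes sense when B is not open, as for the
    inverse of K on the subgroup H. *)
Definition stably_smooth (V1 V2 : normedModType R) (B : set V1)
    (F : V1 -> V2) : Prop :=
  forall (E : normedModType R) (A : set E) (f : E -> V1), open A ->
    smooth_on A f -> (forall x, A x -> B (f x)) ->
    smooth_on A (fun x => F (f x)).

Hypothesis Hsub : H `<=` gcarrier K.
Hypothesis Hone : H (gone K).
Hypothesis Hmul : forall a b, H a -> H b -> H (gmul K a b).
Hypothesis Hinv : forall a, H a -> H (ginv K a).
Hypothesis mulK : forall a v, H a -> gmul K (ginv K a) (gmul K a v) = v.
Hypothesis mulVK : forall a v, H a -> gmul K a (gmul K (ginv K a) v) = v.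
Hypothesis mul_smooth :
  stably_smooth setT (fun p : V * V => gmul K p.1 p.2).
Hypothesis inv_smooth : stably_smooth H (ginv K).
Hypothesis oU : open U.
Hypothesis oW : open W.
Hypothesis phi_smooth : stably_smooth U phi.
Hypothesis psi_smooth : stably_smooth W psi.
Hypothesis phiP : forall u, U u -> [/\ H (phi u), W (phi u) & psi (phi u) = u].
Hypothesis psiP : forall h, H h -> W h -> U (psi h) /\ phi (psi h) = h.
Hypothesis Hg : forall i, H (g i).
Hypothesis gcover : forall h, H h -> exists i, W (gmul K (ginv K (g i)) h).

Let dom (i : nat) := U.
Let chart (i : nat) (u : 'cV[R]_d) := gmul K (g i) (phi u).
Let back (i : nat) (v : V) := gmul K (ginv K (g i)) v.

Let mulr_smooth (E : normedModType R) (A : set E) (f : E -> V) v : open A -> smooth_on A f ->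
  smooth_on A (fun x => gmul K v (f x)).
Proof.
move=> oA sf; apply: (mul_smooth (f := fun x => (v, f x))) => //.
by apply: smooth_on_pair => //; exact: smooth_on_cst.
Qed.

Let chart_s i : smooth_on U (chart i).
Proof.
apply: mulr_smooth => //.
by apply: (phi_smooth (f := id)) => //; exact: smooth_on_id.
Qed.

Let back_chart i u : back i (chart i u) = phi u.
Proof. exact: mulK. Qed.

Let chartH i u : U u -> H (chart i u).
Proof. by move=> /phiP[? _ _]; exact: Hmul. Qed.

Let open_back i : open [set v | W (back i v)].
Proof.
rewrite (_ : [set v | _] = [set v | setT v /\ W (back i v)]); last first.
  by apply/seteqP; split=> v; [|case].
apply: open_preimage_on => [||v _] //; first exact: openT.
apply: (@smooth_on_continuous _ _ _ setT) => //.
by apply: mulr_smooth; [exact: openT|exact: smooth_on_id].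
Qed.

Let smooth_back i : smooth_on [set v | W (back i v)] (fun v => psi (back i v)).
Proof.
have oP := open_back i; apply: (psi_smooth (f := back i)) => //.
by apply: mulr_smooth => //; exact: smooth_on_id.
Qed.

(** The differential of psi, translated, is a left inverse. *)
Let chart_imm i u : U u -> injective ('d (chart i) u : 'cV[R]_d -> V).
Proof.
move=> Uu.
pose P := [set v | W (back i v)].
have oP : open P := open_back i.
have sF : smooth_on P (fun v => psi (back i v)) := smooth_back i.
have Pu : P (chart i u) by rewrite /P /= back_chart; have [] := phiP Uu.
have dF := smooth_on_differentiable sF Pu.
have dc := smooth_on_differentiable (chart_s i) Uu.
have dcomp := diff_comp dc dF.
have did : 'd ((fun v => psi (back i v)) \o chart i) u = id :> (_ -> _).
  have dd : differentiable id u by exact: ex_diff.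
  apply/funext => v; rewrite -deriveE; last exact: differentiable_comp.
  rewrite -[RHS](@derive_id _ _ u v); apply: near_eq_derive.
  near=> w; rewrite /= back_chart.
  suff /phiP[_ _ ->] : U w by [].
  by near: w; exact: open_nbhs_nbhs.
move=> a b ab.
have : ('d ((fun v => psi (back i v)) \o chart i) u : _ -> _) a =
       ('d ((fun v => psi (back i v)) \o chart i) u : _ -> _) b.
  by rewrite dcomp /= ab.
by rewrite did.
Unshelve. all: by end_near. Qed.

Let chart_injP i u v : U u -> U v -> chart i u = chart i v -> u = v.
Proof.
move=> /phiP[_ _ uK] /phiP[_ _ vK] /(congr1 (back i)).
by rewrite !back_chart => /(congr1 psi); rewrite uK vK.
Qed.

Let chart_img j v : H v -> (chart j @` U) v <-> W (back j v).
Proof.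
move=> Hv; split=> [[u Uu <-]|Wv].
  by rewrite back_chart; have [] := phiP Uu.
have Hb : H (back j v) by apply: Hmul => //; apply: Hinv.
have [Uv pv] := psiP Hb Wv.
by exists (psi (back j v)) => //; rewrite /chart pv mulVK.
Qed.

Let chart_cov : \bigcup_i (chart i @` U) = H.
Proof.
apply/seteqP; split=> [v [i _ [u Uu <-]]|v Hv]; first exact: chartH.
have [i Wi] := gcover Hv; exists i => //; exact/chart_img.
Qed.

(** A smooth map into V with values in H is smooth into the atlas: its
    coordinates in the chart j are read by psi after translation by (g j)^-1. *)
Let into (E : normedModType R) (A : set E) (f : E -> V) : open A -> smooth_on A f ->
  (forall x, A x -> H (f x)) -> smooth_into dom chart A f.
Proof.
move=> oA sf fH j D.
have sb : smooth_on A (fun x => back j (f x)) by exact: mulr_smooth.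
have DE : D = [set x | A x /\ W (back j (f x))].
  by apply/seteqP; split=> x [Ax] /= Wx; split=> //; apply/(chart_img j (fH x Ax)).
have oD : open D.
  rewrite DE; apply: open_preimage_on => // x Ax.
  exact: smooth_on_continuous sb Ax.
have DA : D `<=` A by move=> x [].
split=> //; exists (fun x => psi (back j (f x))); split.
  apply: psi_smooth => //; last by rewrite DE => x [].
  exact: smooth_on_sub sb.
move=> x Dx; have Ax := DA _ Dx.
have Hb : H (back j (f x)) by apply: Hmul; [exact: Hinv|exact: fH].
have Wb : W (back j (f x)) by move: Dx; rewrite DE => -[].
have [Uv pv] := psiP Hb Wb.
by split => //; rewrite /chart pv mulVK.
Qed.

Definition translate_atlas : immersed_submanifold d H :=
  @ImmersedSubmanifold _ _ _ H dom chart (fun=> oU) chart_s chart_imm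
    chart_injP chart_cov (fun i => into oU (chart_s i) (@chartH i)).

Let oUU : open (U `*` U : set ('cV[R]_d * 'cV[R]_d)%type).
Proof.
by rewrite openE => -[a b] [/= Ua Ub]; exists (U, U) => //; split;
  exact: open_nbhs_nbhs.
Qed.

Let chart_fst i : smooth_on (U `*` U : set ('cV[R]_d * 'cV[R]_d)%type)
  (fun u => chart i u.1).
Proof.
apply: mulr_smooth => //; apply: phi_smooth => //.
  by apply: smooth_on_fst => //; exact: smooth_on_id.
by move=> x [].
Qed.

Let chart_snd i : smooth_on (U `*` U : set ('cV[R]_d * 'cV[R]_d)%type)
  (fun u => chart i u.2).
Proof.
apply: mulr_smooth => //; apply: phi_smooth => //.
  by apply: smooth_on_snd => //; exact: smooth_on_id.
by move=> x [].
Qed.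

(** For a compact subgroup H, one chart phi at the identity whose inverse psi extends
    smoothly to an open set W of the ambient space is enough: countably, even
    finitely many translates of it cover H. *)
Definition translate_lie_subgroup : lie_subgroup d K H.
Proof.
refine (@LieSubgroup _ _ _ K H Hsub Hone Hmul Hinv translate_atlas _ _).
  move=> i j.
  apply: into => //.
    apply: (mul_smooth (f := fun u => (chart i u.1, chart j u.2))) => //.
    exact: smooth_on_pair.
  by move=> x [Ux Uy]; apply: Hmul; exact: chartH.
move=> i; apply: into => //; last by move=> x Ux; apply: Hinv; exact: chartH.
by apply: inv_smooth => //; exact: chartH.
Defined.

(** The manifold topology of H is induced by V: around each point, the open sets
    of a chart are traces of preimages under the continuous map psi of the
    ambient space.  So a cluster point in V is a cluster point in H. *)
Lemma compact_translate_atlas : compact H ->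
  compact [set: immersed_space translate_atlas].
Proof.
move=> cH F FF _.
pose G : set_system V := (fun y : immersed_space translate_atlas => \val y) @ F.
have GH : G H by apply: (@filterS _ F _ setT) => [y _|]; [exact: set_valP|exact: filterT].
have [p [Hp clp]] := cH G _ GH.
have [i Wp] := gcover Hp.
pose y : immersed_space translate_atlas := exist _ p (mem_set Hp).
exists y; split=> // A B FA; rewrite nbhsE => -[Q [oQ0 Qy] QB].
have Hb : H (back i p) by apply: Hmul => //; exact: Hinv.
have [Uv pv] := psiP Hb Wp.
pose Oi := [set u | U u /\ exists2 z : immersed_space translate_atlas,
    Q z & \val z = chart i u].
have oOi : open Oi by exact: (oQ0 i).
pose P := [set v | W (back i v)].
have oP : open P := open_back i.
have sF : smooth_on P (fun v => psi (back i v)) := smooth_back i.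
have oQ : open [set v | P v /\ Oi (psi (back i v))].
  by apply: open_preimage_on => // x Px; exact: smooth_on_continuous sF Px.
have Qp : nbhs p [set v | P v /\ Oi (psi (back i v))].
  apply: open_nbhs_nbhs; split=> //; split=> //; split=> //.
  by exists y => //; rewrite /chart pv mulVK.
have GA : G [set v | exists2 z : immersed_space translate_atlas, A z & \val z = v].
  by apply: (@filterS _ F _ A) FA => z Az; exists z.
have [v [[z Az zv] [Pv [Upv [z' Oz' z'v]]]]] := clp _ _ GA Qp.
exists z; split=> //; apply: QB.
suff -> : z = z' by [].
apply: val_inj; rewrite zv z'v.
have Hv : H v by rewrite -zv; exact: set_valP.
have Hbv : H (back i v) by apply: Hmul => //; exact: Hinv.
by have [_ pbv] := psiP Hbv Pv; rewrite /chart pbv mulVK.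
Qed.

Lemma compact_identity_component : compact H ->
  compact (identity_component translate_lie_subgroup).
Proof.
move=> /compact_translate_atlas cT.
apply: subclosed_compact cT _ => //.
by apply: component_closed; exact: closedT.
Qed.

End EmbeddedLie.

(** * Absolutely continuous curves with small almost everywhere speed *)
Section AbsCont.
Context (R : realType).
Implicit Types V W : normedModType R.

(** The supremum of the points where P holds cannot be less than b.  This form of
    compactness provides partitions adapted to a gauge: each step from c to c'
    is tagged by a point t between them. *)
Lemma real_induction (P : R -> Prop) (a b : R) : a <= b -> P a ->
  (forall t, a <= t <= b -> exists2 d : R, 0 < d &
    forall c c', a <= c <= t -> t <= c' <= b -> t - d < c -> c' < t + d ->
      P c -> P c') ->
  P b.
Proof.
move=> ab Pa step.
pose S := [set c | a <= c <= b /\ P c].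
have Sa : S a by split; rewrite // lexx.
have ubS : ubound S b by move=> c [/andP[]].
have supS : has_sup S by split; [exists a|exists b].
have tab : a <= sup S <= b.
  by rewrite (ub_le_sup (ex_intro _ b ubS) Sa) ge_sup //; exists a.
have [d d0 H] := step _ tab.
have [c [cab Pc] ltc] := sup_adherent d0 supS.
have ct : c <= sup S by apply: ub_le_sup => //; exists b.
pose c' := Num.min b (sup S + d / 2).
have c'b : c' <= b by rewrite ge_min lexx.
have tc' : sup S <= c'.
  rewrite le_min; case/andP: tab => _ ->; rewrite lerDl ltW // divr_gt0 //.
have c'd : c' < sup S + d.
  rewrite gt_min; apply/orP; right; rewrite ltrD2l ltr_pdivrMr // mulr_natr.
  by rewrite mulr2n ltrDl.
have Pc' : P c'.
  apply: (H c c') => //; first by rewrite ct; case/andP: cab => ->.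
  by rewrite tc' c'b.
have : c' <= sup S.
  apply: ub_le_sup; first by exists b.
  split=> //; rewrite c'b andbT (le_trans _ tc') //; by case/andP: tab.
rewrite ge_min => /orP[bS|]; last first.
  by rewrite leNgt ltrDl divr_gt0.
suff <- : c' = b by [].
apply/eqP; rewrite eq_le c'b /=; exact: le_trans bS tc'.
Qed.

(** The upper derivative of f at t, within [a, b], is at most M. *)
Definition loc_lip V (f : R -> V) (a b M t : R) : Prop :=
  forall e : R, 0 < e -> exists2 d : R, 0 < d &
    forall s, a <= s <= b -> `|s - t| < d ->
      `|f s - f t| <= (M + e) * `|s - t|.

Lemma abs_continuous_seq V (f : R -> V) (a b e : R) : abs_continuous a b f ->
  0 < e -> exists2 d : R, 0 < d &
  forall l : seq (R * R),
    all (fun p => [&& a <= p.1, p.1 <= p.2 & p.2 <= b]) l ->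
    pairwise (fun p q : R * R => q.2 <= p.1) l ->
    \sum_(p <- l) (p.2 - p.1) < d ->
    \sum_(p <- l) `|f p.2 - f p.1| < e.
Proof.
move=> acf e0; have [d d0 H] := acf e e0; exists d => // l /allP la /pairwiseP lp.
rewrite !(big_nth (0, 0)) !big_mkord => ld.
apply: (H (size l) (fun i => (nth (0,0) l i).1) (fun i => (nth (0,0) l i).2)) => //.
  by move=> i; have /la/and3P[] : nth (0,0) l i \in l by exact: mem_nth.
have sep (i j : 'I_(size l)) x : (i < j)%N ->
    x \in `](nth (0,0) l i).1, (nth (0,0) l i).2[ ->
    x \in `](nth (0,0) l j).1, (nth (0,0) l j).2[ -> False.
  move=> ij; rewrite !in_itv /= => /andP[xi _] /andP[_ xj].
  have := lp (0, 0) i j (ltn_ord i) (ltn_ord j) ij.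
  by rewrite leNgt (lt_trans xi xj).
move=> i j _ _ [x [xi xj]]; apply: val_inj => /=.
by case: (ltngtP i j) => // ij; [case: (sep i j x)|case: (sep j i x)].
Qed.

Local Notation mu := (@lebesgue_measure R).

(** This replaces the fundamental theorem of calculus for absolutely continuous
    curves.  The exceptional null set is covered by an open set G of small
    measure.  Going from a to b by small steps, a step tagged by a good point
    contributes at most M + e times its length; the steps tagged by exceptional
    points lie in G, so that their total length is small and absolute continuity
    bounds their contribution. *)
Lemma abs_continuous_loc_lip V (f : R -> V) (a b M : R) : a <= b -> 0 <= M ->
  abs_continuous a b f ->
  (\forall t \ae mu, t \in `]a, b[ -> loc_lip f a b M t) ->
  `|f b - f a| <= M * (b - a).
Proof.
move=> ab M0 acf [N [mN N0 NP]].
apply/ler_addgt0Pr => e0 e0_gt0.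
pose e := e0 / (2 * (b - a + 1)).
have ba1 : 0 < b - a + 1 by rewrite ltr_wpDl // subr_ge0.
have e_gt0 : 0 < e by rewrite divr_gt0 // mulr_gt0.
have [d d0 Hd] := abs_continuous_seq acf (divr_gt0 e0_gt0 (ltr0n _ 2)).
(* The end points join the null set, as the hypothesis concerns ]a, b[ only. *)
pose N' := N `|` [set a; b].
have mN' : measurable N'.
  by apply: measurableU => //; apply: measurableU; exact: measurable_set1.
have N'0 : mu N' = 0%E.
  have nN : mu.-negligible N by exists N; split.
  have n1 x : mu.-negligible [set x].
    by exists [set x]; split => //; exact: lebesgue_measure_set1.
  apply: measure_negligible => //; apply: negligibleU => //.
  exact: negligibleU.
have [|G [oG N'G muG]] := lebesgue_regularity_outer mN' _ d0.
  have N'fin : (mu N' < +oo)%E by rewrite N'0 ltry.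
  exact: N'fin.
have mG : measurable G by exact: measurable_realfun.open_measurable.
have {}muG : (mu G < d%:E)%E.
  suff -> : mu G = mu (G `\` N') by [].
  transitivity (mu N' + mu (G `\` N'))%E; last by rewrite N'0 add0e.
  rewrite -{1}(setDUK N'G); apply: measureU; rewrite ?setDIK //.
  exact: measurableD.
(* l lists the steps tagged by exceptional points met between a and c. *)
pose P c := exists l : seq (R * R),
  [/\ all (fun p => [&& a <= p.1, p.1 <= p.2 & p.2 <= c]) l,
      pairwise (fun p q : R * R => q.2 <= p.1) l,
      ((\sum_(p <- l) (p.2 - p.1))%:E <= mu (G `&` `[a, c[))%E &
      `|f c - f a| <= (M + e) * (c - a) + \sum_(p <- l) `|f p.2 - f p.1|].
suff [l [la lp lG fl]] : P b.
  have lt_d : \sum_(p <- l) (p.2 - p.1) < d.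
    rewrite -lte_fin; apply: le_lt_trans muG; apply: le_trans lG _.
    by apply: le_measure; rewrite ?inE //; exact: measurableI.
  have := Hd l la lp lt_d => lt_e.
  apply: le_trans fl _; rewrite mulrDl -addrA lerD2l [leRHS]splitr lerD ?(ltW lt_e) //.
  have -> : e * (b - a) = e0 / 2 * ((b - a) / (b - a + 1)).
    by rewrite /e; field; exact: lt0r_neq0.
  rewrite ler_piMr ?divr_ge0 ?ltW //.
  by rewrite ltr_pdivrMr // mul1r ltrDl.
apply: (real_induction (P := P) ab).
  exists [::]; split=> //; first by rewrite big_nil.
  by rewrite big_nil !subrr normr0 mulr0 addr0.
have mono c c' : c <= c' -> (mu (G `&` `[a, c[) <= mu (G `&` `[a, c'[))%E.
  move=> cc'; apply: le_measure; rewrite ?inE; [exact: measurableI..|].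
  move=> x [Gx]; rewrite /= !in_itv /= => /andP[ax xc]; split=> //=.
  by rewrite ax (lt_le_trans xc).
have tri c c' : `|f c' - f a| <= `|f c - f a| + `|f c' - f c|.
  by rewrite -[f c' - f a](subrKA (f c)) addrC; exact: ler_normD.
move=> t tab; have [N't|nN't] := pselect (N' t).
  have Gt := N'G _ N't.
  have /nbhs_ballP[r /= r0 rG] : nbhs t G by exact: open_nbhs_nbhs.
  exists r => // c c' /andP[ac ct] /andP[tc' c'b] trc c'tr [l [la lp lG fl]].
  have cc' := le_trans ct tc'.
  exists ((c, c') :: l); split.
  - rewrite /= ac cc' lexx /=; apply: sub_all la => p /and3P[-> -> /=].
    by move=> /le_trans; apply.
  - rewrite /= lp andbT; apply: sub_all la => p /and3P[_ _].
    by [].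
  - rewrite big_cons /= EFinD addeC.
    have GE : G `&` `[a, c'[ = (G `&` `[a, c[) `|` `[c, c'[.
      apply/seteqP; split=> x /=; rewrite !in_itv /=.
        move=> [Gx /andP[ax xc']]; case: (ltP x c) => xc; [left|right].
          by rewrite ax.
        by rewrite xc'.
      move=> [[Gx /andP[ax xc]]|/andP[cx xc']].
        by rewrite ax (lt_le_trans xc).
      rewrite (le_trans ac cx) xc'; split=> //; apply: rG => /=.
      rewrite /ball /= ltr_distlC; apply/andP; split.
        by rewrite (lt_le_trans trc).
      by rewrite (lt_trans xc').
    have mGU : mu ((G `&` `[a, c[) `|` `[c, c'[) =
        (mu (G `&` `[a, c[) + mu `[c, c'[)%E.
      apply: measureU => //; first exact: measurableI.
      apply/seteqP; split=> x //= [[_]]; rewrite !in_itv /= => /andP[_ xc].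
      by rewrite leNgt xc.
    rewrite GE mGU; apply: leeD => //; rewrite lebesgue_measure_itv /= lte_fin.
    case: (ltP c c') => [_|c'c]; first by rewrite EFinB.
    by have -> : c' = c; [apply/eqP; rewrite eq_le c'c cc'|rewrite subrr].
  - rewrite big_cons /=; apply: le_trans (tri c c') _.
    rewrite addrCA addrC lerD2r; apply: le_trans fl _.
    by rewrite lerD2r ler_wpM2l ?lerD2r // addr_ge0 // ltW.
have tg : loc_lip f a b M t.
  apply: contrapT => nt; apply nN't; left; apply NP => /= H; apply: nt.
  apply: H; case/andP: tab => ta tb; rewrite in_itv /= !lt_neqAle ta tb !andbT.
  by apply/andP; split; apply/eqP => tE; apply nN't; right; [left|right].
have [r r0 Hr] := tg e e_gt0.
exists r => // c c' /andP[ac ct] /andP[tc' c'b] trc c'tr [l [la lp lG fl]].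
have cc' := le_trans ct tc'.
exists l; split=> //.
- apply: sub_all la => p /and3P[-> -> /=].
  by move=> /le_trans; apply.
- exact: le_trans lG (mono _ _ cc').
apply: le_trans (tri c c') _; rewrite -(addrC `|f c' - f c|).
have -> : (M + e) * (c' - a) = (M + e) * (c' - c) + (M + e) * (c - a) by ring.
rewrite -addrA lerD //.
rewrite -[f c' - f c](subrKA (f t)); apply: le_trans (ler_normD _ _) _.
have -> : c' - c = (c' - t) + (t - c) by ring.
rewrite mulrDr; apply: lerD.
  rewrite -[X in _ * X]ger0_norm ?subr_ge0 //; apply: Hr.
    by rewrite c'b (le_trans ac).
  by rewrite ger0_norm ?subr_ge0 // ltrBlDl.
rewrite distrC -[X in _ * X]ger0_norm ?subr_ge0 // [X in _ * X]distrC; apply: Hr.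
  by rewrite ac (le_trans cc' c'b).
by rewrite distrC ger0_norm ?subr_ge0 // ltrBlDl -ltrBlDr.
Qed.

End AbsCont.

(** * Derivatives of vector-valued curves *)
Section Derive.
Context (R : realType).
Implicit Types V W : normedModType R.

Lemma is_derive_lin V W (L : W -> V) (g : R -> W) (t : R) (w : W) :
  linear L -> continuous L -> is_derive t (1 : R) g w ->
  is_derive t (1 : R) (fun s => L (g s)) (L w).
Proof.
move=> linL cL [dg <-].
pose LM := GRing.isLinear.Build _ _ _ _ L linL.
pose L' : {linear W -> V} := HB.pack L LM.
have dg' : differentiable g t by exact/derivable1_diffP.
have dL : differentiable L' (g t) by exact: linear_differentiable.
have dc : differentiable (L' \o g) t by exact: differentiable_comp.
apply: DeriveDef; first exact/derivable1_diffP.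
rewrite (@deriveE _ _ _ (L' \o g)) // diff_comp //.
by rewrite -[LHS]/('d L' (g t) ('d g t 1)) diff_lin // -deriveE.
Qed.

Lemma is_derive_scalel V (f : R -> R) (v : V) (t df : R) :
  is_derive t (1 : R) f df -> is_derive t (1 : R) (fun s => f s *: v) (df *: v).
Proof.
apply: is_derive_lin (@scalel_continuous _ _ v).
by move=> a x y; rewrite scalerDl scalerA.
Qed.

Lemma is_derive_line V (x v : V) (t : R) :
  is_derive t (1 : R) (fun s => x + s *: v) v.
Proof.
have H := is_deriveD (is_derive_cst x t (1 : R)) (is_derive_scalel v (is_derive_id t (1 : R))).
by apply: is_derive_eq H _; rewrite add0r scale1r.
Qed.

Lemma is_derive_fst V W (f : R -> V * W) t w : is_derive t (1 : R) f w ->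
  is_derive t (1 : R) (fun s => (f s).1) w.1.
Proof.
apply: is_derive_lin => //.
by move=> x; exact: cvg_fst.
Qed.

Lemma is_derive_snd V W (f : R -> V * W) t w : is_derive t (1 : R) f w ->
  is_derive t (1 : R) (fun s => (f s).2) w.2.
Proof.
apply: is_derive_lin => //.
by move=> x; exact: cvg_snd.
Qed.

Lemma is_derive_pair V W (f : R -> V) (g : R -> W) t df dg :
  is_derive t (1 : R) f df -> is_derive t (1 : R) g dg ->
  is_derive t (1 : R) (fun s => (f s, g s)) (df, dg).
Proof.
move=> hf hg.
have h1 : is_derive t (1 : R) (fun s => (f s, 0 : W)) (df, 0).
  apply: (@is_derive_lin (V * W)%type _ (fun v => (v, 0 : W)) f) => //.
    by move=> a u v; congr pair; rewrite /= scaler0 addr0.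
  by move=> x; apply: cvg_pair; [exact: cvg_id|exact: cvg_cst].
have h2 : is_derive t (1 : R) (fun s => (0 : V, g s)) (0, dg).
  apply: (@is_derive_lin (V * W)%type _ (fun v => (0 : V, v)) g) => //.
    by move=> a u v; congr pair; rewrite /= scaler0 addr0.
  by move=> x; apply: cvg_pair; [exact: cvg_cst|exact: cvg_id].
have -> : (fun s => (f s, g s)) = (fun s => (f s, 0 : W)) + (fun s => (0 : V, g s)).
  by apply/funext => s; congr pair; rewrite /= ?addr0 ?add0r.
have -> : (df, dg) = (df, 0) + (0, dg).
  by congr pair; rewrite /= ?addr0 ?add0r.
exact: is_deriveD.
Qed.

Lemma is_derive_mxP p q (f : R -> 'M[R]_(p, q)) t df :
  is_derive t (1 : R) f df <->
  forall i j, is_derive t (1 : R) (fun s => f s i j) (df i j).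
Proof.
split=> [[hf <-] i j|H].
  have hij := (derivable_mxP _ _ _).1 hf i j.
  by apply: DeriveDef => //; rewrite derive_mx // mxE.
have hf : derivable f t 1 by apply/derivable_mxP => i j; have [] := H i j.
apply: DeriveDef => //; rewrite derive_mx //; apply/matrixP => i j; rewrite mxE.
by have [] := H i j.
Qed.

Lemma is_derive_mulmx p q r (f : R -> 'M[R]_(p, q)) (g : R -> 'M[R]_(q, r)) t df dg :
  is_derive t (1 : R) f df -> is_derive t (1 : R) g dg ->
  is_derive t (1 : R) (fun s => f s *m g s) (df *m g t + f t *m dg).
Proof.
move=> /is_derive_mxP hf /is_derive_mxP hg; apply/is_derive_mxP => i j.
have -> : (fun s => (f s *m g s) i j) = \sum_k (fun s => f s i k * g s k j).
  by apply/funext => s; rewrite mxE fct_sumE.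
have H : is_derive t (1 : R) (\sum_k (fun s => f s i k * g s k j))
    (\sum_k (f t i k *: dg k j + g t k j *: df i k)).
  by apply: is_derive_sum => k; exact: is_deriveM.
apply: is_derive_eq H _; rewrite !mxE -big_split; apply: eq_bigr => k _ /=.
by rewrite addrC [_ *: df _ _]mulrC.
Qed.

Lemma is_derive_trmx p q (f : R -> 'M[R]_(p, q)) t df :
  is_derive t (1 : R) f df -> is_derive t (1 : R) (fun s => (f s)^T) df^T.
Proof.
move=> /is_derive_mxP hf; apply/is_derive_mxP => i j.
under eq_fun do rewrite mxE; rewrite mxE; exact: hf.
Qed.

Lemma is_derive_approx V (f : R -> V) (t : R) w : is_derive t (1 : R) f w ->
  forall e : R, 0 < e -> exists2 d : R, 0 < d &
    forall s, `|s - t| < d -> `|f s - f t - (s - t) *: w| <= e * `|s - t|.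
Proof.
move=> [df <-] e e0; have := derivable_nbhs df => /eqaddoP/(_ e e0).
move=> /nbhs_ballP[d /= d0 H]; exists d => // s st.
have := H (s - t); rewrite /ball /= sub0r normrN => /(_ st).
rewrite !fctE /= opprD addrA => H'.
move: H'; congr (`|_ - _ - _| <= _); rewrite ?fctE //=.
by rewrite scaler1 subrK.
Qed.

Lemma approx_is_derive V (f : R -> V) (t : R) w :
  (forall e : R, 0 < e -> exists2 d : R, 0 < d &
    forall s, `|s - t| < d -> `|f s - f t - (s - t) *: w| <= e * `|s - t|) ->
  is_derive t (1 : R) f w.
Proof.
move=> H.
have cv : (fun h => h^-1 *: ((f \o shift t) (h *: (1 : R)) - f t)) @ 0^' --> w.
  apply/cvgrPdist_le => e e0; have [d d0 Hd] := H e e0.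
  near=> h; have h0 : h != 0 by near: h; exact: nbhs_dnbhs_neq.
  have hd : `|h| < d by near: h; exact: dnbhs0_lt.
  have := Hd (h + t); rewrite addrK => /(_ hd) /=.
  rewrite -normrN opprB => Hh.
  rewrite -[w](scalerK h0) -scalerBr normrZ normfV ler_pdivrMl ?normr_gt0 //.
  by rewrite mulrC [h *: 1]mulr1.
apply: DeriveDef; first by apply/cvg_ex; exists w.
exact/cvg_lim.
Unshelve. all: by end_near. Qed.

End Derive.

(** * Norms of matrices and operations on absolutely continuous curves *)
Section MxNorm.
Context (R : realType).

Lemma mx_norm_entry p q (M : 'M[R]_(p, q)) i j : `|M i j| <= `|M|.
Proof.
rewrite [leRHS]/Num.Def.normr /= mx_normrE.
exact: (le_bigmax _ (fun ij : 'I_p * 'I_q => `|M ij.1 ij.2|) (i, j)).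
Qed.

Lemma mx_norm_le p q (M : 'M[R]_(p, q)) c : 0 <= c ->
  (forall i j, `|M i j| <= c) -> `|M| <= c.
Proof.
move=> c0 H; rewrite [leLHS]/Num.Def.normr /= mx_normrE.
by apply: bigmax_le => // -[i j] _; exact: H.
Qed.

Lemma mx_norm_mul p q r (A : 'M[R]_(p, q)) (B : 'M[R]_(q, r)) :
  `|A *m B| <= q%:R * (`|A| * `|B|).
Proof.
apply: mx_norm_le => [|i j]; first by rewrite !mulr_ge0.
rewrite mxE; apply: le_trans (ler_norm_sum _ _ _) _.
apply: (@le_trans _ _ (\sum_(k < q) (`|A| * `|B|))).
  by apply: ler_sum => k _; rewrite normrM ler_pM // mx_norm_entry.
by rewrite sumr_const card_ord mulr_natl.
Qed.

End MxNorm.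

Section AbsContOps.
Context (R : realType).
Implicit Types V W E : normedModType R.

(** All the closure properties of absolute continuity follow from such a bound on
    increments. *)
Lemma abs_continuous_dom V W E (f : R -> V) (g : R -> W) (h : R -> E) (a b C : R) :
  0 <= C ->
  (forall s t, a <= s <= b -> a <= t <= b ->
     `|h s - h t| <= C * (`|f s - f t| + `|g s - g t|)) ->
  abs_continuous a b f -> abs_continuous a b g -> abs_continuous a b h.
Proof.
move=> C0 H acf acg e e0.
have C1 : 0 < 2 * (C + 1) by rewrite mulr_gt0 // ltr_wpDl.
have e'0 : 0 < e / (2 * (C + 1)) by rewrite divr_gt0.
have [df df0 Hf] := acf _ e'0; have [dg dg0 Hg] := acg _ e'0.
exists (Num.min df dg); first by rewrite lt_min df0.
move=> k s t st tI; rewrite lt_min => /andP[lf lg].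
apply: (@le_lt_trans _ _ (C * (\sum_(i < k) `|f (t i) - f (s i)| +
                               \sum_(i < k) `|g (t i) - g (s i)|))).
  rewrite -big_split mulr_sumr; apply: ler_sum => i _.
  have [as_ [st_ tb]] := st i.
  by apply: H; rewrite ?as_ ?tb ?(le_trans as_) ?(le_trans st_).
have := ltrD (Hf k s t st tI lf) (Hg k s t st tI lg).
set X := (X in X < _ -> _) => XX.
have X0 : 0 <= X by rewrite addr_ge0 // sumr_ge0.
apply: (@le_lt_trans _ _ ((C + 1) * X)); first by rewrite ler_wpM2r // lerDl.
have C2 : 0 < C + 1 by rewrite ltr_wpDl.
rewrite -ltr_pdivlMl //; apply: lt_le_trans XX _.
suff -> : e / (2 * (C + 1)) + e / (2 * (C + 1)) = (C + 1)^-1 * e by [].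
by field; exact: lt0r_neq0.
Qed.

Lemma abs_continuous_sub V (f : R -> V) (a b c d : R) : a <= c -> d <= b ->
  abs_continuous a b f -> abs_continuous c d f.
Proof.
move=> ac db acf e e0; have [r r0 H] := acf e e0; exists r => // k s t st.
apply: H => i; have [cs [st' td]] := st i.
by rewrite (le_trans ac cs) (le_trans td db).
Qed.

Lemma abs_continuous_point V (f : R -> V) (a b e : R) : 0 < e ->
  abs_continuous a b f -> exists2 d : R, 0 < d &
    forall s t, a <= s <= b -> a <= t <= b -> `|s - t| < d -> `|f s - f t| < e.
Proof.
move=> e0 acf; have [d d0 H] := acf e e0; exists d => // s t sab tab.
wlog st : s t sab tab / s <= t.
  move=> W; case: (leP s t) => [|/ltW] st std; first exact: W.
  by rewrite distrC; apply: W => //; rewrite distrC.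
rewrite distrC ger0_norm ?subr_ge0 // => std.
have := H 1%N (fun=> s) (fun=> t); rewrite !big_ord1 distrC; apply => //.
  by move=> _; case/andP: sab; case/andP: tab.
by move=> i j _ _ _; rewrite !ord1.
Qed.

Lemma abs_continuous_within V (f : R -> V) (a b : R) :
  abs_continuous a b f -> {within `[a, b], continuous f}.
Proof.
move=> acf; apply/subspace_continuousP => t /= tab.
apply/cvgrPdist_lt => e e0; have [d d0 H] := abs_continuous_point e0 acf.
rewrite near_withinE; near=> s => sab; apply: H.
- by move: tab; rewrite in_itv.
- by move: sab; rewrite /= in_itv.
- by near: s; apply: cvgr_dist_lt.
Unshelve. all: by end_near. Qed.

Lemma abs_continuous_max V (f : R -> V) (a b : R) : a <= b ->
  abs_continuous a b f ->
  exists2 c, a <= c <= b & forall s, a <= s <= b -> `|f s| <= `|f c|.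
Proof.
move=> ab acf; have cn : {within `[a, b], continuous (fun s => `|f s|)}.
  have cf := abs_continuous_within acf.
  by move=> s; apply: cvg_norm; exact: cf.
have [c cab H] := EVT_max ab cn.
by exists c => [|s sab]; [move: cab; rewrite in_itv|apply: H; rewrite in_itv].
Qed.

Lemma abs_continuous_bounded V (f : R -> V) (a b : R) :
  abs_continuous a b f ->
  exists2 M : R, 0 <= M & forall s, a <= s <= b -> `|f s| <= M.
Proof.
move=> acf; case: (leP a b) => [ab|ba].
  by have [c _ H] := abs_continuous_max ab acf; exists `|f c|.
by exists 0 => // s /andP[as_ sb]; move: ba; rewrite ltNge (le_trans as_ sb).
Qed.

Lemma mulmx_dist_le p q r (A A' : 'M[R]_(p, q)) (B B' : 'M[R]_(q, r)) (M : R) :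
  `|B| <= M -> `|A'| <= M ->
  `|A *m B - A' *m B'| <= q%:R * M * (`|A - A'| + `|B - B'|).
Proof.
move=> BM AM.
have M0 : 0 <= M by exact: le_trans BM.
have -> : A *m B - A' *m B' = (A - A') *m B + A' *m (B - B').
  by rewrite mulmxBl mulmxBr addrA subrK.
apply: le_trans (ler_normD _ _) _; rewrite mulrDr; apply: lerD.
  apply: le_trans (mx_norm_mul _ _) _.
  by rewrite -mulrA ler_wpM2l // mulrC ler_wpM2r.
apply: le_trans (mx_norm_mul _ _) _.
by rewrite -mulrA ler_wpM2l // ler_wpM2r.
Qed.

Lemma abs_continuous_mulmx p q r (f : R -> 'M[R]_(p, q)) (g : R -> 'M[R]_(q, r)) a b :
  abs_continuous a b f -> abs_continuous a b g ->
  abs_continuous a b (fun t => f t *m g t).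
Proof.
move=> acf acg.
have [M1 M10 H1] := abs_continuous_bounded acf.
have [M2 M20 H2] := abs_continuous_bounded acg.
apply: (@abs_continuous_dom _ _ _ f g _ a b (q%:R * (M1 + M2))) => //.
  by rewrite mulr_ge0 // addr_ge0.
move=> s t sab tab; apply: mulmx_dist_le.
  by apply: le_trans (H2 s sab) _; rewrite lerDr.
by apply: le_trans (H1 t tab) _; rewrite lerDl.
Qed.

Lemma abs_continuousD V (f g : R -> V) a b :
  abs_continuous a b f -> abs_continuous a b g ->
  abs_continuous a b (fun t => f t + g t).
Proof.
apply: (@abs_continuous_dom _ _ _ _ _ _ a b 1) => // s t _ _.
by rewrite mul1r opprD addrACA; exact: ler_normD.
Qed.

Lemma abs_continuous_lip V (f : R -> V) a b C : 0 <= C ->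
  (forall s t, a <= s <= b -> a <= t <= b -> `|f s - f t| <= C * `|s - t|) ->
  abs_continuous a b f.
Proof.
move=> C0 H.
have acid : abs_continuous a b (id : R -> R).
  move=> e e0; exists e => // k s t st _; apply: le_lt_trans.
  apply: ler_sum => i _; have [_ [st' _]] := st i.
  by rewrite ger0_norm // subr_ge0.
apply: (@abs_continuous_dom _ _ _ id id _ a b C) => // s t sab tab.
apply: le_trans (H s t sab tab) _; rewrite ler_wpM2l // lerDl //.
Qed.

Lemma abs_continuous_comp_lip V W (f : R -> V) (h : V -> W) a b C : 0 <= C ->
  (forall s t, a <= s <= b -> a <= t <= b ->
    `|h (f s) - h (f t)| <= C * `|f s - f t|) ->
  abs_continuous a b f -> abs_continuous a b (fun t => h (f t)).
Proof.
move=> C0 H acf.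
apply: (@abs_continuous_dom _ _ _ f f _ a b C) => // s t sab tab.
by apply: le_trans (H s t sab tab) _; rewrite ler_wpM2l // lerDl.
Qed.

Lemma abs_continuous_cst V (v : V) a b : abs_continuous a b (fun=> v : V).
Proof.
by apply: (@abs_continuous_lip V (fun=> v) a b 0) => // s t _ _; rewrite subrr normr0 mul0r.
Qed.

Lemma abs_continuous_sum V I (r : seq I) (F : I -> R -> V) a b :
  (forall i, abs_continuous a b (F i)) ->
  abs_continuous a b (fun t => \sum_(i <- r) F i t).
Proof.
move=> acF; elim: r => [|i r IH].
  rewrite (_ : (fun t => _) = fun=> 0); first exact: abs_continuous_cst.
  by apply/funext => t; rewrite big_nil.
rewrite (_ : (fun t => _) = fun t => F i t + \sum_(j <- r) F j t).
  exact: abs_continuousD.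
by apply/funext => t; rewrite big_cons.
Qed.

Lemma abs_continuous_trmx p q (f : R -> 'M[R]_(p, q)) a b :
  abs_continuous a b f -> abs_continuous a b (fun t => (f t)^T).
Proof.
apply: (@abs_continuous_comp_lip _ _ f trmx a b 1) => // s t _ _.
rewrite mul1r; apply: mx_norm_le => // i j.
by rewrite -linearB mxE mx_norm_entry.
Qed.

Lemma abs_continuous_fst V W (f : R -> V * W) a b :
  abs_continuous a b f -> abs_continuous a b (fun t => (f t).1).
Proof.
apply: (@abs_continuous_comp_lip _ _ f fst a b 1) => // s t _ _.
by rewrite mul1r [leRHS]prod_normE le_max lexx.
Qed.

Lemma abs_continuous_snd V W (f : R -> V * W) a b :
  abs_continuous a b f -> abs_continuous a b (fun t => (f t).2).
Proof.
apply: (@abs_continuous_comp_lip _ _ f snd a b 1) => // s t _ _.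
by rewrite mul1r [leRHS]prod_normE le_max lexx orbT.
Qed.

Lemma abs_continuous_pair V W (f : R -> V) (g : R -> W) a b :
  abs_continuous a b f -> abs_continuous a b g ->
  abs_continuous a b (fun t => (f t, g t)).
Proof.
apply: (@abs_continuous_dom _ _ _ _ _ _ a b 1) => // s t _ _.
by rewrite mul1r [leLHS]prod_normE ge_max lerDl lerDr !normr_ge0.
Qed.

Lemma is_derive_loc_lip V (f : R -> V) (a b M t : R) w :
  is_derive t (1 : R) f w -> `|w| <= M -> loc_lip f a b M t.
Proof.
move=> /is_derive_approx H wM e e0; have [d d0 Hd] := H e e0.
exists d => // s _ /Hd {}Hd.
rewrite -(subrK ((s - t) *: w) (f s - f t)); apply: le_trans (ler_normD _ _) _.
rewrite mulrDl addrC; apply: lerD => //.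
by rewrite normrZ mulrC ler_wpM2r.
Qed.

End AbsContOps.

(** * Lebesgue-almost every time *)
Section LebesgueAe.
Context (R : realType).
Implicit Types P Q : R -> Prop.

Lemma lebesgue_aeS P Q : (forall t, P t -> Q t) ->
  (\forall t \ae (@lebesgue_measure R), P t) ->
  \forall t \ae (@lebesgue_measure R), Q t.
Proof.
by move=> PQ [A [mA A0 PA]]; exists A; split=> // t nQ; apply: PA => /PQ.
Qed.

Lemma lebesgue_aeI P Q :
  (\forall t \ae (@lebesgue_measure R), P t) ->
  (\forall t \ae (@lebesgue_measure R), Q t) ->
  \forall t \ae (@lebesgue_measure R), P t /\ Q t.
Proof.
move=> nP nQ; have := negligibleU nP nQ; rewrite -setCI.
by [].
Qed.

Lemma lebesgue_aeT P : (forall t, P t) -> \forall t \ae (@lebesgue_measure R), P t.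
Proof.
by move=> HP; exists set0; split=> // t; apply; exact: HP.
Qed.

Lemma lebesgue_ae_forall n (P : 'I_n -> R -> Prop) :
  (forall i, \forall t \ae (@lebesgue_measure R), P i t) ->
  \forall t \ae (@lebesgue_measure R), forall i, P i t.
Proof.
move=> HP.
have H (s : seq 'I_n) : \forall t \ae (@lebesgue_measure R), forall i, i \in s -> P i t.
  elim: s => [|i s IH]; first exact: lebesgue_aeT.
  apply: lebesgue_aeS (lebesgue_aeI (HP i) IH) => t [Pi Ps] j.
  by rewrite inE => /orP[/eqP ->|/Ps].
apply: lebesgue_aeS (H (enum 'I_n)) => t Ht i.
by apply: Ht; rewrite mem_enum.
Qed.

Lemma lebesgue_ae_notin (s : seq R) :
  \forall t \ae (@lebesgue_measure R), t \notin s.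
Proof.
elim: s => [|x s IH]; first exact: lebesgue_aeT.
have Hx : \forall t \ae (@lebesgue_measure R), t != x.
  exists [set x]; split=> //; first exact: lebesgue_measure_set1.
  by move=> t /negP; rewrite negbK => /eqP.
apply: lebesgue_aeS (lebesgue_aeI Hx IH) => t [tx ts].
by rewrite inE negb_or tx.
Qed.

End LebesgueAe.

(** * Skew-symmetric matrices and the adjoint representation of SO(1+m) *)
Section Model.
Context (R : realType) (m : nat).
Local Notation N := (m + vdim m)%N.
Local Notation n := (1 + m)%N.

Lemma mulmx_cV_ext p q (A B : 'M[R]_(p, q)) :
  (forall z : 'cV[R]_q, A *m z = B *m z) -> A = B.
Proof.
move=> AB; apply/matrixP => i j.
by have := AB (delta_mx j 0); rewrite -!colE => /matrixP/(_ i 0); rewrite !mxE.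
Qed.

Definition skewp (a b : 'I_m) : 'M[R]_m := delta_mx a b - delta_mx b a.

Definition vert_skew (y : 'cV[R]_(vdim m)) : 'M[R]_m :=
  \sum_(p : pairs m) y (pair_index p) 0 *: skewp (val p).1 (val p).2.

(** The isomorphism S of R^N with so(1+m): the horizontal part fills the first
    row and column, the vertical part is the lower right skew block. *)
Definition toskew (z : 'cV[R]_N) : 'M[R]_n :=
  block_mx 0 (- (usubmx z)^T) (usubmx z) (vert_skew (dsubmx z)).

Definition ofskew (X : 'M[R]_n) : 'cV[R]_N :=
  col_mx (dlsubmx X)
    (\col_k (drsubmx X (val (index_pair k)).1 (val (index_pair k)).2)).

Lemma skewp_entry a b i j :
  skewp a b i j = ((i == a) && (j == b))%:R - ((i == b) && (j == a))%:R.
Proof. by rewrite !mxE. Qed.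

Lemma vert_skew_linear : linear vert_skew.
Proof.
move=> a u v; rewrite /vert_skew scaler_sumr -big_split /=.
by apply: eq_bigr => p _; rewrite !mxE scalerDl scalerA.
Qed.

Lemma vert_skew_entry y (p : pairs m) :
  vert_skew y (val p).1 (val p).2 = y (pair_index p) 0.
Proof.
rewrite /vert_skew summxE (bigD1 p) //= big1 => [|q qp].
  rewrite mxE skewp_entry !eqxx /= addr0.
  have -> : ((val p).1 == (val p).2) = false.
    by apply/negbTE; rewrite -val_eqE /= gtn_eqF // (valP p).
  by rewrite subr0 mulr1.
rewrite mxE skewp_entry.
have -> : ((val p).1 == (val q).1) && ((val p).2 == (val q).2) = false.
  apply/negbTE; apply: contra qp => /andP[/eqP e1 /eqP e2].
  by apply/eqP/val_inj; rewrite (surjective_pairing (val p)) e1 e2 -surjective_pairing.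
have -> : ((val p).1 == (val q).2) && ((val p).2 == (val q).1) = false.
  apply/negbTE/negP => /andP[/eqP e1 /eqP e2].
  have := valP p; have := valP q; rewrite /= -e1 -e2 => h1 h2.
  by have := ltn_trans h1 h2; rewrite ltnn.
by rewrite subrr mulr0.
Qed.

Lemma vert_skew_tr y : (vert_skew y)^T = - vert_skew y.
Proof.
rewrite /vert_skew linear_sum -sumrN; apply: eq_bigr => p _.
by rewrite linearZ /= linearB /= !trmx_delta -scalerN opprB.
Qed.

HB.instance Definition _ := GRing.isLinear.Build R _ _ _ vert_skew
  vert_skew_linear.

Lemma toskew_linear : linear toskew.
Proof.
move=> a u v; rewrite /toskew scale_block_mx add_block_mx !linearP /=.
by rewrite !scaler0 addr0.
Qed.

HB.instance Definition _ := GRing.isLinear.Build R _ _ _ toskew toskew_linear.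

Lemma ofskew_linear : linear ofskew.
Proof.
move=> a X Y; rewrite /ofskew scale_col_mx add_col_mx.
by congr col_mx; apply/matrixP => i j; rewrite !mxE.
Qed.

HB.instance Definition _ := GRing.isLinear.Build R _ _ _ ofskew ofskew_linear.

Lemma toskewK : cancel toskew ofskew.
Proof.
move=> z; rewrite /ofskew /toskew block_mxKdl block_mxKdr -[RHS]vsubmxK.
congr col_mx; apply/matrixP => k j; rewrite mxE vert_skew_entry index_pairK.
by rewrite ord1.
Qed.

Lemma toskew_tr z : (toskew z)^T = - toskew z.
Proof.
rewrite /toskew tr_block_mx opp_block_mx vert_skew_tr trmx0 oppr0 linearN /= trmxK.
by rewrite opprK.
Qed.

Lemma ofskewK X : X^T = - X -> toskew (ofskew X) = X.
Proof.
move=> Xskew; have XE i j : X j i = - X i j.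
  by have /matrixP/(_ i j) := Xskew; rewrite !mxE.
rewrite /toskew /ofskew col_mxKu col_mxKd -[RHS]submxK; congr block_mx.
- apply/matrixP => i j; rewrite !ord1 !mxE; have := XE (lshift m 0) (lshift m 0).
  by move=> /eqP; rewrite -addr_eq0 -mulr2n mulrn_eq0 /= => /eqP ->.
- by apply/matrixP => i j; rewrite !mxE -XE.
apply/matrixP => i j; set y := (\col_k _).
have yE (p : pairs m) : vert_skew y (val p).1 (val p).2 =
    drsubmx X (val p).1 (val p).2.
  by rewrite vert_skew_entry mxE pair_indexK.
case: (ltngtP i j) => [ij|ji|/val_inj ->].
- have := yE (exist _ (j, i) ij); rewrite /= => yji.
  have /matrixP/(_ j i) := vert_skew_tr y; rewrite 2!mxE yji => ->.
  by rewrite !mxE -XE.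
- exact: (yE (exist _ (i, j) ji)).
have /matrixP/(_ j j) := vert_skew_tr y; rewrite 2!mxE => /eqP.
rewrite -addr_eq0 -mulr2n mulrn_eq0 /= => /eqP ->.
have := XE (rshift 1 j) (rshift 1 j) => /eqP.
by rewrite -addr_eq0 -mulr2n mulrn_eq0 /= !mxE => /eqP ->.
Qed.

Lemma dot_vert (y z : 'cV[R]_(vdim m)) :
  \tr (vert_skew y *m vert_skew z) = - 2 * (y^T *m z) 0 0.
Proof.
rewrite {1}/vert_skew mulmx_suml linear_sum /= mxE mulr_sumr.
rewrite [RHS](reindex (@pair_index m)) /=; last first.
  by exists (@index_pair m) => ? _; [exact: pair_indexK|exact: index_pairK].
apply: eq_bigr => p _; rewrite mxE -scalemxAl linearZ /= mulmxBl linearB /=.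
have trE a b (X : 'M[R]_m) : \tr (delta_mx a b *m X) = X b a.
  rewrite /mxtrace (bigD1 a) //= big1 ?addr0 => [|i ia].
    rewrite mxE (bigD1 b) //= big1 ?addr0 => [|k kb]; first by rewrite mxE !eqxx mul1r.
    by rewrite mxE (negbTE kb) andbF mul0r.
  by rewrite mxE big1 // => k _; rewrite mxE (negbTE ia) mul0r.
rewrite !trE vert_skew_entry.
have /matrixP/(_ (val p).1 (val p).2) := vert_skew_tr z.
rewrite 2!mxE vert_skew_entry => ->; ring.
Qed.

(** Hence S is an isometry up to a factor for the conjugation-invariant trace
    form, which makes adj c orthogonal when c is. *)
Lemma dot_toskew (y z : 'cV[R]_N) :
  \tr (toskew y *m toskew z) = - 2 * (y^T *m z) 0 0.
Proof.
rewrite /toskew mulmx_block mxtrace_block !mul0mx !add0r.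
rewrite mulmxN linearD /= !linearN /= dot_vert mulNmx linearN /=.
have -> : \tr (usubmx y *m (usubmx z)^T) = ((usubmx y)^T *m usubmx z) 0 0.
  by rewrite mxtrace_mulC -[RHS]mulr1 -trace_mx11 -mxtrace_tr trmx_mul trmxK mulr1.
rewrite trace_mx11.
have -> : (y^T *m z) 0 0 = ((usubmx y)^T *m usubmx z) 0 0 +
    ((dsubmx y)^T *m dsubmx z) 0 0.
  by rewrite -{1}[y]vsubmxK -{1}[z]vsubmxK tr_col_mx mul_row_col mxE.
ring.
Qed.

(** The conjugation X |-> c X c^T of so(1+m), transported to R^N by S. *)
Definition adj (c : 'M[R]_n) : 'M[R]_N :=
  \matrix_(i, j) ofskew (c *m toskew (delta_mx j 0) *m c^T) i 0.

Lemma adjE c z : adj c *m z = ofskew (c *m toskew z *m c^T).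
Proof.
rewrite [in RHS](matrix_sum_delta z); apply/matrixP => i j; rewrite !ord1.
rewrite linear_sum /= mulmx_sumr mulmx_suml linear_sum summxE mxE.
apply: eq_bigr => k _; rewrite big_ord1 linearZ /= -scalemxAr -scalemxAl linearZ /=.
by rewrite !mxE mulrC.
Qed.

Lemma conj_skew (c X : 'M[R]_n) : X^T = - X -> (c *m X *m c^T)^T = - (c *m X *m c^T).
Proof. by move=> Xs; rewrite !trmx_mul trmxK Xs mulNmx mulmxN mulmxA. Qed.

Lemma toskew_adj c z : toskew (adj c *m z) = c *m toskew z *m c^T.
Proof. by rewrite adjE ofskewK // conj_skew // toskew_tr. Qed.

Lemma adjM c c' : adj (c *m c') = adj c *m adj c'.
Proof.
apply: mulmx_cV_ext => z; rewrite -mulmxA [RHS]adjE toskew_adj adjE trmx_mul.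
by rewrite !mulmxA.
Qed.

Lemma adj1 : adj 1%:M = 1%:M.
Proof.
by apply: mulmx_cV_ext => z; rewrite adjE trmx1 mul1mx mulmx1 toskewK mul1mx.
Qed.

Lemma dot_sym (y z : 'cV[R]_N) : (y^T *m z) 0 0 = (z^T *m y) 0 0.
Proof. by rewrite -[LHS]trace_mx11 -mxtrace_tr trmx_mul trmxK trace_mx11. Qed.

Lemma adj_tr c : (adj c)^T = adj c^T.
Proof.
apply: mulmx_cV_ext => z; apply/matrixP => i j; rewrite ord1.
have key (y w : 'cV[R]_N) : (y^T *m ((adj c)^T *m w)) 0 0 = (y^T *m (adj c^T *m w)) 0 0.
  apply: (@mulfI _ (- 2)); first by rewrite oppr_eq0 pnatr_eq0.
  rewrite mulmxA -trmx_mul -!dot_toskew !toskew_adj.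
  by rewrite trmxK !mulmxA [RHS]mxtrace_mulC !mulmxA.
have rE (v : 'cV[R]_N) : ((delta_mx i 0)^T *m v) 0 0 = v i 0.
  rewrite mxE (bigD1 i) //= !mxE !eqxx mul1r big1 ?addr0 // => k ki.
  by rewrite !mxE (negbTE ki) mul0r.
by have := key (delta_mx i 0) z; rewrite !rE.
Qed.

End Model.

(** * The Cayley transform *)
Section Cayley.
Context (R : realType) (n : nat).
Implicit Types X c : 'M[R]_n.

(** If v (1 + X) = 0 then the norm of v is zero, because the quadratic form of a
    skew matrix vanishes. *)
Lemma skew_unitmx X : X^T = - X -> 1%:M + X \in unitmx.
Proof.
move=> Xs; rewrite unitmxE unitfE; apply/negP => /det0P[v v0 /(congr1 (mulmx^~ v^T))].
rewrite mul0mx mulmxDr mulmx1 mulmxDl => /matrixP/(_ 0 0).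
have vXv : (v *m X *m v^T) 0 0 = 0.
  have : (v *m X *m v^T) 0 0 = - (v *m X *m v^T) 0 0.
    rewrite -{1}[_ 0 0]trace_mx11 -mxtrace_tr !trmx_mul trmxK Xs mulNmx mulmxN mulmxA.
    by rewrite linearN /= trace_mx11.
  by move=> /eqP; rewrite -addr_eq0 -mulr2n mulrn_eq0 /= => /eqP.
rewrite mxE vXv addr0 !mxE => /eqP; rewrite psumr_eq0; last first.
  by move=> i _; rewrite mxE -expr2 sqr_ge0.
move=> /allP H; move/negP: v0; apply; apply/eqP/rowP => i.
have := H i (mem_index_enum i); rewrite /= !mxE -expr2 sqrf_eq0 => /eqP.
by [].
Qed.

Definition cayley X := (1%:M - X) *m invmx (1%:M + X).

Lemma cayley_mul X : 1%:M + X \in unitmx -> cayley X *m (1%:M + X) = 1%:M - X.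
Proof. by move=> uX; rewrite mulmxKV. Qed.

Lemma cayley_unit X : 1%:M + X \in unitmx ->
  1%:M + cayley X = 2 *: invmx (1%:M + X).
Proof.
move=> uX; rewrite -{1}(mulmxV uX) -mulmxDl.
have -> : 1%:M + X + (1%:M - X) = 2 *: 1%:M.
  by apply/matrixP => i j; rewrite !mxE; ring.
by rewrite -scalemxAl mul1mx.
Qed.

Lemma cayley_unitmx X : 1%:M + X \in unitmx -> 1%:M + cayley X \in unitmx.
Proof.
by move=> uX; rewrite cayley_unit // unitmxZ ?unitfE ?pnatr_eq0 // unitmx_inv.
Qed.

Lemma cayleyK X : 1%:M + X \in unitmx -> cayley (cayley X) = X.
Proof.
move=> uX; have uc := cayley_unitmx uX.
apply: (can_inj (mulmxK uc)); rewrite cayley_mul // cayley_unit //.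
have -> : 1%:M - cayley X = 2 *: (X *m invmx (1%:M + X)).
  rewrite -{1}(mulmxV uX) -mulmxBl opprB [1%:M + X + _]addrC addrA subrK.
  by rewrite -mulr2n -scaler_nat -scalemxAl.
by rewrite -scalemxAr.
Qed.

(** Orthogonality holds as the two factors of the Cayley transform commute; for
    the determinant, 1 - X is the transpose of 1 + X. *)
Lemma cayley_SO X : X^T = - X ->
  (cayley X)^T *m cayley X = 1%:M /\ \det (cayley X) = 1.
Proof.
move=> Xs; have uX := skew_unitmx Xs.
have trX : (1%:M + X)^T = 1%:M - X by rewrite linearD /= trmx1 Xs.
have trX' : (1%:M - X)^T = 1%:M + X by rewrite linearB /= trmx1 Xs opprK.
have uX' : 1%:M - X \in unitmx by rewrite -trX unitmx_tr.
split.
  rewrite /cayley trmx_mul trmx_inv trX trX' mulmxA -[_ *m (1%:M - X)]mulmxA.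
  have -> : (1%:M + X) *m (1%:M - X) = (1%:M - X) *m (1%:M + X).
    by rewrite mulmxBr mulmxBl mulmx1 mul1mx mulmxDl mulmxDr mul1mx mulmx1.
  by rewrite mulmxA mulVmx // mul1mx mulmxV.
rewrite det_mulmx det_inv -trX det_tr mulfV //.
by move: uX; rewrite unitmxE unitfE.
Qed.

Lemma cayley_skew c : c^T *m c = 1%:M -> 1%:M + c \in unitmx ->
  (cayley c)^T = - cayley c.
Proof.
move=> cc uc; apply: (can_inj (mulmxK uc)); rewrite mulNmx cayley_mul //.
have uct : (1%:M + c)^T \in unitmx by rewrite unitmx_tr.
apply: (can_inj (mulKmx uct)); rewrite mulmxA -trmx_mul cayley_mul //.
rewrite [(1%:M - c)^T]linearB [(1%:M + c)^T]linearD /= trmx1.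
rewrite mulmxBl mul1mx mulmxDr mulmx1 cc.
rewrite mulmxN mulmxDl mul1mx mulmxBr mulmx1 cc.
by apply/matrixP => i j; rewrite !mxE; ring.
Qed.

End Cayley.

(** * A chart of adj(SO(1+m)) at the identity *)
Section ChartData.
Context (R : realType) (m : nat) (hm : (2 <= m)%N).
Local Notation N := (m + vdim m)%N.
Local Notation n := (1 + m)%N.

Definition skewn (j k : 'I_n) : 'M[R]_n := delta_mx j k - delta_mx k j.

Lemma skewn_tr j k : (skewn j k)^T = - skewn j k.
Proof. by rewrite linearB /= !trmx_delta opprB. Qed.

(** The elementary matrices are quadratic in the skew ones, because n > 2; so the
    conjugates of elementary matrices by c can be read off from adj c. *)
Lemma sum_skewn j l : \sum_k skewn j k *m skewn k l =
  (n%:R - 2) *: delta_mx j l + (j == l)%:R *: 1%:M.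
Proof.
have H k : skewn j k *m skewn k l = delta_mx j l
   - (k == l)%:R *: delta_mx j l - (j == k)%:R *: delta_mx j l
   + (j == l)%:R *: delta_mx k k.
  rewrite /skewn mulmxBl !mulmxBr !mul_delta_mx_cond eqxx mulr1n.
  have -> : (delta_mx j k : 'M[R]_n) *+ (k == l) = (k == l)%:R *: delta_mx j l.
    by case: eqP => [->|_]; rewrite ?scale1r ?scale0r.
  have -> : (delta_mx k l : 'M[R]_n) *+ (j == k) = (j == k)%:R *: delta_mx j l.
    by case: eqP => [->|_]; rewrite ?scale1r ?scale0r.
  have -> : (delta_mx k k : 'M[R]_n) *+ (j == l) = (j == l)%:R *: delta_mx k k.
    by rewrite scaler_nat.
  by rewrite opprB [_ - (j == k)%:R *: _]addrC addrA.
under eq_bigr do rewrite H.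
rewrite big_split /= -scaler_sumr !sumrB /= sumr_const card_ord -!scaler_suml.
have d1 (i : 'I_n) : \sum_(k < n) (k == i)%:R = 1 :> R.
  by rewrite (bigD1 i) //= eqxx big1 ?addr0 // => k /negbTE ->.
have d2 (i : 'I_n) : \sum_(k < n) (i == k)%:R = 1 :> R.
  by rewrite -[RHS](d1 i); apply: eq_bigr => k _; rewrite eq_sym.
rewrite d1 d2 -scaler_nat -!scalerBl; congr (_ *: _ + _ *: _); first by ring.
apply/matrixP => a b; rewrite summxE mxE (bigD1 a) //= big1 ?addr0.
  by rewrite mxE eqxx [b == a]eq_sym.
by move=> k /negbTE ka; rewrite mxE eq_sym ka.
Qed.

Definition conj_of (C : 'M[R]_N) (E : 'M[R]_n) : 'M[R]_n :=
  toskew (C *m ofskew E).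

Lemma conj_of_adj c E : E^T = - E -> conj_of (adj c) E = c *m E *m c^T.
Proof. by move=> Es; rewrite /conj_of toskew_adj ofskewK. Qed.

(** The value c E_j0 c^T at C = adj c, by sum_skewn. *)
Definition unit_conj (C : 'M[R]_N) (j : 'I_n) : 'M[R]_n :=
  (n%:R - 2)^-1 *: (\sum_k conj_of C (skewn j k) *m conj_of C (skewn k 0)
                   - (j == 0)%:R *: 1%:M).

Lemma unit_conj_adj c j : c^T *m c = 1%:M ->
  unit_conj (adj c) j = c *m delta_mx j 0 *m c^T.
Proof.
move=> cc; have cc' : c *m c^T = 1%:M by exact: mulmx1C.
have n2 : n%:R - 2 != 0 :> R.
  by rewrite subr_eq0 eqr_nat gtn_eqF // add1n ltnS.
rewrite /unit_conj; under eq_bigr do rewrite !conj_of_adj ?skewn_tr //.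
have -> : \sum_k c *m skewn j k *m c^T *m (c *m skewn k 0 *m c^T) =
    c *m (\sum_k skewn j k *m skewn k 0) *m c^T.
  rewrite mulmx_sumr mulmx_suml; apply: eq_bigr => k _.
  by rewrite !mulmxA -[_ *m c^T *m c]mulmxA cc mulmx1.
rewrite sum_skewn mulmxDr mulmxDl -!scalemxAr -!scalemxAl mulmx1 cc' addrK.
by rewrite scalerA mulVf // scale1r.
Qed.

Definition entry_of (C : 'M[R]_N) : 'M[R]_n :=
  \matrix_(i, j) unit_conj C j i 0.

(** The (i, 0) entry of c E_j0 c^T is c_ij c_00.  As adj (-c) = adj c, the matrix
    c itself cannot be recovered. *)
Lemma entry_of_adj c : c^T *m c = 1%:M -> entry_of (adj c) = c 0 0 *: c.
Proof.
move=> cc; apply/matrixP => i j; rewrite mxE unit_conj_adj // -mulmxA !mxE.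
rewrite (bigD1 j) //= big1 ?addr0 => [|k kj]; last first.
  rewrite mxE big1 ?mulr0 // => l _; rewrite mxE (negbTE kj) mul0r //.
rewrite mxE (bigD1 0) //= big1 ?addr0 => [|k k0]; last first.
  by rewrite mxE (negbTE k0) andbF mul0r.
by rewrite !mxE !eqxx mul1r mulrC.
Qed.

(** Divides c_00 c by the absolute value of c_00: among c and -c, this selects the
    one with a positive corner. *)
Definition lift_of (C : 'M[R]_N) : 'M[R]_n :=
  (Num.sqrt (entry_of C 0 0))^-1 *: entry_of C.

Definition chart_at1 (u : 'cV[R]_N) : 'M[R]_N := adj (cayley (toskew u)).
Definition chart_at1_dom : set 'cV[R]_N :=
  [set u | 0 < cayley (toskew u) 0 0].
Definition chart_at1_inv (C : 'M[R]_N) : 'cV[R]_N := ofskew (cayley (lift_of C)).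
(** An open set of all matrices, on which chart_at1_inv is smooth: the square root
    is taken of a positive number and the Cayley transform is defined. *)
Definition chart_at1_nbhs : set 'M[R]_N :=
  [set C | 0 < entry_of C 0 0 /\ \det (1%:M + lift_of C) != 0].

Definition adjSO : set 'M[R]_N := adj (m := m) @` gcarrier (SO R n).

Lemma adjZ (a : R) c : adj (m := m) (a *: c) = a ^+ 2 *: adj c.
Proof.
apply: mulmx_cV_ext => z; rewrite -scalemxAl !adjE linearZ /=.
by rewrite -!scalemxAl -scalemxAr scalerA linearZ expr2.
Qed.

Lemma lift_of_adj c : c^T *m c = 1%:M -> 0 < entry_of (adj c) 0 0 ->
  [/\ (lift_of (adj c))^T *m lift_of (adj c) = 1%:M,
      adj (lift_of (adj c)) = adj c, 0 < lift_of (adj c) 0 0 &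
      (0 < c 0 0 -> lift_of (adj c) = c)].
Proof.
move=> cc; rewrite /lift_of entry_of_adj // mxE -expr2 => c0.
rewrite sqrtr_sqr scalerA; set s := _^-1 * _.
have n0 : 0 < `|c 0 0| by rewrite normr_gt0 -sqrf_eq0 gt_eqF.
have s2 : s ^+ 2 = 1.
  by rewrite exprMn exprVn real_normK ?num_real // mulVf // gt_eqF.
split.
- by rewrite [(s *: c)^T]linearZ /= -scalemxAl -scalemxAr scalerA -expr2 s2 scale1r.
- by rewrite adjZ s2 scale1r.
- by rewrite mxE /s -mulrA -expr2 -real_normK ?num_real // expr2 mulrA mulVf ?mul1r // gt_eqF.
by move=> cp; rewrite /s ger0_norm ?(ltW cp) // mulVf ?scale1r // gt_eqF.
Qed.

Lemma chart_at1P u : chart_at1_dom u ->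
  [/\ adjSO (chart_at1 u), chart_at1_nbhs (chart_at1 u) &
      chart_at1_inv (chart_at1 u) = u].
Proof.
move=> /= Uu; have us := toskew_tr u; have uu := skew_unitmx us.
have [cc dc] := cayley_SO us.
have c00 : 0 < entry_of (chart_at1 u) 0 0.
  by rewrite entry_of_adj // mxE -expr2 exprn_gt0.
have [_ _ _ /(_ Uu) lE] := lift_of_adj cc c00.
split; first by exists (cayley (toskew u)).
  split => //; rewrite lE.
  by have := cayley_unitmx uu; rewrite unitmxE unitfE.
by rewrite /chart_at1_inv lE cayleyK // toskewK.
Qed.

Lemma chart_at1_invP C : adjSO C -> chart_at1_nbhs C ->
  chart_at1_dom (chart_at1_inv C) /\ chart_at1 (chart_at1_inv C) = C.
Proof.
move=> [c [cc _] <-] [c00 d0]; have [lo la lp _] := lift_of_adj cc c00.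
have ul : 1%:M + lift_of (adj c) \in unitmx by rewrite unitmxE unitfE.
have E : toskew (chart_at1_inv (adj c)) = cayley (lift_of (adj c)).
  by rewrite ofskewK // cayley_skew.
by rewrite /chart_at1_dom /chart_at1 /= E cayleyK.
Qed.

End ChartData.

(** * Smoothness of the chart and of its inverse *)
Section SmoothBlock.
Context (R : realType) (V : normedModType R) (A : set V) (oA : open A).

Lemma smooth_on_col_mx p q r (f : V -> 'M[R]_(p, r)) (g : V -> 'M[R]_(q, r)) :
  smooth_on A f -> smooth_on A g -> smooth_on A (fun x => col_mx (f x) (g x)).
Proof.
move=> sf sg; apply: smooth_on_mx => // i j.
rewrite -(fintype.splitK i); case: (fintype.split i) => i' /=.
  apply: smooth_on_eq (smooth_on_entry oA i' j sf) => // x _.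
  by rewrite col_mxEu.
apply: smooth_on_eq (smooth_on_entry oA i' j sg) => // x _.
by rewrite col_mxEd.
Qed.

Lemma smooth_on_row_mx p q r (f : V -> 'M[R]_(r, p)) (g : V -> 'M[R]_(r, q)) :
  smooth_on A f -> smooth_on A g -> smooth_on A (fun x => row_mx (f x) (g x)).
Proof.
move=> sf sg; have H := smooth_on_col_mx (smooth_on_trmx oA sf) (smooth_on_trmx oA sg).
by apply: smooth_on_eq (smooth_on_trmx oA H) => // x _; rewrite tr_col_mx !trmxK.
Qed.

Lemma smooth_on_mxsub p q p' q' (f : V -> 'M[R]_(p, q))
    (g : V -> 'M[R]_(p', q')) (a : 'I_p' -> 'I_p) (b : 'I_q' -> 'I_q) :
  (forall x, g x = mxsub a b (f x)) -> smooth_on A f -> smooth_on A g.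
Proof.
move=> gE sf; apply: smooth_on_mx => // i j.
apply: smooth_on_eq (smooth_on_entry oA (a i) (b j) sf) => // x _.
by rewrite gE mxE.
Qed.

Lemma smooth_on_usubmx p q r (f : V -> 'M[R]_(p + q, r)) :
  smooth_on A f -> smooth_on A (fun x => usubmx (f x)).
Proof. by apply: smooth_on_mxsub => x; apply/matrixP => i j; rewrite !mxE. Qed.

Lemma smooth_on_dsubmx p q r (f : V -> 'M[R]_(p + q, r)) :
  smooth_on A f -> smooth_on A (fun x => dsubmx (f x)).
Proof. by apply: smooth_on_mxsub => x; apply/matrixP => i j; rewrite !mxE. Qed.

End SmoothBlock.

Section ChartSmooth.
Context (R : realType) (m : nat).
Local Notation N := (m + vdim m)%N.
Local Notation n := (1 + m)%N.

Section On.
Context (V : normedModType R) (A : set V) (oA : open A).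

Lemma smooth_on_toskew (f : V -> 'cV[R]_N) :
  smooth_on A f -> smooth_on A (fun x => toskew (f x)).
Proof.
move=> sf; have su := smooth_on_usubmx oA sf.
apply: smooth_on_col_mx => //; apply: smooth_on_row_mx => //.
- exact: smooth_on_cst.
- by apply: smooth_onN => //; exact: smooth_on_trmx.
apply: smooth_on_sum => // p; apply: smooth_onZ => //; last exact: smooth_on_cst.
by apply: smooth_on_entry => //; exact: smooth_on_dsubmx.
Qed.

Lemma smooth_on_ofskew (f : V -> 'M[R]_n) :
  smooth_on A f -> smooth_on A (fun x => ofskew (f x)).
Proof.
move=> sf; apply: smooth_on_col_mx => //.
  by apply: smooth_on_mxsub sf => // x; apply/matrixP => i j; rewrite !mxE.
apply: smooth_on_mx => // k j.
pose p := val (index_pair k).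
apply: smooth_on_eq (smooth_on_entry oA (rshift 1 p.1) (rshift 1 p.2) sf) => //.
by move=> x _; rewrite !mxE.
Qed.

Lemma smooth_on_adj (f : V -> 'M[R]_n) :
  smooth_on A f -> smooth_on A (fun x => adj (f x)).
Proof.
move=> sf; apply: smooth_on_mx => // i j.
have H : smooth_on A (fun x => ofskew (f x *m toskew (delta_mx j 0) *m (f x)^T)).
  apply: smooth_on_ofskew; apply: smooth_on_mulmx => //.
    by apply: smooth_on_mulmx => //; exact: smooth_on_cst.
  exact: smooth_on_trmx.
by apply: smooth_on_eq (smooth_on_entry oA i 0 H) => // x _; rewrite [RHS]mxE.
Qed.

Lemma smooth_on_cayley p (f : V -> 'M[R]_p) :
  (forall x, A x -> 1%:M + f x \in unitmx) ->
  smooth_on A f -> smooth_on A (fun x => cayley (f x)).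
Proof.
move=> uf sf; apply: smooth_on_mulmx => //.
  by apply: smooth_onD => //; [exact: smooth_on_cst|exact: smooth_onN].
by apply: smooth_on_invmx => //; apply: smooth_onD => //; exact: smooth_on_cst.
Qed.

Lemma smooth_on_chart_at1 (f : V -> 'cV[R]_N) :
  smooth_on A f -> smooth_on A (fun x => chart_at1 (f x)).
Proof.
move=> sf; apply: smooth_on_adj; apply: smooth_on_cayley.
  by move=> x _; apply: skew_unitmx; exact: toskew_tr.
exact: smooth_on_toskew.
Qed.

Lemma smooth_on_entry_of (f : V -> 'M[R]_N) :
  smooth_on A f -> smooth_on A (fun x => entry_of (f x)).
Proof.
move=> sf; have sc E : smooth_on A (fun x => conj_of (f x) E).
  apply: smooth_on_toskew; apply: smooth_on_mulmx => //; exact: smooth_on_cst.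
apply: smooth_on_mx => // i j.
have H : smooth_on A (fun x => unit_conj (f x) j).
  apply: smooth_onZ => //; first exact: smooth_on_cst.
  apply: smooth_onD => //; last exact: smooth_on_cst.
  by apply: smooth_on_sum => // k; exact: smooth_on_mulmx.
by apply: smooth_on_eq (smooth_on_entry oA i 0 H) => // x _; rewrite [RHS]mxE.
Qed.

Lemma smooth_on_lift_of (f : V -> 'M[R]_N) :
  (forall x, A x -> 0 < entry_of (f x) 0 0) ->
  smooth_on A f -> smooth_on A (fun x => lift_of (f x)).
Proof.
move=> f0 sf; have se := smooth_on_entry_of sf.
apply: smooth_onZ => //; apply: smooth_onV => //.
  by move=> x Ax; rewrite gt_eqF // sqrtr_gt0 f0.
by apply: smooth_on_sqrt => //; exact: smooth_on_entry.
Qed.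

Lemma smooth_on_chart_at1_inv (f : V -> 'M[R]_N) :
  (forall x, A x -> chart_at1_nbhs (f x)) ->
  smooth_on A f -> smooth_on A (fun x => chart_at1_inv (f x)).
Proof.
move=> fW sf; apply: smooth_on_ofskew; apply: smooth_on_cayley.
  by move=> x Ax; have [_] := fW x Ax; rewrite unitmxE unitfE.
by apply: smooth_on_lift_of => // x Ax; have [] := fW x Ax.
Qed.

End On.

Lemma open_gt0 : open [set x : R | 0 < x].
Proof. exact: open_gt. Qed.

Lemma open_neq0 : open [set x : R | x != 0].
Proof. exact: open_neq. Qed.

Lemma open_chart_at1_dom : open (@chart_at1_dom R m).
Proof.
have oT : open [set: 'cV[R]_N] by exact: openT.
have H := smooth_on_toskew oT (@smooth_on_id _ _ setT).
have sc : smooth_on [set: 'cV[R]_N] (fun u => cayley (toskew u)).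
  apply: smooth_on_cayley => // u _; apply: skew_unitmx; exact: toskew_tr.
have := @open_preimage_on _ _ _ setT [set x : R | 0 < x]
  (fun u : 'cV[R]_N => cayley (toskew u) 0 0) oT open_gt0.
rewrite (_ : [set x | _] = (@chart_at1_dom R m)); last first.
  by apply/seteqP; split=> u [].
apply => u _; apply: (@smooth_on_continuous _ _ _ setT) => //.
exact: smooth_on_entry.
Qed.

Lemma open_chart_at1_nbhs : open (@chart_at1_nbhs R m).
Proof.
have oT : open [set: 'M[R]_N] by exact: openT.
have se := smooth_on_entry_of oT (@smooth_on_id _ _ setT).
pose A := [set C : 'M[R]_N | setT C /\ 0 < entry_of C 0 0].
have oA : open A.
  apply: (@open_preimage_on _ _ _ setT [set x : R | 0 < x]
    (fun u : 'M[R]_N => entry_of u 0 0)); [exact: openT|exact: open_gt0|].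
  move=> u _; apply: (@smooth_on_continuous _ _ _ setT) => //.
  exact: smooth_on_entry.
rewrite (_ : @chart_at1_nbhs R m =
  [set C | A C /\ \det (1%:M + lift_of C) != 0]); last first.
  by apply/seteqP; split=> C [] // [].
apply: (@open_preimage_on _ _ _ A [set x : R | x != 0]
    (fun u : 'M[R]_N => \det (1%:M + lift_of u))); [exact: oA|exact: open_neq0|].
move=> C CA; apply: smooth_on_continuous CA; apply: smooth_on_det => //.
apply: smooth_onD => //; first exact: smooth_on_cst.
by apply: smooth_on_lift_of => //; [move=> x []|exact: smooth_on_id].
Qed.

Lemma smooth_continuous (V W : normedModType R) (f : V -> W) :
  smooth_on setT f -> continuous f.
Proof. by move=> sf x; exact: (@smooth_on_continuous _ _ _ setT). Qed.

End ChartSmooth.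

(** * Compactness of adj(SO(1+m)) *)
Section Compact.
Context (R : realType).

Lemma compact_bounded_mx p (A : set 'M[R]_p) (M : R) :
  closed A -> (forall x, A x -> `|x| <= M) -> compact A.
Proof.
move=> cA bA.
have sv : continuous (@vec_mx R p p).
  apply: (smooth_continuous (f := @vec_mx R p p)).
  have oT : open [set: 'rV[R]_(p * p)] by exact: openT.
  apply: smooth_on_mx => // i j.
  apply: smooth_on_eq (smooth_on_entry oT 0 (mxvec_index i j)
    (@smooth_on_id _ _ setT)) => // x _; rewrite mxE //.
have -> : A = vec_mx @` (vec_mx @^-1` A).
  apply/seteqP; split=> [x Ax|_ [y Ay <-] //].
  by exists (mxvec x); rewrite /= mxvecK.
apply: continuous_compact; first exact: continuous_subspaceT.
apply: bounded_closed_compact; last first.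
  by move/continuous_closedP : sv; apply.
exists M; split; first exact: num_real.
move=> M' MM' v /= /bA vM; apply: mx_norm_le => [|i j].
  by apply: ltW; apply: le_lt_trans MM'; apply: le_trans vM.
apply: (le_trans _ (ltW MM')); apply: le_trans vM; rewrite !ord1.
case: (mxvec_indexP j) => a b; apply: le_trans (mx_norm_entry _ a b).
by rewrite mxE.
Qed.

Lemma orth_norm_le1 n (c : 'M[R]_n) : c^T *m c = 1%:M -> `|c| <= 1.
Proof.
move=> cc; apply: mx_norm_le => // i j.
have : (c^T *m c) j j = 1 by rewrite cc mxE eqxx.
rewrite mxE => cj; rewrite -(@ler_sqr _ _ 1) ?nnegrE // expr1n -[leRHS]cj.
rewrite (bigD1 i) //= mxE real_normK ?num_real // -expr2 lerDl sumr_ge0 // => k _.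
by rewrite mxE -expr2 sqr_ge0.
Qed.

Lemma compact_SO n : compact (gcarrier (SO R n)).
Proof.
have oT : open [set: 'M[R]_n] by exact: openT.
apply: (@compact_bounded_mx _ _ 1).
  have -> : gcarrier (SO R n) =
    (fun c : 'M[R]_n => c^T *m c) @^-1` [set 1%:M] `&`
    (fun c : 'M[R]_n => \det c) @^-1` [set 1].
    by apply/seteqP; split=> c [].
  apply: closedI.
    have /continuous_closedP : continuous (fun c : 'M[R]_n => c^T *m c).
      apply: smooth_continuous; apply: smooth_on_mulmx => //.
        by apply: smooth_on_trmx => //; exact: smooth_on_id.
      exact: smooth_on_id.
    by apply; apply: accessible_closed_set1; exact: hausdorff_accessible.
  have /continuous_closedP : continuous (fun c : 'M[R]_n => \det c).
    by apply: smooth_continuous; apply: smooth_on_det => //; exact: smooth_on_id.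
  by apply; apply: accessible_closed_set1; exact: hausdorff_accessible.
by move=> c [cc _]; exact: orth_norm_le1.
Qed.

Lemma compact_adjSO m : compact (@adjSO R m).
Proof.
apply: continuous_compact (@compact_SO _).
apply: continuous_subspaceT; apply: smooth_continuous.
by apply: smooth_on_adj; [exact: openT|exact: smooth_on_id].
Qed.

End Compact.

(** * Rotations in the planes (0, i) generate SO(1+m) *)
Section Rotations.
Context (R : realType) (m : nat).
Local Notation n := (1 + m)%N.
Local Notation ax i := (rshift 1 i : 'I_n).

Definition rotF (i : 'I_m) : 'M[R]_n := delta_mx (ax i) 0 - delta_mx 0 (ax i).
Definition rotP (i : 'I_m) : 'M[R]_n := delta_mx 0 0 + delta_mx (ax i) (ax i).

(** The rotation of angle t in the plane of the axes 0 and 1 + i, with rotP the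
    projection onto this plane and - rotF the generator. *)
Definition rot (i : 'I_m) (t : R) : 'M[R]_n :=
  1%:M + (cos t - 1) *: rotP i - sin t *: rotF i.

Lemma ax_neq0 i : (ax i == 0 :> 'I_n) = false.
Proof. by []. Qed.

Lemma ax_neq0' i : (0 == ax i :> 'I_n) = false.
Proof. by []. Qed.

Lemma ax_eq i j : (ax i == ax j :> 'I_n) = (i == j).
Proof. by rewrite eq_rshift. Qed.

Definition deltaE := (mul_delta_mx_cond, ax_neq0, ax_neq0', eqxx, mulr1n, mulr0n).

Lemma rotFF i : rotF i *m rotF i = - rotP i.
Proof.
rewrite /rotF mulmxBl !mulmxBr !deltaE /rotP.
by rewrite sub0r subr0 opprD addrC.
Qed.

Lemma rotPF i : rotP i *m rotF i = rotF i.
Proof.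
by rewrite /rotF /rotP mulmxDl !mulmxBr !deltaE sub0r subr0 addrC.
Qed.

Lemma rotFP i : rotF i *m rotP i = rotF i.
Proof.
by rewrite /rotF /rotP mulmxBl !mulmxDr !deltaE addr0 add0r.
Qed.

Lemma rotPP i : rotP i *m rotP i = rotP i.
Proof.
by rewrite /rotP mulmxDl !mulmxDr !deltaE addr0 add0r.
Qed.

Lemma rotD i s t : rot i (s + t) = rot i s *m rot i t.
Proof.
rewrite /rot cosD sinD !(mulmxDl, mulmxDr, mulNmx, mulmxN, mul1mx, mulmx1).
rewrite -!scalemxAl -!scalemxAr rotFF rotPF rotFP rotPP.
by apply/matrixP => a b; rewrite !mxE; ring.
Qed.

Lemma rot0 i : rot i 0 = 1%:M.
Proof. by rewrite /rot cos0 sin0 subrr !scale0r addr0 subr0. Qed.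

Lemma rot_tr i t : (rot i t)^T = rot i (- t).
Proof.
rewrite /rot cosN sinN linearB linearD /= trmx1 !linearZ /= /rotP /rotF.
rewrite linearD linearB /= !trmx_delta.
by apply/matrixP => a b; rewrite !mxE; ring.
Qed.

Lemma rot_orth i t : (rot i t)^T *m rot i t = 1%:M.
Proof. by rewrite rot_tr -rotD addNr rot0. Qed.

Lemma rot_det i t : \det (rot i t) = 1.
Proof.
have -> : t = t / 2 + t / 2 by rewrite -splitr.
rewrite rotD det_mulmx; have := congr1 determinant (rot_orth i (t / 2)).
by rewrite det_mulmx det_tr det1.
Qed.

Lemma rot_entry i t (w : 'cV[R]_n) j : (rot i t *m w) j 0 =
  if j == 0 then cos t * w 0 0 + sin t * w (ax i) 0
  else if j == ax i then cos t * w (ax i) 0 - sin t * w 0 0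
  else w j 0.
Proof.
have dE a b : ((delta_mx a b : 'M[R]_n) *m w) j 0 = (j == a)%:R * w b 0.
  rewrite mxE (bigD1 b) //= big1 ?addr0 ?mxE ?eqxx ?andbT // => k kb.
  by rewrite mxE (negbTE kb) andbF mul0r.
rewrite /rot !(mulmxDl, mulNmx) mul1mx -!scalemxAl mulmxDl mulmxBl.
have H (A B C D v : 'cV[R]_n) (x y : R) :
    (v + x *: (A + B) - y *: (C - D)) j 0 =
    v j 0 + x * (A j 0 + B j 0) - y * (C j 0 - D j 0).
  by rewrite !mxE.
rewrite H !dE.
case: (eqVneq j 0) => [->|j0]; first by rewrite ?eqxx ax_neq0' /=; ring.
by case: (eqVneq j (ax i)) => [->|ji] /=; ring.
Qed.

(** Products of rotations in the planes (0, i) for i < k; they fix the axes beyond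
    the k-th one. *)
Inductive rotgen (k : nat) : 'M[R]_n -> Prop :=
| rotgen1 : rotgen k 1%:M
| rotgenM (i : 'I_m) (t : R) (c : 'M[R]_n) :
    (i < k)%N -> rotgen k c -> rotgen k (rot i t *m c).

Lemma rotgen_mul k c c' : rotgen k c -> rotgen k c' -> rotgen k (c *m c').
Proof.
move=> gc gc'; elim: gc => [|i t d ik _ IH]; first by rewrite mul1mx.
by rewrite -mulmxA; exact: rotgenM.
Qed.

Lemma rotgen_rot k (i : 'I_m) t : (i < k)%N -> rotgen k (rot i t).
Proof. by move=> ik; rewrite -[rot i t]mulmx1; apply: rotgenM => //; exact: rotgen1. Qed.

Lemma rotgen_tr k c : rotgen k c -> rotgen k c^T.
Proof.
elim=> [|i t d ik _ IH]; first by rewrite trmx1; exact: rotgen1.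
by rewrite trmx_mul; apply: rotgen_mul => //; rewrite rot_tr; exact: rotgen_rot.
Qed.

Lemma rotgen_le k l c : (k <= l)%N -> rotgen k c -> rotgen l c.
Proof.
move=> kl; elim=> [|i t d ik _ IH]; first exact: rotgen1.
by apply: rotgenM => //; exact: leq_trans kl.
Qed.

Lemma rotgen_SO k c : rotgen k c -> c^T *m c = 1%:M /\ \det c = 1.
Proof.
elim=> [|i t d ik _ [dd detd]]; first by rewrite trmx1 mulmx1 det1.
split; last by rewrite det_mulmx rot_det mul1r.
by rewrite trmx_mul mulmxA -[_ *m rot i t]mulmxA rot_orth mulmx1.
Qed.

Lemma rotgen_fix k c (j : 'I_n) : rotgen k c -> (k < j)%N ->
  c *m (delta_mx j 0 : 'cV[R]_n) = delta_mx j 0.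
Proof.
move=> gc kj; elim: gc => [|i t d ik _ IH]; first by rewrite mul1mx.
rewrite -mulmxA IH; apply/matrixP => a b; rewrite !ord1 rot_entry.
have j0 : (0 == j :> 'I_n) = false.
  by apply/negbTE; rewrite -val_eqE /= eq_sym -lt0n (leq_ltn_trans _ kj).
have ji : (ax i == j) = false.
  apply/negbTE; rewrite -val_eqE /= add1n ltn_eqF //; exact: leq_ltn_trans kj.
rewrite !mxE j0 ji; case: eqVneq => [->|a0]; first by rewrite j0 /=; ring.
by case: eqVneq => [->|//]; rewrite ji /=; ring.
Qed.

Lemma polar (x y : R) : exists t r : R, x = r * cos t /\ y = r * sin t.
Proof.
have [xy0|xy0] := eqVneq (x ^+ 2 + y ^+ 2) 0.
  have /andP[/eqP x0 /eqP y0] : (x == 0) && (y == 0).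
    by move/eqP: xy0; rewrite paddr_eq0 ?sqr_ge0 // !sqrf_eq0.
  by exists 0, 0; rewrite x0 y0 !mul0r.
have p0 : 0 < x ^+ 2 + y ^+ 2 by rewrite lt0r xy0 addr_ge0 ?sqr_ge0.
pose r := Num.sqrt (x ^+ 2 + y ^+ 2); have r0 : 0 < r by rewrite sqrtr_gt0.
have r2 : r ^+ 2 = x ^+ 2 + y ^+ 2 by rewrite sqr_sqrtr // ltW.
have ru : r != 0 by rewrite gt_eqF.
have xr : -1 <= x / r <= 1.
  rewrite -ler_norml normrM normfV (gtr0_norm r0) ler_pdivrMr // mul1r.
  by rewrite -(@ler_sqr _ `|x| r) ?nnegrE ?(ltW r0) // real_normK ?num_real // r2 lerDl sqr_ge0.
have sE : sin (acos (x / r)) = `|y| / r.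
  rewrite sin_acos // expr_div_n r2; have -> : 1 - x ^+ 2 / (x ^+ 2 + y ^+ 2) =
    (`|y| / r) ^+ 2.
    by rewrite expr_div_n r2 real_normK ?num_real //; field.
  by rewrite sqrtr_sqr ger0_norm // divr_ge0 // ltW.
have cE : cos (acos (x / r)) = x / r by rewrite acosK // in_itv.
case: (leP 0 y) => y0.
  exists (acos (x / r)), r; rewrite cE sE ger0_norm //.
  by split; rewrite mulrCA mulfV // mulr1.
exists (- acos (x / r)), r; rewrite cosN sinN cE sE ltr0_norm //.
by split; rewrite ?mulNr ?opprK mulrCA mulfV // mulr1.
Qed.

(** One coordinate after the other is rotated into the first one. *)
Lemma rotgen_axis0 k (w : 'cV[R]_n) : (k <= m)%N ->
  (forall j : 'I_n, (k < j)%N -> w j 0 = 0) ->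
  exists2 g, rotgen k g & exists a, g *m w = a *: delta_mx 0 0.
Proof.
elim: k w => [|k IH] w km wk.
  exists 1%:M; first exact: rotgen1.
  exists (w 0 0); rewrite mul1mx; apply/matrixP => i j; rewrite !ord1 !mxE eqxx andbT.
  case: (eqVneq i 0) => [->|i0]; first by rewrite mulr1.
  rewrite mulr0 wk //.
  by rewrite lt0n; apply: contra i0 => /eqP i0; apply/eqP/val_inj.
pose i := Ordinal km.
have [t [r [w0 wi]]] := polar (w 0 0) (w (ax i) 0).
have [|j kj|g gg [a ga]] := IH (rot i t *m w).
- exact: ltnW.
- rewrite rot_entry; case: eqVneq => [j0|j0]; first by rewrite j0 in kj.
  case: eqVneq => [_|ji]; first by rewrite w0 wi; ring.
  apply: wk; rewrite ltn_neqAle kj andbT; apply: contra ji => /eqP ji.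
  by apply/eqP/val_inj; exact: esym ji.
exists (g *m rot i t); last by exists a; rewrite -mulmxA.
apply: rotgen_mul; first exact: rotgen_le gg.
exact: rotgen_rot.
Qed.

(** Induction on the number of axes which c may move.  If w is the image under c
    of the last one, rotate w onto the axis 0 by rotgen_axis0, up to sign, and
    from there back to the last axis by a quarter turn; then c followed by these
    rotations fixes one axis more. *)
Lemma rotgen_of_fix k (c : 'M[R]_n) : (k <= m)%N ->
  c^T *m c = 1%:M -> \det c = 1 ->
  (forall j : 'I_n, (k < j)%N -> c *m (delta_mx j 0 : 'cV[R]_n) = delta_mx j 0) ->
  rotgen m c.
Proof.
have colE' (A : 'M[R]_n) (j i : 'I_n) :
    (A *m (delta_mx j 0 : 'cV[R]_n)) i 0 = A i j by rewrite -colE mxE.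
elim: k c => [|k IH] c km cc dc fixc.
  suff -> : c = 1%:M by exact: rotgen1.
  have cj (i j : 'I_n) : j != 0 -> c i j = (i == j)%:R.
    move=> j0; have := colE' c j i; rewrite fixc; first by rewrite mxE andbT.
    by rewrite lt0n; apply: contra j0 => /eqP j0; apply/eqP/val_inj.
  have c0 (i : 'I_n) : i != 0 -> c i 0 = 0.
    move=> i0; have /matrixP/(_ i 0) := cc; rewrite !mxE (negbTE i0) /=.
    rewrite (bigD1 i) //= big1 => [|k ki].
      by rewrite mxE cj // eqxx mul1r addr0.
    by rewrite mxE cj // (negbTE ki) mul0r.
  have dE : c = diag_mx (\row_j (if j == 0 then c 0 0 else 1)).
    apply/matrixP => i j; rewrite !mxE; case: (eqVneq j 0) => [->|j0].
      by case: (eqVneq i 0) => [->|i0]; rewrite ?eqxx ?(c0 _ i0) ?(negbTE i0).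

    by rewrite cj //; case: eqVneq => [->|]; rewrite ?(negbTE j0).
  have c00 : c 0 0 = 1.
    move: dc; rewrite {1}dE det_diag (bigD1 0) //= big1 ?mulr1 => [|j j0].
      by rewrite !mxE.
    by rewrite !mxE (negbTE j0).
  apply/matrixP => i j; case: (eqVneq j 0) => [->|j0]; last by rewrite cj // mxE.
  by case: (eqVneq i 0) => [->|i0]; rewrite mxE ?c00 ?c0 // (negbTE i0).
pose i := Ordinal km; pose w : 'cV[R]_n := c *m delta_mx (ax i) 0.
have wE j : w j 0 = c j (ax i) by exact: colE'.
have [|g gg [a ga]] := @rotgen_axis0 k.+1 w km.
  move=> j kj; have /matrixP/(_ j (ax i)) := cc.
  have -> : (1%:M : 'M[R]_n) j (ax i) = 0.
    rewrite mxE; case: eqVneq => // ji; move: kj.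
    by rewrite ji /= add1n ltnn.
  rewrite mxE wE (bigD1 j) //= big1 => [|l lj].
    have := colE' c j j; rewrite fixc // !mxE eqxx => <-.
    by rewrite mul1r addr0.
  have := colE' c j l; rewrite fixc // !mxE (negbTE lj) => <-.
  by rewrite mul0r.
have [gg1 dg] := rotgen_SO gg.
have a2 : a ^+ 2 = 1.
  have H : (g *m w)^T *m (g *m w) = 1%:M.
    rewrite trmx_mul mulmxA -[_ *m g]mulmxA gg1 mulmx1 /w trmx_mul mulmxA.
    rewrite -[_ *m c]mulmxA cc mulmx1 trmx_delta mul_delta_mx.
    by apply/matrixP => x y; rewrite !ord1 !mxE.
  move: H; rewrite ga [(a *: _)^T]linearZ /= -scalemxAl -scalemxAr scalerA trmx_delta.
  rewrite mul_delta_mx -expr2 => /matrixP/(_ 0 0); rewrite !mxE !eqxx /=.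
  by rewrite mulr1.
(* The direction of the quarter turn corrects the sign a of the image of w. *)
pose t : R := if a == 1 then - (pi / 2) else pi / 2.
pose h := rot i t *m g.
have gh : rotgen k.+1 h by apply: rotgenM.
have hw : h *m w = delta_mx (ax i) 0.
  rewrite -mulmxA ga; apply/matrixP => x y; rewrite !ord1 rot_entry !mxE !eqxx.
  rewrite ax_neq0 /= mulr1 mulr0 !mulr0 addr0 sub0r.
  have ct : cos t = 0 by rewrite /t; case: ifP => _; rewrite ?cosN cos_pihalf.
  have st : - (sin t * a) = 1.
    move/eqP: a2; rewrite sqrf_eq1 /t => /orP[/eqP ->|/eqP ->].
      by rewrite eqxx sinN sin_pihalf mulr1 opprK.
    have -> : (-1 == 1 :> R) = false.
      by apply/negbTE; rewrite lt_eqF // (lt_trans (ltrN10 R)) // ltr01.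
    by rewrite sin_pihalf mul1r opprK.
  rewrite ct st mul0r; case: (eqVneq x 0) => [->|x0]; first by rewrite ax_neq0'.
  by case: (eqVneq x (ax i)) => _; rewrite /= ?mulr0.
have [hh dh] := rotgen_SO gh.
have : rotgen m (h *m c).
  apply: IH.
  - exact: ltnW.
  - by rewrite trmx_mul mulmxA -[_ *m h]mulmxA hh mulmx1.
  - by rewrite det_mulmx dh dc mul1r.
  move=> j kj; rewrite -mulmxA; case: (eqVneq j (ax i)) => [->|ji]; first exact: hw.
  have kj' : (k.+1 < j)%N.
    rewrite ltn_neqAle kj andbT; apply: contra ji => /eqP ji.
    by apply/eqP/val_inj; exact: esym ji.
  by rewrite fixc // (rotgen_fix gh).
have ghm : rotgen m h^T by apply: rotgen_tr; exact: rotgen_le gh.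
by move=> /(rotgen_mul ghm); rewrite mulmxA hh mul1mx.
Qed.

Lemma SO_rotgen (c : 'M[R]_n) : c^T *m c = 1%:M -> \det c = 1 -> rotgen m c.
Proof.
move=> cc dc; apply: (@rotgen_of_fix m) => // j mj.
by have := ltn_ord j; rewrite [X in (_ < X)%N]add1n ltnS leqNgt mj.
Qed.

Lemma adj_orth (c : 'M[R]_n) : c^T *m c = 1%:M -> (adj c)^T *m adj c = 1%:M.
Proof. by move=> cc; rewrite adj_tr -adjM cc adj1. Qed.

(** Each generating rotation is a square, so its adjoint action has a square as
    determinant. *)
Lemma adj_det (c : 'M[R]_n) : c^T *m c = 1%:M -> \det c = 1 -> \det (adj c) = 1.
Proof.
move=> cc dc; elim: (SO_rotgen cc dc) => [|i t d _ _ IH]; first by rewrite adj1 det1.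
rewrite adjM det_mulmx IH mulr1.
have -> : t = t / 2 + t / 2 by rewrite -splitr.
rewrite rotD adjM det_mulmx.
have := congr1 determinant (adj_orth (rot_orth i (t / 2))).
by rewrite det_mulmx det_tr det1.
Qed.

End Rotations.

(** * Lie group structures on the candidate holonomy groups *)
Section LieStructures.
Context (R : realType) (m : nat) (hm : (2 <= m)%N).
Local Notation N := (m + vdim m)%N.
Local Notation n := (1 + m)%N.
Local Notation K := (@adjSO R m).

Lemma adjSO1 : K 1%:M.
Proof. by exists 1%:M; [split; rewrite ?trmx1 ?mulmx1 ?det1|exact: adj1]. Qed.

Lemma adjSO_mul k k' : K k -> K k' -> K (k *m k').
Proof.
move=> [c [cc dc] <-] [c' [cc' dc'] <-]; exists (c *m c'); last exact: adjM.
split; last by rewrite det_mulmx dc dc' mulr1.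
by rewrite trmx_mul mulmxA -[_ *m c]mulmxA cc mulmx1.
Qed.

Lemma adjSO_tr k : K k -> K k^T.
Proof.
move=> [c [cc dc] <-]; exists c^T; last by rewrite adj_tr.
by split; rewrite ?det_tr // trmxK; exact: mulmx1C.
Qed.

Lemma adjSO_orth k : K k -> k^T *m k = 1%:M.
Proof. by move=> [c [cc dc] <-]; exact: adj_orth. Qed.

Lemma adjSO_orth' k : K k -> k *m k^T = 1%:M.
Proof. by move=> /adjSO_orth; exact: mulmx1C. Qed.

Lemma adjSO_det k : K k -> \det k = 1.
Proof. by move=> [c [cc dc] <-]; exact: adj_det. Qed.

Lemma chart_at1_nbhs1 : chart_at1_nbhs (1%:M : 'M[R]_N).
Proof.
have I1 : (1%:M : 'M[R]_n)^T *m 1%:M = 1%:M by rewrite trmx1 mulmx1.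
have c00 : 0 < entry_of (adj (1%:M : 'M[R]_n)) 0 0.
  by rewrite entry_of_adj // !mxE mulr1 ltr01.
have [_ _ _ lE] := lift_of_adj hm I1 c00.
rewrite -[1%:M](adj1 R m); split => //; rewrite lE ?mxE ?ltr01 //.
rewrite -mulr2n -scaler_nat detZ det1 mulr1 expf_neq0 // pnatr_eq0 //.
Qed.

(** By compactness, finitely many translates suffice; the list is padded by 1 to a
    sequence. *)
Lemma adjSO_cover : exists g : nat -> 'M[R]_N, (forall i, K (g i)) /\
  forall k, K k -> exists i, chart_at1_nbhs ((g i)^T *m k).
Proof.
have := @compact_adjSO R m; rewrite compact_cover.
move=> /(_ _ K (fun g => [set k | chart_at1_nbhs (g^T *m k)])).
case.
- move=> g _; rewrite (_ : [set k | _] =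
    [set k | setT k /\ chart_at1_nbhs (g^T *m k)]); last first.
    by apply/seteqP; split=> k // [].
  have oT : open [set: 'M[R]_N] by exact: openT.
  apply: open_preimage_on; [exact: oT|exact: open_chart_at1_nbhs|move=> k _].
  apply: (@smooth_on_continuous _ _ _ setT) => //.
  by apply: smooth_on_mulmx => //; [exact: smooth_on_cst|exact: smooth_on_id].
- move=> k Kk; exists k => //=; rewrite adjSO_orth //; exact: chart_at1_nbhs1.
move=> D DK cov.
pose s : seq 'M[R]_N := finmap.enum_fset D.
pose g i := nth 1%:M s i; exists g; split=> [i|k /cov[h /= hD hk]].
  case: (ltnP i (size s)) => [si|si]; last by rewrite /g nth_default //; exact: adjSO1.
  by apply/set_mem/DK; exact: mem_nth.
by exists (index h s); rewrite /g nth_index.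
Qed.

(** The linear holonomy groups are of this form; the orthogonal matrix O is the
    change between the Jacobian frame and the chosen orthonormal coordinates. *)
Definition conj_adjSO (O : 'M[R]_N) : set 'M[R]_N :=
  [set O *m k *m O^T | k in K].

Section Conj.
Context (O : 'M[R]_N) (oO : O^T *m O = 1%:M).
Let oO' : O *m O^T = 1%:M. Proof. exact: mulmx1C. Qed.

Let cj (k : 'M[R]_N) := O *m k *m O^T.
Let cjV (k : 'M[R]_N) := O^T *m k *m O.

Let cjK k : cjV (cj k) = k.
Proof. by rewrite /cjV /cj !mulmxA oO mul1mx -mulmxA oO mulmx1. Qed.

Let cjVK k : cj (cjV k) = k.
Proof. by rewrite /cjV /cj !mulmxA oO' mul1mx -mulmxA oO' mulmx1. Qed.

Let cjM k l : cj (k *m l) = cj k *m cj l.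
Proof. by rewrite /cj !mulmxA -[_ *m O^T *m O]mulmxA oO mulmx1. Qed.

Let cjVM k l : cjV (k *m l) = cjV k *m cjV l.
Proof. by rewrite /cjV !mulmxA -[_ *m O *m O^T]mulmxA oO' mulmx1. Qed.

Let cj_tr k : (cj k)^T = cj k^T.
Proof. by rewrite /cj !trmx_mul trmxK mulmxA. Qed.

Let cjP h : conj_adjSO O h <-> K (cjV h).
Proof.
split=> [[k Kk <-]|Kh]; first by rewrite -/(cj k) cjK.
by exists (cjV h) => //; rewrite -/(cj _) cjVK.
Qed.

Let Hone : conj_adjSO O 1%:M.
Proof. by apply/cjP; rewrite /cjV mulmx1 oO; exact: adjSO1. Qed.

Let Hmul a b : conj_adjSO O a -> conj_adjSO O b -> conj_adjSO O (a *m b).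
Proof. by move=> /cjP Ka /cjP Kb; apply/cjP; rewrite cjVM; exact: adjSO_mul. Qed.

Let Horth a : conj_adjSO O a -> a^T *m a = 1%:M.
Proof.
move=> [k Kk <-]; rewrite -/(cj k) cj_tr -cjM adjSO_orth // /cj mulmx1.
exact: oO'.
Qed.

Let Hunit a : conj_adjSO O a -> a \in unitmx.
Proof. by move=> /Horth /mulmx1_unit[]. Qed.

Let Hinvmx a : conj_adjSO O a -> invmx a = a^T.
Proof.
move=> Ha; have Ua := Hunit Ha; apply: (can_inj (mulmxK Ua)).
by rewrite mulVmx // Horth.
Qed.

Let Hinv a : conj_adjSO O a -> conj_adjSO O (invmx a).
Proof.
move=> Ha; rewrite Hinvmx //; case: Ha => k Kk <-.
by rewrite -/(cj k) cj_tr; exists k^T => //; exact: adjSO_tr.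
Qed.

Let Hsub : conj_adjSO O `<=` gcarrier (SO R N).
Proof.
move=> a Ha; split; first exact: Horth.
case: Ha => k Kk <-; rewrite !det_mulmx (adjSO_det Kk) mulr1 -det_mulmx oO'.
exact: det1.
Qed.

Let oT (V : normedModType R) : open [set: V]. Proof. exact: openT. Qed.

Let W : set 'M[R]_N := [set h | chart_at1_nbhs (cjV h)].

Let smooth_cj (E : normedModType R) (A : set E) (f : E -> 'M[R]_N) : open A ->
  smooth_on A f -> smooth_on A (fun x => cj (f x)).
Proof.
move=> oA sf; apply: smooth_on_mulmx => //; last exact: smooth_on_cst.
by apply: smooth_on_mulmx => //; exact: smooth_on_cst.
Qed.

Let smooth_cjV (E : normedModType R) (A : set E) (f : E -> 'M[R]_N) : open A ->
  smooth_on A f -> smooth_on A (fun x => cjV (f x)).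
Proof.
move=> oA sf; apply: smooth_on_mulmx => //; last exact: smooth_on_cst.
by apply: smooth_on_mulmx => //; exact: smooth_on_cst.
Qed.

Let oW : open W.
Proof.
rewrite (_ : W = [set k | setT k /\ chart_at1_nbhs (cjV k)]); last first.
  by apply/seteqP; split=> k // [].
apply: open_preimage_on; [exact: oT|exact: open_chart_at1_nbhs|move=> k _].
apply: (@smooth_on_continuous _ _ _ setT) => //.
by apply: smooth_cjV => //; exact: smooth_on_id.
Qed.

Lemma conj_adjSO_lie : exists L : lie_subgroup N (SO R N) (conj_adjSO O),
  compact (identity_component L).
Proof.
have [g [gK gc]] := adjSO_cover.
pose phi u := cj (chart_at1 u).
pose psi h := chart_at1_inv (cjV h).
have mulK a (v : 'M[R]_N) : conj_adjSO O a -> invmx a *m (a *m v) = v.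
  by move=> /Hunit Ua; rewrite mulKmx.
have mulVK a (v : 'M[R]_N) : conj_adjSO O a -> a *m (invmx a *m v) = v.
  by move=> /Hunit Ua; rewrite mulKVmx.
have mul_s : stably_smooth setT (fun p : 'M[R]_N * 'M[R]_N => p.1 *m p.2).
  move=> E A f oA sf _; apply: smooth_on_mulmx => //.
    exact: smooth_on_fst.
  exact: smooth_on_snd.
have inv_s : stably_smooth (conj_adjSO O) (@invmx R N).
  move=> E A f oA sf fH; apply: smooth_on_invmx => // x Ax.
  by apply: Hunit; exact: fH.
have phi_s : stably_smooth (@chart_at1_dom R m) phi.
  move=> E A f oA sf fU; apply: smooth_cj => //; exact: smooth_on_chart_at1.
have psi_s : stably_smooth W psi.
  move=> E A f oA sf fW; apply: smooth_on_chart_at1_inv => //.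
  exact: smooth_cjV.
have phiP u : chart_at1_dom u ->
    [/\ conj_adjSO O (phi u), W (phi u) & psi (phi u) = u].
  move=> /(chart_at1P hm)[h1 h2 h3].
  by split; [apply/cjP|rewrite /W /=|rewrite /psi]; rewrite /phi cjK.
have psiP h : conj_adjSO O h -> W h ->
    chart_at1_dom (psi h) /\ phi (psi h) = h.
  move=> /cjP Kh Wh; have [d1 d2] := chart_at1_invP hm Kh Wh.
  by split => //; rewrite /phi d2 cjVK.
have Hg i : conj_adjSO O (cj (g i)) by exists (g i).
have gcov h : conj_adjSO O h -> exists i, W (invmx (cj (g i)) *m h).
  move=> Hh; have [i Wi] := gc _ ((cjP h).1 Hh); exists i.
  change (chart_at1_nbhs (cjV (invmx (cj (g i)) *m h))).
  rewrite (Hinvmx (Hg i)) cj_tr cjVM cjK; exact: Wi.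
exists (@translate_lie_subgroup R _ N (SO R N) (conj_adjSO O)
  (@chart_at1_dom R m) phi W psi (fun i => cj (g i))
  Hsub Hone Hmul Hinv mulK mulVK mul_s inv_s
  (@open_chart_at1_dom R m) oW phi_s psi_s phiP psiP Hg gcov).
apply: compact_identity_component.
apply: continuous_compact (@compact_adjSO R m).
apply: continuous_subspaceT; apply: smooth_continuous.
by apply: smooth_cj => //; exact: smooth_on_id.
Qed.

(** The affine holonomy group contains all translations: the constraint is on the
    linear part only, which explains the dimension N + N. *)
Definition affine_conj : set ('cV[R]_N * 'M[R]_N) := [set h | conj_adjSO O h.2].

Let twoN : (2 * N = N + N)%N. Proof. by rewrite mul2n addnn. Qed.

Let half1 (u : 'cV[R]_(2 * N)) : 'cV[R]_N := usubmx (castmx (twoN, erefl 1%N) u).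
Let half2 (u : 'cV[R]_(2 * N)) : 'cV[R]_N := dsubmx (castmx (twoN, erefl 1%N) u).
Let join (y u : 'cV[R]_N) : 'cV[R]_(2 * N) :=
  castmx (esym twoN, erefl 1%N) (col_mx y u).

Let half1K y u : half1 (join y u) = y.
Proof. by rewrite /half1 /join castmx_comp castmx_id col_mxKu. Qed.
Let half2K y u : half2 (join y u) = u.
Proof. by rewrite /half2 /join castmx_comp castmx_id col_mxKd. Qed.
Let joinK u : join (half1 u) (half2 u) = u.
Proof. by rewrite /half1 /half2 /join vsubmxK castmx_comp castmx_id. Qed.

Let smooth_cast (E : normedModType R) (A : set E) p q (e : p = q)
  (f : E -> 'cV[R]_p) : open A ->
  smooth_on A f -> smooth_on A (fun x => castmx (e, erefl 1%N) (f x)).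
Proof. by move=> oA; case: q / e. Qed.

Let smooth_half1 (E : normedModType R) (A : set E) (f : E -> 'cV[R]_(2 * N)) :
  open A -> smooth_on A f -> smooth_on A (fun x => half1 (f x)).
Proof. by move=> oA sf; apply: smooth_on_usubmx => //; exact: smooth_cast. Qed.

Let smooth_half2 (E : normedModType R) (A : set E) (f : E -> 'cV[R]_(2 * N)) :
  open A -> smooth_on A f -> smooth_on A (fun x => half2 (f x)).
Proof. by move=> oA sf; apply: smooth_on_dsubmx => //; exact: smooth_cast. Qed.

Let smooth_join (E : normedModType R) (A : set E) (f g : E -> 'cV[R]_N) :
  open A -> smooth_on A f -> smooth_on A g ->
  smooth_on A (fun x => join (f x) (g x)).
Proof. by move=> oA sf sg; apply: smooth_cast => //; exact: smooth_on_col_mx. Qed.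

Lemma affine_conj_lie : inhabited (lie_subgroup (2 * N) (SE R N) affine_conj).
Proof.
have [g [gK gc]] := adjSO_cover.
pose U : set 'cV[R]_(2 * N) := [set u | chart_at1_dom (half2 u)].
pose phi u := (half1 u, cj (chart_at1 (half2 u))).
pose W2 : set ('cV[R]_N * 'M[R]_N) := [set h | W h.2].
pose psi (h : 'cV[R]_N * 'M[R]_N) := join h.1 (chart_at1_inv (cjV h.2)).
have sub2 : affine_conj `<=` gcarrier (SE R N) by move=> h Hh; exact: Hsub.
have mul2 a b : affine_conj a -> affine_conj b -> affine_conj (gmul (SE R N) a b).
  exact: Hmul.
have inv2 a : affine_conj a -> affine_conj (ginv (SE R N) a) by exact: Hinv.
have mulK (a v : 'cV[R]_N * 'M[R]_N) : affine_conj a ->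
    gmul (SE R N) (ginv (SE R N) a) (gmul (SE R N) a v) = v.
  move=> /Hunit Ua; case: v => v1 v2; congr pair; rewrite /= ?mulKmx //.
  by rewrite mulmxDr mulKmx // addKr.
have mulVK (a v : 'cV[R]_N * 'M[R]_N) : affine_conj a ->
    gmul (SE R N) a (gmul (SE R N) (ginv (SE R N) a) v) = v.
  move=> /Hunit Ua; case: v => v1 v2; congr pair; rewrite /= ?mulKVmx //.
  by rewrite mulmxDr mulmxN !mulKVmx // addrA subrr add0r.
have mul_s : stably_smooth setT
    (fun p : ('cV[R]_N * 'M[R]_N) * ('cV[R]_N * 'M[R]_N) => gmul (SE R N) p.1 p.2).
  move=> E A f oA sf _.
  have s1 := smooth_on_fst oA sf; have s2 := smooth_on_snd oA sf.
  have s11 := smooth_on_fst oA s1; have s12 := smooth_on_snd oA s1.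
  have s21 := smooth_on_fst oA s2; have s22 := smooth_on_snd oA s2.
  apply: smooth_on_pair => //; last exact: smooth_on_mulmx.
  by apply: smooth_onD => //; exact: smooth_on_mulmx.
have inv_s : stably_smooth affine_conj (ginv (SE R N)).
  move=> E A f oA sf fH.
  have s1 := smooth_on_fst oA sf; have s2 := smooth_on_snd oA sf.
  have s3 : smooth_on A (fun x => invmx (f x).2).
    by apply: smooth_on_invmx => // x Ax; apply: Hunit; exact: fH.
  apply: smooth_on_pair => //.
  by apply: smooth_onN => //; exact: smooth_on_mulmx.
have oU : open U.
  rewrite (_ : U = [set u | setT u /\ chart_at1_dom (half2 u)]); last first.
    by apply/seteqP; split=> k // [].
  apply: open_preimage_on; [exact: oT|exact: open_chart_at1_dom|move=> k _].
  apply: (@smooth_on_continuous _ _ _ setT) => //.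
  by apply: smooth_half2 => //; exact: smooth_on_id.
have oW2 : open W2.
  rewrite (_ : W2 = [set u | setT u /\ W u.2]); last first.
    by apply/seteqP; split=> k // [].
  apply: open_preimage_on; [exact: oT|exact: oW|move=> k _].
  apply: (@smooth_on_continuous _ _ _ setT) => //.
  by apply: smooth_on_snd => //; exact: smooth_on_id.
have phi_s : stably_smooth U phi.
  move=> E A f oA sf fU; apply: smooth_on_pair => //; first exact: smooth_half1.
  apply: smooth_cj => //; apply: smooth_on_chart_at1 => //; exact: smooth_half2.
have psi_s : stably_smooth W2 psi.
  move=> E A f oA sf fW; apply: smooth_join => //; first exact: smooth_on_fst.
  apply: smooth_on_chart_at1_inv => //.
  by apply: smooth_cjV => //; exact: smooth_on_snd.
have phiP u : U u -> [/\ affine_conj (phi u), W2 (phi u) & psi (phi u) = u].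
  move=> /(chart_at1P hm)[h1 h2 h3]; split.
  - by apply/cjP; rewrite /phi /= cjK.
  - by rewrite /W2 /W /phi /= cjK.
  by rewrite /psi /phi /= cjK h3 joinK.
have psiP h : affine_conj h -> W2 h -> U (psi h) /\ phi (psi h) = h.
  move=> /cjP Kh Wh; have [d1 d2] := chart_at1_invP hm Kh Wh.
  rewrite /U /phi /psi /= half1K half2K; split => //.
  by case: h {Kh Wh d1} d2 => h1 h2 /= ->; rewrite cjVK.
have Hg i : affine_conj (0, cj (g i)) by exists (g i).
have gcov h : affine_conj h ->
    exists i, W2 (gmul (SE R N) (ginv (SE R N) (0, cj (g i))) h).
  move=> Hh; have [i Wi] := gc _ ((cjP h.2).1 Hh); exists i.
  change (chart_at1_nbhs (cjV (invmx (cj (g i)) *m h.2))).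
  rewrite (Hinvmx (Hg i)) cj_tr cjVM cjK; exact: Wi.
exact: (inhabits (@translate_lie_subgroup R _ (2 * N) (SE R N) affine_conj
  U phi W2 psi (fun i => (0, cj (g i)))
  sub2 Hone mul2 inv2 mulK mulVK mul_s inv_s oU oW2 phi_s psi_s phiP psiP Hg gcov)).
Qed.

End Conj.
End LieStructures.

(** * The Levi-Civita connection in the Jacobian frame *)
Section Connection.
Context (R : realType) (m : nat).
Local Notation N := (m + vdim m)%N.
Local Notation n := (1 + m)%N.

(** Half the vertical bracket v /\ w of horizontal vectors, as a matrix acting on
    w. *)
Definition wedge (v : 'cV[R]_m) : 'M[R]_(vdim m, m) :=
  \matrix_(k, h) (2^-1 * (v (val (index_pair k)).1 0 *+ ((val (index_pair k)).2 == h)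
                        - v (val (index_pair k)).2 0 *+ ((val (index_pair k)).1 == h))).

Definition Bmx (v : 'cV[R]_m) : 'M[R]_N := block_mx 0 0 (wedge v) 0.

Lemma wedge_linear : linear wedge.
Proof.
move=> a u v; apply/matrixP => i j; rewrite !mxE.
by case: eqP => _; case: eqP => _; rewrite ?mulr1n ?mulr0n; ring.
Qed.
HB.instance Definition _ := GRing.isLinear.Build R _ _ _ wedge wedge_linear.

Lemma Bmx_linear : linear Bmx.
Proof.
by move=> a u v; rewrite /Bmx linearP scale_block_mx add_block_mx !scaler0 !addr0.
Qed.
HB.instance Definition _ := GRing.isLinear.Build R _ _ _ Bmx Bmx_linear.

Lemma wedgeE (v w : 'cV[R]_m) k : (wedge v *m w) k 0 =
  2^-1 * (v (val (index_pair k)).1 0 * w (val (index_pair k)).2 0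
        - v (val (index_pair k)).2 0 * w (val (index_pair k)).1 0).
Proof.
rewrite mxE; under eq_bigr do rewrite mxE -mulrA mulrBl.
rewrite -mulr_sumr sumrB; congr (_ * (_ - _)).
  rewrite (bigD1 (val (index_pair k)).2) //= eqxx mulr1n big1 ?addr0 // => i.
  by rewrite eq_sym => /negbTE ->; rewrite mulr0n mul0r.
rewrite (bigD1 (val (index_pair k)).1) //= eqxx mulr1n big1 ?addr0 // => i.
by rewrite eq_sym => /negbTE ->; rewrite mulr0n mul0r.
Qed.

Lemma wedge_anti (v w : 'cV[R]_m) : wedge v *m w = - (wedge w *m v).
Proof.
apply/matrixP => k j; rewrite !ord1 [RHS]mxE !wedgeE; ring.
Qed.

Lemma Bmx_mul v (z : 'cV[R]_N) : Bmx v *m z = col_mx 0 (wedge v *m usubmx z).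
Proof. by rewrite -{1}[z]vsubmxK mul_block_col !mul0mx !addr0. Qed.

Lemma BmxB v w : Bmx v *m Bmx w = 0.
Proof.
rewrite mulmx_block !mul0mx !mulmx0 !addr0.
by rewrite -[RHS]submxK; congr block_mx; apply/matrixP => i j; rewrite !mxE.
Qed.

Lemma Bmx_anti (y z : 'cV[R]_N) : Bmx (usubmx y) *m z = - (Bmx (usubmx z) *m y).
Proof. by rewrite !Bmx_mul wedge_anti opp_col_mx oppr0. Qed.

Lemma jacobian_frameE x : jacobian_frame x = 1%:M + Bmx (usubmx x) :> 'M[R]_N.
Proof.
have sumE (P : pred (pairs m)) (f : pairs m -> R) k :
    (\sum_(p | P p) f p *: dgamma R p) (rshift m k) 0 =
    f (index_pair k) *+ P (index_pair k).
  have dE p : (dgamma R p : 'cV[R]_N) (rshift m k) 0 = (p == index_pair k)%:R.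
    rewrite mxE eqxx andbT eq_rshift; congr (_%:R); congr nat_of_bool.
    by rewrite eq_sym -(can_eq (@index_pairK m)) pair_indexK.
  rewrite summxE; case Pk: (P (index_pair k)).
    rewrite (bigD1 (index_pair k)) //= big1 ?addr0.
      by rewrite mxE dE eqxx mulr1.
    by move=> p /andP[_ /negbTE pk]; rewrite mxE dE pk mulr0.
  rewrite big1 // => p Pp; rewrite mxE dE.
  by case: eqP => [pk|]; [move: Pp; rewrite pk Pk|rewrite mulr0].
have sum0 (P : pred (pairs m)) (f : pairs m -> R) i :
    (\sum_(p | P p) f p *: dgamma R p) (lshift (vdim m) i) 0 = 0.
  rewrite summxE big1 // => p _.
  by rewrite !mxE eq_lrshift mulr0.
have -> : 1%:M + Bmx (usubmx x) = block_mx 1%:M 0 (wedge (usubmx x)) 1%:M.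
  by rewrite scalar_mx_block add_block_mx !addr0 add0r.
rewrite -[LHS]submxK /jacobian_frame /ulsubmx /ursubmx /drsubmx.
rewrite /usubmx /dsubmx; congr block_mx; apply/matrixP => i j.
- rewrite 2!mxE row_mxEl !mxE !sum0 !mulr0 subr0 addr0.
  by rewrite eq_lshift eqxx andbT.
- by rewrite 2!mxE row_mxEr !mxE eq_lrshift.
- rewrite 2!mxE row_mxEl !mxE !sumE /vcoord eq_rlshift /= add0r -mulrBr.
  by [].
- by rewrite 2!mxE row_mxEr !mxE eq_rshift index_pairK eqxx andbT.
Qed.

Lemma invmx_jacobian x : invmx (jacobian_frame x) = 1%:M - Bmx (usubmx x) :> 'M[R]_N.
Proof.
have H : (1%:M - Bmx (usubmx x)) *m jacobian_frame x = 1%:M.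
  rewrite jacobian_frameE mulmxBl mul1mx mulmxDr BmxB mulmx1 addr0 addrK.
  by [].
have UJ := jacobian_frame_unit x.
by apply: (can_inj (mulmxK UJ)); rewrite mulVmx // H.
Qed.

Lemma Bmx_jac v x : Bmx v *m jacobian_frame x = Bmx v :> 'M[R]_N.
Proof. by rewrite jacobian_frameE mulmxDr mulmx1 BmxB addr0. Qed.

Lemma jac_Bmx v x : jacobian_frame x *m Bmx v = Bmx v :> 'M[R]_N.
Proof. by rewrite jacobian_frameE mulmxDl mul1mx BmxB addr0. Qed.

Lemma usubmx_jac x (a : 'cV[R]_N) : usubmx (jacobian_frame x *m a) = usubmx a.
Proof. by rewrite jacobian_frameE mulmxDl mul1mx linearD /= Bmx_mul col_mxKu addr0. Qed.

(** For the entries of the metric, which are quadratic polynomials. *)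
Lemma derive_quad (V : normedModType R) (f : V -> R) (x v : V) (a b : R) :
  (forall h : R, f (h *: v + x) = f x + h * a + h ^+ 2 * b) -> 'D_v f x = a.
Proof.
move=> H; rewrite /derive; apply/cvg_lim => //.
have cv : (fun h : R => a + h * b) @ 0^' --> a.
  have : (fun h : R => a + h * b) @ 0^' --> a + 0 * b.
    apply: cvg_within_filter; apply: cvgD; first exact: cvg_cst.
    by apply: cvgM; [exact: cvg_id|exact: cvg_cst].
  by rewrite mul0r addr0.
apply: cvg_trans cv; apply: near_eq_cvg; near=> h.
have h0 : h != 0 by near: h; exact: nbhs_dnbhs_neq.
rewrite /= H /= -[RHS]/(_ * _).
by field.
Unshelve. all: by end_near. Qed.

Context (nabla : connection R N) (hnabla : levi_civita (carnot_metric R m) nabla).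

(** The Christoffel matrix in the direction w: the covariant derivative of Y in
    the direction w is the derivative of Y plus Gam x w *m Y. *)
Definition Gam (x w : 'cV[R]_N) : 'M[R]_N := \sum_(i < N) w i 0 *: nabla x i.

Lemma Gam_linear x : linear (Gam x).
Proof.
move=> a u v; rewrite /Gam scaler_sumr -big_split; apply: eq_bigr => i _ /=.
by rewrite !mxE scalerDl scalerA.
Qed.

Lemma Gam_delta x i : Gam x (delta_mx i 0) = nabla x i.
Proof.
rewrite /Gam (bigD1 i) //= mxE !eqxx scale1r big1 ?addr0 // => j ji.
by rewrite mxE (negbTE ji) scale0r.
Qed.

Lemma linear_ext p q r (f g : 'cV[R]_p -> 'M[R]_(q, r)) :
  linear f -> linear g -> (forall i, f (delta_mx i 0) = g (delta_mx i 0)) ->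
  f =1 g.
Proof.
move=> lf lg fg v.
have sum_lin (h : 'cV[R]_p -> 'M[R]_(q, r)) : linear h ->
    h v = \sum_i v i 0 *: h (delta_mx i 0).
  move=> lh; pose hM := GRing.isLinear.Build _ _ _ _ h lh.
  pose h' : {linear 'cV[R]_p -> 'M[R]_(q, r)} := HB.pack h hM.
  have E : h' v = \sum_i v i 0 *: h' (delta_mx i 0).
    rewrite {1}[v](matrix_sum_delta v) linear_sum; apply: eq_bigr => i _.
    by rewrite big_ord1 linearZ.
  exact: E.
by rewrite !sum_lin //; apply: eq_bigr => i _; rewrite fg.
Qed.

Lemma Gam_sym x (w z : 'cV[R]_N) : Gam x w *m z = Gam x z *m w.
Proof.
have E (u v : 'cV[R]_N) k : (Gam x u *m v) k 0 =
    \sum_j \sum_i v j 0 * u i 0 * nabla x i k j.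
  rewrite mxE; apply: eq_bigr => j _; rewrite summxE mulr_suml.
  by apply: eq_bigr => i _; rewrite mxE; ring.
apply/matrixP => k j; rewrite !ord1 !E exchange_big /=.
apply: eq_bigr => i _; apply: eq_bigr => j' _.
by have [tf _] := hnabla; rewrite (tf x i j' k); ring.
Qed.

Lemma metricE x : carnot_metric R m x =
  (1%:M - Bmx (usubmx x))^T *m (1%:M - Bmx (usubmx x)).
Proof. by rewrite /carnot_metric invmx_jacobian. Qed.

Lemma derive_metric (x v : 'cV[R]_N) j k :
  'D_v (fun y => carnot_metric R m y j k) x =
  - ((Bmx (usubmx v))^T *m (1%:M - Bmx (usubmx x))
     + (1%:M - Bmx (usubmx x))^T *m Bmx (usubmx v)) j k.
Proof.
apply: (@derive_quad _ _ _ _ _ (((Bmx (usubmx v))^T *m Bmx (usubmx v)) j k)) => h.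
rewrite !metricE; set M := 1%:M - Bmx (usubmx x); set B := Bmx (usubmx v).
have -> : 1%:M - Bmx (usubmx (h *: v + x)) = M - h *: B.
  rewrite /M /B [usubmx _]linearP [Bmx _]linearP /=.
  move: (Bmx (usubmx v)) (Bmx (usubmx x)) => X Y.
  by apply/matrixP => a b; rewrite !mxE; ring.
have -> : (M - h *: B)^T *m (M - h *: B) =
    M^T *m M + h *: (- (B^T *m M + M^T *m B)) + h ^+ 2 *: (B^T *m B).
  rewrite [(M - h *: B)^T]linearB /= [(h *: B)^T]linearZ /= mulmxBl !mulmxBr -!scalemxAl -!scalemxAr scalerA -expr2.
  by apply/matrixP => a b; rewrite !mxE; ring.
by move: (M^T *m M) (B^T *m M + _) (B^T *m B) => X Y Z; rewrite !mxE.
Qed.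

Lemma Gam_metric x w :
  (Gam x w)^T *m carnot_metric R m x + carnot_metric R m x *m Gam x w =
  - ((Bmx (usubmx w))^T *m (1%:M - Bmx (usubmx x))
     + (1%:M - Bmx (usubmx x))^T *m Bmx (usubmx w)).
Proof.
have basis i : (nabla x i)^T *m carnot_metric R m x + carnot_metric R m x *m nabla x i =
  - ((Bmx (usubmx (delta_mx i 0 : 'cV[R]_N)))^T *m (1%:M - Bmx (usubmx x))
     + (1%:M - Bmx (usubmx x))^T *m Bmx (usubmx (delta_mx i 0 : 'cV[R]_N))).
  apply/matrixP => j k; rewrite [RHS]mxE -derive_metric.
  have [_ mc] := hnabla; rewrite mc 2!mxE [X in _ + X]mxE -big_split /=.
  apply: eq_bigr => l _; rewrite !mxE; ring.
pose f w := (Gam x w)^T *m carnot_metric R m x + carnot_metric R m x *m Gam x w.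
pose g (w : 'cV[R]_N) := - ((Bmx (usubmx w))^T *m (1%:M - Bmx (usubmx x))
     + (1%:M - Bmx (usubmx x))^T *m Bmx (usubmx w)).
apply: (@linear_ext _ _ _ f g) => [a u v|a u v|i].
- rewrite /f Gam_linear [(_ + _)^T]linearP /= mulmxDl mulmxDr.
  by rewrite -scalemxAl -scalemxAr scalerDr addrACA.
- rewrite /g; move: (1%:M - Bmx (usubmx x)) => M; rewrite [usubmx _]linearP [Bmx _]linearP /= [(_ + Bmx _)^T]linearP /=.
  by rewrite mulmxDl mulmxDr -scalemxAl -scalemxAr scalerN scalerDr -opprD addrACA.
by rewrite /f Gam_delta basis.
Qed.

(** The connection form in the frame J: the covariant derivative of J z in the
    direction J a is J times (the derivative of z plus Om x a *m z). *)
Definition Om (x a : 'cV[R]_N) : 'M[R]_N :=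
  invmx (jacobian_frame x) *m Gam x (jacobian_frame x *m a) *m jacobian_frame x
  + Bmx (usubmx a).

(** Compatibility with the metric, as the frame is orthonormal. *)
Lemma Om_skew x a : (Om x a)^T = - Om x a.
Proof.
have UJ := jacobian_frame_unit x.
set J := jacobian_frame x in UJ; set M := invmx J.
have ME : 1%:M - Bmx (usubmx x) = M by rewrite /M invmx_jacobian.
have := Gam_metric x (J *m a); rewrite metricE ME usubmx_jac.
set G := Gam _ _; set B := Bmx (usubmx a) => H.
have MJ : M *m J = 1%:M by rewrite mulVmx.
have BJ : B *m J = B by rewrite Bmx_jac.
have JM : J^T *m M^T = 1%:M by rewrite -trmx_mul MJ trmx1.
have JB : J^T *m B^T = B^T by rewrite -trmx_mul BJ.
have {}H := congr1 (fun X => J^T *m X *m J) H.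
have L1 : J^T *m (G^T *m (M^T *m M)) *m J = J^T *m G^T *m M^T.
  by rewrite !mulmxA -[_ *m M *m J]mulmxA MJ mulmx1.
have L2 : J^T *m (M^T *m M *m G) *m J = M *m G *m J by rewrite !mulmxA JM mul1mx.
have R1 : J^T *m (B^T *m M) *m J = B^T.
  by rewrite !mulmxA JB -mulmxA MJ mulmx1.
have R2 : J^T *m (M^T *m B) *m J = B by rewrite mulmxA JM mul1mx BJ.
rewrite /= mulmxDr mulmxDl L1 L2 mulmxN mulNmx mulmxDr mulmxDl R1 R2 in H.
rewrite /Om -/J -/M -/G -/B [(_ + B)^T]linearD /= !trmx_mul mulmxA.
by apply/eqP; rewrite -addr_eq0 addrACA H addNr.
Qed.

(** Absence of torsion: the right-hand side is the bracket of left-invariant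
    fields. *)
Lemma Om_torsion x (a b : 'cV[R]_N) :
  Om x a *m b - Om x b *m a = Bmx (usubmx a) *m b - Bmx (usubmx b) *m a.
Proof.
rewrite /Om !mulmxDl -!mulmxA Gam_sym.
by rewrite opprD addrACA subrr add0r.
Qed.

Let dot (a b : 'cV[R]_N) : R := (a^T *m b) 0 0.

Let dotC a b : dot a b = dot b a. Proof. exact: dot_sym. Qed.

Let dotD a b c : dot a (b + c) = dot a b + dot a c.
Proof. by rewrite /dot mulmxDr mxE. Qed.

Let dotN a b : dot a (- b) = - dot a b.
Proof. by rewrite /dot mulmxN mxE. Qed.

Let dot_adjoint A a b : dot a (A *m b) = dot (A^T *m a) b.
Proof. by rewrite /dot trmx_mul trmxK mulmxA. Qed.

(** Koszul's formula: a form which is skew and has a given torsion is determined by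
    a combination of the torsion identities for the three cyclic orders of a, b
    and c.  The result does not depend on x. *)
Lemma OmE x (a b : 'cV[R]_N) : Om x a *m b =
  Bmx (usubmx a) *m b - (Bmx (usubmx a))^T *m b - (Bmx (usubmx b))^T *m a.
Proof.
have dot_ext (u v : 'cV[R]_N) : (forall c, dot c u = dot c v) -> u = v.
  move=> H; apply/matrixP => i j; rewrite ord1.
  have rE (w : 'cV[R]_N) : dot (delta_mx i 0) w = w i 0.
    rewrite /dot mxE (bigD1 i) //= !mxE !eqxx mul1r big1 ?addr0 // => k ki.
    by rewrite !mxE (negbTE ki) mul0r.
  by have := H (delta_mx i 0); rewrite !rE.
apply: dot_ext => c.
have tor u v w : dot w (Om x u *m v) - dot w (Om x v *m u) =
    2 * dot w (Bmx (usubmx u) *m v).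
  rewrite -dotN -dotD Om_torsion (Bmx_anti v u) opprK dotD; ring.
have skw u v w : dot w (Om x u *m v) = - dot v (Om x u *m w).
  by rewrite dot_adjoint Om_skew mulNmx dotC dotN.
have t1 := tor a b c; have t2 := tor b c a; have t3 := tor c a b.
have s1 := skw a c b; have s2 := skw b c a; have s3 := skw c a b.
rewrite !dotD !dotN -[in X in _ - X - _](trmxK (Bmx (usubmx a))).
have adj1 : dot c ((Bmx (usubmx a))^T *m b) = dot b (Bmx (usubmx a) *m c).
  by rewrite dot_adjoint trmxK dotC.
have adj2 : dot c ((Bmx (usubmx b))^T *m a) = dot a (Bmx (usubmx b) *m c).
  by rewrite dot_adjoint trmxK dotC.
have an : dot b (Bmx (usubmx a) *m c) = - dot b (Bmx (usubmx c) *m a).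
  by rewrite Bmx_anti dotN.
rewrite ?trmxK adj1 adj2; lra.
Qed.

(** The connection form in a horizontal direction. *)
Definition om (u : 'cV[R]_m) : 'M[R]_N := Bmx u - (Bmx u)^T.

Definition hor (u : 'cV[R]_m) : 'cV[R]_N := col_mx u 0.

Lemma Om_hor x u : Om x (hor u) = om u.
Proof.
apply: mulmx_cV_ext => b; rewrite OmE /om mulmxBl /hor col_mxKu.
rewrite [X in _ - X](_ : _ = 0) ?subr0 //.
rewrite tr_block_mx !trmx0 mul_block_col !mulmx0 !mul0mx !addr0.
by rewrite col_mx0.
Qed.

Lemma Gam_hor x u : Gam x (jacobian_frame x *m hor u) *m jacobian_frame x + Bmx u
  = jacobian_frame x *m om u.
Proof.
have UJ := jacobian_frame_unit x.
rewrite -(Om_hor x) /Om mulmxDr jac_Bmx !mulmxA mulmxV // mul1mx.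
by rewrite /hor col_mxKu.
Qed.

(** This is why parallel transport in horizontal directions is generated by the
    adjoint representation of so(1+m). *)
Lemma om_adjoint u z :
  om u *m z = ofskew (- 2^-1 *: (toskew (hor u) *m toskew z - toskew z *m toskew (hor u))).
Proof.
rewrite -[z]vsubmxK; move: (usubmx z) (dsubmx z) => v y.
rewrite /om mulmxBl Bmx_mul tr_block_mx !trmx0 mul_block_col !mul0mx.
rewrite !add0r ?addr0 col_mxKu opp_col_mx add_col_mx oppr0 ?addr0 ?add0r.
rewrite /toskew /hor !col_mxKu !col_mxKd linear0 !mulmx_block !mul0mx !mulmx0 ?add0r ?addr0.
rewrite opp_block_mx add_block_mx scale_block_mx /ofskew block_mxKdl block_mxKdr.
congr col_mx; last first.
  apply/matrixP => k j; rewrite !ord1 wedgeE !mxE !big_ord1 !mxE; ring.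
rewrite sub0r scalerN scaleNr opprK; apply/matrixP => h j; rewrite !ord1.
rewrite mxE [RHS]mxE mxE /vert_skew mulmx_suml summxE mulr_sumr.
rewrite [RHS](reindex (@index_pair m)) /=; last first.
  by exists (@pair_index m) => ? _; [exact: index_pairK|exact: pair_indexK].
rewrite -sumrN; apply: eq_bigr => k _; rewrite index_pairK.
have dE (a b : 'I_m) : ((delta_mx a b : 'M[R]_m) *m u) h 0 = (a == h)%:R * u b 0.
  rewrite mxE (bigD1 b) //= big1 ?addr0 ?mxE ?eqxx ?andbT => [|l lb].
    by rewrite eq_sym.
  by rewrite mxE (negbTE lb) andbF mul0r.
have H (A B : 'cV[R]_m) (a : R) : (a *: (A - B)) h 0 = a * (A h 0 - B h 0).
  by rewrite !mxE.
rewrite -scalemxAl mulmxBl H !dE !mxE.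
by do 2![case: (_ == h)]; rewrite ?mulr1n ?mulr0n; ring.
Qed.

(** Solving the formula for the connection form, the Christoffel symbols are
    polynomial in x. *)
Lemma continuous_nabla i : continuous (fun x => nabla x i).
Proof.
have oT : open [set: 'cV[R]_N] by exact: openT.
apply: smooth_continuous; apply: smooth_on_mx => // k j.
have sid : smooth_on [set: 'cV[R]_N] id by exact: smooth_on_id.
have su : smooth_on [set: 'cV[R]_N] (@usubmx R m (vdim m) 1) by exact: smooth_on_usubmx.
have sW (f : 'cV[R]_N -> 'cV[R]_m) :
    smooth_on [set: 'cV[R]_N] f -> smooth_on [set: 'cV[R]_N] (fun x => wedge (f x)).
  move=> sf; apply: smooth_on_mx => // a b.
  pose F (x : 'cV[R]_N) := 2^-1 * ((f x) (val (index_pair a)).1 0 * ((val (index_pair a)).2 == b)%:R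
     + -1 * ((f x) (val (index_pair a)).2 0 * ((val (index_pair a)).1 == b)%:R)).
  apply: (@smooth_on_eq _ _ _ oT _ F) => [x _|]; first by rewrite mxE /F mulN1r !mulr_natr.
  apply: smooth_onM => //; first exact: smooth_on_cst.
  apply: smooth_onD => //; first by apply: smooth_onM => //; [exact: smooth_on_entry|exact: smooth_on_cst].
  apply: smooth_onM => //; first exact: smooth_on_cst.
  by apply: smooth_onM => //; [exact: smooth_on_entry|exact: smooth_on_cst].
have sB (f : 'cV[R]_N -> 'cV[R]_m) :
    smooth_on [set: 'cV[R]_N] f -> smooth_on [set: 'cV[R]_N] (fun x => Bmx (f x)).
  move=> sf; apply: smooth_on_col_mx => //; first exact: smooth_on_cst.
  by apply: smooth_on_row_mx => //; [exact: sW|exact: smooth_on_cst].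
pose J (x : 'cV[R]_N) := 1%:M + Bmx (usubmx x) : 'M[R]_N.
pose M (x : 'cV[R]_N) := 1%:M - Bmx (usubmx x) : 'M[R]_N.
have sBu := sB _ su.
have sJ : smooth_on [set: 'cV[R]_N] J by apply: smooth_onD => //; exact: smooth_on_cst.
have sM : smooth_on [set: 'cV[R]_N] M.
  by apply: smooth_onD => //; [exact: smooth_on_cst|exact: smooth_onN].
pose e (l : 'I_N) : 'cV[R]_N := delta_mx l 0.
pose F x := J x *m (Bmx (usubmx (M x *m e i)) *m (M x *m e j)
   - (Bmx (usubmx (M x *m e i)))^T *m (M x *m e j)
   - (Bmx (usubmx (M x *m e j)))^T *m (M x *m e i))
   - Bmx (usubmx (M x *m e i)) *m (M x *m e j).
have NE x : nabla x i k j = F x k 0.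
  have UJ := jacobian_frame_unit x.
  have -> : nabla x i k j = (nabla x i *m e j) k 0 by rewrite /e -colE mxE.
  have JE : J x = jacobian_frame x by rewrite jacobian_frameE.
  have ME : M x = invmx (jacobian_frame x) by rewrite invmx_jacobian.
  have Ja l : jacobian_frame x *m (invmx (jacobian_frame x) *m e l) = e l.
    by rewrite mulKVmx.
  congr (fun_of_matrix _ k 0); rewrite /F -(OmE x) JE ME /Om Ja Gam_delta.
  rewrite mulmxDl mulmxDr [_ *m (Bmx _ *m _)]mulmxA jac_Bmx addrK.
  by rewrite -!mulmxA Ja mulKVmx.
have sMe l : smooth_on [set: 'cV[R]_N] (fun x => M x *m e l).
  by apply: smooth_on_mulmx => //; exact: smooth_on_cst.
have sBM l : smooth_on [set: 'cV[R]_N] (fun x => Bmx (usubmx (M x *m e l))).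
  by apply: sB; exact: smooth_on_usubmx.
have sBt l : smooth_on [set: 'cV[R]_N] (fun x => (Bmx (usubmx (M x *m e l)))^T).
  exact: smooth_on_trmx.
have sF : smooth_on [set: 'cV[R]_N] F.
  apply: smooth_onD => //; last by apply: smooth_onN => //; exact: smooth_on_mulmx.
  apply: smooth_on_mulmx => //; apply: smooth_onD => //.
    apply: smooth_onD => //; first exact: smooth_on_mulmx.
    by apply: smooth_onN => //; exact: smooth_on_mulmx.
  by apply: smooth_onN => //; exact: smooth_on_mulmx.
by apply: (smooth_on_eq oT) (smooth_on_entry oT k 0 sF) => x _; rewrite NE.
Qed.

End Connection.

(** * Horizontal transport stays in adj(SO(1+m)) *)
Section Invariance.
Context (R : realType) (m : nat).
Local Notation N := (m + vdim m)%N.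
Local Notation n := (1 + m)%N.
Local Notation K := (@adjSO R m).

(** Differentiating cayley ((s - t) X) (1 + (s - t) X) = 1 - (s - t) X at s = t
    gives the velocity. *)
Lemma is_derive_cayley (X : 'M[R]_n) (t : R) : X^T = - X ->
  is_derive t (1 : R) (fun s => cayley ((s - t) *: X)) (- 2 *: X).
Proof.
move=> Xs; have sk s : ((s - t) *: X)^T = - ((s - t) *: X).
  by rewrite linearZ /= Xs scalerN.
have oT : open [set: R] by exact: openT.
have sY : smooth_on [set: R] (fun s => (s - t) *: X).
  apply: smooth_onZ => //; last exact: smooth_on_cst.
  by apply: smooth_onD => //; [exact: smooth_on_id|exact: smooth_on_cst].
have sc : smooth_on [set: R] (fun s => cayley ((s - t) *: X)).
  by apply: smooth_on_cayley => // s _; exact: skew_unitmx.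
have dc : derivable (fun s => cayley ((s - t) *: X)) t 1.
  by apply/derivable1_diffP; apply: smooth_on_differentiable sc _.
have d1 : is_derive t (1 : R) (fun s => (s - t) *: X) X.
  have H : is_derive t (1 : R) (id - cst t : R -> R) (1 - 0) by exact: is_deriveB.
  by apply: is_derive_eq (is_derive_scalel X H) _; rewrite subr0 scale1r.
have d2 : is_derive t (1 : R) (fun s => 1%:M + (s - t) *: X) X.
  by apply: is_derive_eq; rewrite add0r.
have d3 : is_derive t (1 : R) (fun s => 1%:M - (s - t) *: X) (- X).
  by apply: is_derive_eq; rewrite sub0r.
have E : (fun s => cayley ((s - t) *: X) *m (1%:M + (s - t) *: X)) =
    (fun s => 1%:M - (s - t) *: X).
  by apply/funext => s; rewrite cayley_mul //; exact: skew_unitmx.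
have := is_derive_mulmx (derivableP dc) d2; rewrite E subrr scale0r addr0 mulmx1.
have -> : cayley (0 : 'M[R]_n) = 1%:M.
  by rewrite /cayley subr0 addr0 mul1mx invmx1.
rewrite mul1mx => d4.
have H : 'D_1 (fun s => cayley ((s - t) *: X)) t + X = - X.
  by rewrite -(@derive_val _ _ _ _ _ _ _ d4) (@derive_val _ _ _ _ _ _ _ d3).
apply: DeriveDef => //.
apply: (addIr X); rewrite H scaleNr scaler_nat mulr2n opprD addrNK //.
Qed.

(** The Leibniz rule for c z c^T. *)
Lemma is_derive_adj (c : R -> 'M[R]_n) t dc (D : 'M[R]_N) :
  is_derive t (1 : R) c dc ->
  (forall z, D *m z = ofskew (dc *m toskew z *m (c t)^T + c t *m toskew z *m dc^T)) ->
  is_derive t (1 : R) (fun s => adj (c s)) D.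
Proof.
move=> hc HD; apply/is_derive_mxP => i j.
have co : continuous (@ofskew R m).
  apply: smooth_continuous; apply: smooth_on_ofskew; first exact: openT.
  exact: smooth_on_id.
have H : is_derive t (1 : R)
    (fun s => ofskew (c s *m toskew (delta_mx j 0) *m (c s)^T)) (D *m delta_mx j 0).
  rewrite HD; apply: is_derive_lin => //; first exact: ofskew_linear.
  apply: is_derive_eq.
    apply: is_derive_mulmx; last exact: is_derive_trmx.
    apply: is_derive_mulmx; exact: is_derive_cst.
  by rewrite mulmx0 addr0.
have -> : (fun s => adj (c s) i j) =
    (fun s => ofskew (c s *m toskew (delta_mx j 0) *m (c s)^T) i 0).
  by apply/funext => s; rewrite mxE.
have -> : D i j = (D *m (delta_mx j 0 : 'cV[R]_N)) i 0 by rewrite -colE mxE.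
by move/is_derive_mxP : H.
Qed.

(** The factor 1/4 turns the velocity -2 X of the Cayley curve into the commutator
    of om_adjoint. *)
Lemma adjSO_curve (u : 'cV[R]_m) t : exists k : R -> 'M[R]_N,
  [/\ forall s, K (k s), k t = 1%:M & is_derive t (1 : R) k (om u)].
Proof.
pose X : 'M[R]_n := 4^-1 *: toskew (hor u).
have Xs : X^T = - X by rewrite linearZ /= toskew_tr scalerN.
exists (fun s => adj (cayley ((s - t) *: X))); split.
- move=> s; exists (cayley ((s - t) *: X)) => //; apply: cayley_SO.
  by rewrite linearZ /= Xs scalerN.
- by rewrite subrr scale0r /cayley subr0 addr0 mul1mx invmx1 adj1.
apply: (is_derive_adj (is_derive_cayley t Xs)) => z.
rewrite subrr scale0r /cayley subr0 addr0 mul1mx invmx1 trmx1 mulmx1 mul1mx.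
rewrite om_adjoint [(_ *: X)^T]linearZ /= Xs; congr ofskew.
rewrite /X -scalerN !scalerA -scalemxAl -scalemxAr mulmxN.
move: (_ *m _) (_ *m _) => A B.
by apply/matrixP => i j; rewrite !mxE; field.
Qed.

(** The square of a norm which, unlike the maximum of the entries, is invariant
    under orthogonal matrices. *)
Definition frob (x : 'M[R]_N) : R := \tr (x^T *m x).

Lemma frobE x : frob x = \sum_i \sum_j x j i ^+ 2.
Proof.
by apply: eq_bigr => i _; rewrite mxE; apply: eq_bigr => j _; rewrite mxE expr2.
Qed.

Lemma frob_ge0 x : 0 <= frob x.
Proof. by rewrite frobE; do 2![apply: sumr_ge0 => ? _]; rewrite sqr_ge0. Qed.

Lemma frob_mul x k : K k -> frob (x *m k) = frob x.
Proof.
move=> Kk; rewrite /frob trmx_mul mxtrace_mulC mulmxA -[_ *m k *m k^T]mulmxA.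
by rewrite adjSO_orth' // mulmx1 mxtrace_mulC.
Qed.

Lemma norm_le_frob x (r : R) : 0 <= r -> frob x < r ^+ 2 -> `|x| <= r.
Proof.
move=> r0 xr; apply: mx_norm_le => // i j.
rewrite -(@ler_sqr _ _ r) ?nnegrE // real_normK ?num_real //.
apply: le_trans (ltW xr); rewrite frobE (bigD1 j) //= (bigD1 i) //= -addrA lerDl.
by rewrite addr_ge0 //; do ?[apply: sumr_ge0 => ? _]; rewrite ?sqr_ge0.
Qed.

Lemma frob_lip x y M : `|x| <= M -> `|y| <= M ->
  `|frob x - frob y| <= N%:R ^+ 2 * (2 * M) * `|x - y|.
Proof.
move=> xM yM; rewrite !frobE -sumrB.
apply: le_trans (ler_norm_sum _ _ _) _.
apply: (@le_trans _ _ (\sum_(i < N) \sum_(j < N) (2 * M * `|x - y|))); last first.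
  by rewrite !sumr_const card_ord -mulrnA -[leLHS]mulr_natl natrM expr2 !mulrA.
apply: ler_sum => i _; rewrite -sumrB; apply: le_trans (ler_norm_sum _ _ _) _.
apply: ler_sum => j _; rewrite subr_sqr normrM mulrC; apply: ler_pM => //.
  apply: le_trans (ler_normD _ _) _; rewrite mulrDl mul1r; apply: lerD.
    exact: le_trans (mx_norm_entry _ _ _) xM.
  exact: le_trans (mx_norm_entry _ _ _) yM.
by have := mx_norm_entry (x - y) j i; rewrite !mxE.
Qed.

Definition sqdist (b : 'M[R]_N) : R := inf [set frob (b - k) | k in K].

Lemma has_inf_sqdist b : has_inf [set frob (b - k) | k in K].
Proof.
split; first by exists (frob (b - 1%:M)); exists 1%:M => //; exact: adjSO1.
by exists 0 => _ [k _ <-]; exact: frob_ge0.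
Qed.

Lemma sqdist_le b k : K k -> sqdist b <= frob (b - k).
Proof. by move=> Kk; apply: ge_inf; [case: (has_inf_sqdist b)|exists k]. Qed.

Lemma sqdist_mul b k : K k -> sqdist (b *m k) = sqdist b.
Proof.
move=> Kk; congr inf; apply/seteqP; split=> [_ [l Kl <-]|_ [l Kl <-]].
  exists (l *m k^T); first by apply: adjSO_mul => //; exact: adjSO_tr.
  rewrite -(frob_mul _ Kk) mulmxBl -mulmxA [k^T *m k]adjSO_orth // mulmx1.
  by [].
exists (l *m k); first exact: adjSO_mul.
by rewrite -mulmxBl frob_mul.
Qed.

Lemma adjSO_norm k : K k -> `|k| <= 1.
Proof. by move=> Kk; apply: orth_norm_le1; exact: adjSO_orth. Qed.

(** An infimum of functions with a common Lipschitz constant on each ball. *)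
Lemma sqdist_lip b b' M : `|b| <= M -> `|b'| <= M ->
  `|sqdist b - sqdist b'| <= N%:R ^+ 2 * (2 * (M + 1)) * `|b - b'|.
Proof.
wlog bb' : b b' / sqdist b' <= sqdist b.
  move=> W bM b'M; case: (leP (sqdist b') (sqdist b)) => [|/ltW] h; first exact: W.
  by rewrite (distrC b) (distrC (sqdist b)); apply: (W b' b).
move=> bM b'M; rewrite ger0_norm ?subr_ge0 // lerBlDr -lerBlDl.
apply: lb_le_inf; first by case: (has_inf_sqdist b').
move=> _ [k Kk <-]; rewrite lerBlDr; apply: le_trans (sqdist_le b Kk) _.
rewrite -lerBlDl; apply: le_trans (ler_norm _) _.
have -> : b - b' = (b - k) - (b' - k) by rewrite opprB addrA subrK.
have kM c : `|c| <= M -> `|c - k| <= M + 1.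
  by move=> cM; apply: le_trans (ler_normB _ _) _; rewrite lerD // adjSO_norm.
exact: frob_lip (kM _ bM) (kM _ b'M).
Qed.

Lemma sqdist0 b : sqdist b <= 0 -> K b.
Proof.
move=> b0; apply: contrapT => nK.
have cK : closed K by apply: compact_closed; [exact: norm_hausdorff|exact: compact_adjSO].
have oK : open (~` K) by rewrite openC.
have /nbhs_ballP[r /= r0 rK] : nbhs b (~` K) by exact: open_nbhs_nbhs.
have r2 : 0 < r / 2 by rewrite divr_gt0.
have : (r / 2) ^+ 2 <= sqdist b.
  apply: lb_le_inf; first by case: (has_inf_sqdist b).
  move=> _ [k Kk <-]; rewrite leNgt; apply/negP => /(norm_le_frob (ltW r2)) bk.
  apply: (rK k) => //; rewrite -ball_normE /=; apply: le_lt_trans bk _.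
  by rewrite ltr_pdivrMr // mulr_natr mulr2n ltrDl.
by move=> /le_trans/(_ b0); rewrite leNgt exprn_gt0.
Qed.

(** At a time t with velocity a(t) om(u), compare a(s) with a(t) k(s), where k is
    a curve in K through 1 with velocity om(u): the distance of a(t) k(s) to K is
    constant in s, and a(s) - a(t) k(s) = o(s - t).  So the distance of a to K has
    derivative zero almost everywhere, hence it is constant. *)
Lemma adjSO_invariant (a : R -> 'M[R]_N) : abs_continuous 0 1 a -> a 0 = 1%:M ->
  (\forall t \ae (@lebesgue_measure R), t \in `]0, 1[ ->
     exists u, is_derive (t : R) (1 : R) a (a t *m om u)) ->
  K (a 1).
Proof.
move=> aca a0 aea.
have [M M0 aM] := abs_continuous_bounded aca.
pose M1 := M + N%:R * M.
have MM1 : M <= M1 by rewrite lerDl mulr_ge0.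
pose C := N%:R ^+ 2 * (2 * (M1 + 1)).
have C0 : 0 <= C by rewrite /C !mulr_ge0 ?exprn_ge0 // addr_ge0 // (le_trans M0).
have acd : abs_continuous 0 1 (fun t => sqdist (a t)).
  apply: (@abs_continuous_comp_lip _ _ _ a sqdist _ _ C) => // s t s01 t01.
  by apply: sqdist_lip; apply: le_trans MM1; exact: aM.
have : `|sqdist (a 1) - sqdist (a 0)| <= 0 * (1 - 0).
  have H := @abs_continuous_loc_lip R _ (fun t => sqdist (a t)) 0 1 0.
  apply: H => //.
  apply: lebesgue_aeS aea => t H t01 e e0; have [u du] := H t01.
  have [k [Kk kt dk]] := adjSO_curve u t.
  have dd : is_derive t (1 : R) (fun s => a s - a t *m k s) 0.
    have d2 : is_derive t (1 : R) (fun s => a t *m k s) (0 *m k t + a t *m om u).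
      by apply: is_derive_mulmx; exact: is_derive_cst.
    have d3 := is_deriveB du d2.
    by rewrite mul0mx add0r subrr in d3.
  have e1 : 0 < e / (C + 1) by rewrite divr_gt0 // ltr_wpDl.
  have [d d0 Hd] := is_derive_approx dd e1.
  exists d => // s s01 /Hd; rewrite kt mulmx1 subrr !(subr0, scaler0) add0r => Hs.
  have tt01 : 0 <= t <= 1.
    by move: t01; rewrite in_itv /= => /andP[/ltW -> /ltW ->].
  have akM : `|a t *m k s| <= M1.
    apply: le_trans (mx_norm_mul _ _) _; apply: (@le_trans _ _ (N%:R * M)).
      rewrite ler_wpM2l // -[leRHS]mulr1; apply: ler_pM => //; first exact: aM.
      exact: adjSO_norm.
    by rewrite lerDr.
  rewrite -(sqdist_mul (a t) (Kk s)).
  apply: le_trans (sqdist_lip _ akM) _; first by apply: le_trans MM1; exact: aM.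
  rewrite -/C; apply: (@le_trans _ _ (C * (e / (C + 1) * `|s - t|))).
    by rewrite ler_wpM2l.
  rewrite mulrA ler_wpM2r // mulrCA ler_piMr ?(ltW e0) //.
  by rewrite ler_pdivrMr ?ltr_wpDl // mul1r lerDl.
rewrite mul0r normr_le0 subr_eq0 a0 => /eqP d1.
apply: sqdist0; rewrite d1; apply: le_trans (sqdist_le _ (adjSO1 R m)) _.
by rewrite subrr /frob trmx0 mul0mx mxtrace0.
Qed.

End Invariance.

(** * Upper bound for the horizontal holonomy *)
Section Upper.
Context (R : realType) (m : nat).
Local Notation N := (m + vdim m)%N.
Local Notation n := (1 + m)%N.
Local Notation K := (@adjSO R m).
Context (nabla : connection R N) (hnabla : levi_civita (carnot_metric R m) nabla).
Local Notation J := (@jacobian_frame R m).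
Local Notation Gam := (@Gam R m nabla).

Lemma horizontalP x w : horizontal R m x w <-> exists u, w = J x *m hor u.
Proof.
have E u : J x *m hor u = \sum_(h < m) u h 0 *: X_field h x.
  rewrite /jacobian_frame /hor mul_row_col mulmx0 addr0.
  apply/matrixP => i j; rewrite ord1 summxE mxE; apply: eq_bigr => h _.
  by rewrite !mxE mulrC.
split=> [[u ->]|[u ->]]; last by exists (fun h => u h 0); rewrite E.
by exists (\col_h u h); rewrite E; apply: eq_bigr => h _; rewrite mxE.
Qed.

Lemma abs_continuous_lin (V W : normedModType R) (L : V -> W) (f : R -> V) a b :
  linear L -> continuous L -> abs_continuous a b f ->
  abs_continuous a b (fun t => L (f t)).
Proof.
move=> lL cL acf.
pose LM := GRing.isLinear.Build _ _ _ _ L lL.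
pose L' : {linear V -> W} := HB.pack L LM.
have [k k0 Hk] := linear_lipschitz (f := L') cL.
apply: (@abs_continuous_comp_lip _ _ _ f L _ _ k) => // [|s t _ _].
  exact: ltW.
have -> : L (f s) - L (f t) = L' (f s - f t) by rewrite linearB.
exact: Hk.
Qed.

Lemma linear_Bu : linear (fun x : 'cV[R]_N => Bmx (usubmx x)).
Proof. by move=> a u v; rewrite [usubmx _]linearP [Bmx _]linearP. Qed.

Lemma continuous_Bu : continuous (fun x : 'cV[R]_N => Bmx (usubmx x)).
Proof.
have oT : open [set: 'cV[R]_N] by exact: openT.
apply: smooth_continuous; apply: smooth_on_mx => // i j.
have E : (fun x : 'cV[R]_N => Bmx (usubmx x) i j) =
    (fun x => \sum_(l < N) x l 0 * Bmx (usubmx (delta_mx l 0 : 'cV[R]_N)) i j).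
  apply/funext => x; rewrite {1}[x](matrix_sum_delta x).
  rewrite !linear_sum summxE; apply: eq_bigr => l _.
  by rewrite big_ord1 !linearZ mxE.
rewrite E; apply: smooth_on_sum => // l; apply: smooth_onM => //.
  by apply: smooth_on_entry => //; exact: smooth_on_id.
exact: smooth_on_cst.
Qed.

Lemma abs_continuous_Bu (f : R -> 'cV[R]_N) a b : abs_continuous a b f ->
  abs_continuous a b (fun t => Bmx (usubmx (f t))).
Proof. exact: abs_continuous_lin linear_Bu continuous_Bu. Qed.

Lemma abs_continuous_J (f : R -> 'cV[R]_N) a b : abs_continuous a b f ->
  abs_continuous a b (fun t => J (f t)).
Proof.
move=> acf; have -> : (fun t => J (f t)) = (fun t => 1%:M + Bmx (usubmx (f t))).
  by apply/funext => t; rewrite jacobian_frameE.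
by apply: abs_continuousD; [exact: abs_continuous_cst|exact: abs_continuous_Bu].
Qed.

Lemma abs_continuous_invJ (f : R -> 'cV[R]_N) a b : abs_continuous a b f ->
  abs_continuous a b (fun t => invmx (J (f t))).
Proof.
move=> acf; have -> : (fun t => invmx (J (f t))) =
    (fun t => 1%:M + Bmx (usubmx (-1 *: f t))).
  apply/funext => t; rewrite invmx_jacobian.
  by rewrite [usubmx (-1 *: _)]linearZ [Bmx (-1 *: _)]linearZ /= scaleN1r.
apply: abs_continuousD; first exact: abs_continuous_cst.
apply: abs_continuous_Bu; apply: (@abs_continuous_comp_lip _ _ _ f (fun v => -1 *: v) _ _ 1) => //.
by move=> s t _ _; rewrite mul1r -scalerBr normrZ normrN1 mul1r.
Qed.

Lemma is_derive_Bu (f : R -> 'cV[R]_N) t w : is_derive t (1 : R) f w ->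
  is_derive t (1 : R) (fun s => Bmx (usubmx (f s))) (Bmx (usubmx w)).
Proof. exact: is_derive_lin linear_Bu continuous_Bu. Qed.

Lemma is_derive_J (f : R -> 'cV[R]_N) t w : is_derive t (1 : R) f w ->
  is_derive t (1 : R) (fun s => J (f s)) (Bmx (usubmx w)).
Proof.
move=> /is_derive_Bu df; have -> : (fun t => J (f t)) = (fun t => 1%:M + Bmx (usubmx (f t))).
  by apply/funext => s; rewrite jacobian_frameE.
have H := is_deriveD (is_derive_cst (1%:M : 'M[R]_N) t 1) df.
by rewrite add0r in H.
Qed.

Lemma is_derive_invJ (f : R -> 'cV[R]_N) t w : is_derive t (1 : R) f w ->
  is_derive t (1 : R) (fun s => invmx (J (f s))) (- Bmx (usubmx w)).
Proof.
move=> /is_derive_Bu df; have -> : (fun t => invmx (J (f t))) = (fun t => 1%:M - Bmx (usubmx (f t))).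
  by apply/funext => s; rewrite invmx_jacobian.
have H := is_deriveB (is_derive_cst (1%:M : 'M[R]_N) t 1) df.
by rewrite sub0r in H.
Qed.

Lemma om_tr (u : 'cV[R]_m) : (om u)^T = - om u.
Proof. by rewrite /om linearB /= trmxK opprB. Qed.

Lemma invJ_Bmx x (u : 'cV[R]_m) : invmx (J x) *m Bmx u = Bmx u.
Proof. by rewrite invmx_jacobian mulmxBl mul1mx BmxB subr0. Qed.

Lemma invJ_Gam x u : invmx (J x) *m Gam x (J x *m hor u) *m J x = om u - Bmx u.
Proof.
have UJ := jacobian_frame_unit x.
have := Gam_hor hnabla x u => /(congr1 (mulmx (invmx (J x)))).
by rewrite mulmxDr mulKmx // invJ_Bmx mulmxA => <-; rewrite addrK.
Qed.

(** The transpose is taken for om u to act on the right: this is the equation that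
    rolling satisfies too, and it is invariant under left multiplication by
    constants. *)
Lemma frame_ode (gam : R -> 'cV[R]_N) (Y : R -> 'M[R]_N) t u :
  is_derive t (1 : R) gam (J (gam t) *m hor u) ->
  is_derive t (1 : R) Y (- (Gam (gam t) (J (gam t) *m hor u) *m Y t)) ->
  is_derive t (1 : R) (fun s => (invmx (J (gam s)) *m Y s)^T)
    ((invmx (J (gam t)) *m Y t)^T *m om u).
Proof.
move=> dg dY; have UJ := jacobian_frame_unit (gam t).
have H := is_derive_trmx (is_derive_mulmx (is_derive_invJ dg) dY).
apply: is_derive_eq H _; rewrite usubmx_jac /hor col_mxKu.
set j := J (gam t) in UJ *.
have [Z YZ] : exists Z, Y t = j *m Z by exists (invmx j *m Y t); rewrite mulKVmx.
have E : - Bmx u *m Y t + invmx j *m (- (Gam (gam t) (j *m hor u) *m Y t)) =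
    - (om u *m Z).
  rewrite YZ mulNmx mulmxN !mulmxA /j Bmx_jac invJ_Gam.
  rewrite mulmxBl; move: (om u *m Z) (Bmx u *m Z) => A B.
  by apply/matrixP => a b; rewrite !mxE; ring.
by rewrite E YZ mulKmx // linearN /= trmx_mul om_tr mulmxN opprK.
Qed.

(** The transports of the columns of J(x) form a parallel matrix Y, to which
    frame_ode and the invariance of K apply. *)
Lemma holonomy_sub x P : horizontal_holonomy_at nabla (horizontal R m) x P ->
  exists2 k, K k & P = J x *m k *m invmx (J x).
Proof.
move=> [gam [[acg aeg] g0 g1 pt]]; have UJ := jacobian_frame_unit x.
have min01 : Num.min 0 1 = 0 :> R by rewrite min_l.
have max01 : Num.max 0 1 = 1 :> R by rewrite max_r.
have /choice[Y HY] : forall j : 'I_N, exists Y : R -> 'cV[R]_N,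
    [/\ parallel_along nabla gam 0 1 Y, Y 0 = J x *m delta_mx j 0 &
        Y 1 = P *m (J x *m delta_mx j 0)].
  by move=> j; have := pt (J x *m delta_mx j 0); rewrite min01 max01.
pose Ym t := \sum_(j < N) Y j t *m (delta_mx 0 j : 'rV[R]_N).
have deltaK (A : 'M[R]_N) :
    \sum_(j < N) (A *m delta_mx j 0) *m (delta_mx 0 j : 'rV[R]_N) = A.
  apply/matrixP => a b; rewrite summxE (bigD1 b) //= big1 ?addr0 => [|c cb].
    by rewrite mxE big_ord1 -colE !mxE !eqxx mulr1.
  by rewrite mxE big_ord1 !mxE [b == c]eq_sym (negbTE cb) andbF mulr0.
have Y0 : Ym 0 = J x.
  rewrite -[RHS]deltaK; apply: eq_bigr => j _.
  by have [_ -> _] := HY j.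
have Y1 : Ym 1 = P *m J x.
  rewrite -[RHS]deltaK; apply: eq_bigr => j _.
  by have [_ _ ->] := HY j; rewrite mulmxA.
have acY : abs_continuous 0 1 Ym.
  apply: abs_continuous_sum => j; apply: abs_continuous_mulmx.
    by have [[]] := HY j.
  exact: abs_continuous_cst.
pose a t := (invmx (J (gam t)) *m Ym t)^T.
have aca : abs_continuous 0 1 a.
  apply: abs_continuous_trmx; apply: abs_continuous_mulmx => //.
  exact: abs_continuous_invJ.
have aeY : \forall t \ae (@lebesgue_measure R), forall j : 'I_N,
   t \in `]0, 1[ -> exists2 w : 'cV[R]_N, is_derive (t : R) (1 : R) gam w &
      is_derive (t : R) (1 : R) (Y j)
        (- \sum_(i < N) w i 0 *: (nabla (gam t) i *m Y j t)).
  by apply: lebesgue_ae_forall => j; have [[]] := HY j.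
have Ka : K (a 1).
  apply: adjSO_invariant => //; first by rewrite /a Y0 g0 mulVmx // trmx1.
  apply: lebesgue_aeS (lebesgue_aeI aeg aeY) => t [Hg HYt] t01.
  have [w dg /horizontalP[u wE]] := Hg t01; exists u.
  apply: frame_ode; rewrite -?wE //.
  have dY j : is_derive t (1 : R) (Y j) (- (Gam (gam t) w *m Y j t)).
    have [w' dg' dY'] := HYt j t01.
    have <- : w' = w.
      by rewrite -(@derive_val _ _ _ _ _ _ _ dg) -(@derive_val _ _ _ _ _ _ _ dg').
    apply: is_derive_eq dY' _; congr (- _); rewrite /Gam mulmx_suml.
    by apply: eq_bigr => i _; rewrite scalemxAl.
  have dYm : is_derive t (1 : R) Ym
     (\sum_(j < N) (- (Gam (gam t) w *m Y j t) *m (delta_mx 0 j : 'rV[R]_N))).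
    have -> : Ym = \sum_(j < N) (fun s => Y j s *m (delta_mx 0 j : 'rV[R]_N)).
      by apply/funext => s; rewrite fct_sumE.
    apply: is_derive_sum => j.
    have H := is_derive_mulmx (dY j) (is_derive_cst (delta_mx 0 j : 'rV[R]_N) t 1).
    by rewrite mulmx0 addr0 in H.
  apply: is_derive_eq dYm _; rewrite /Ym mulmx_sumr -sumrN.
  by apply: eq_bigr => j _; rewrite mulNmx mulmxA.
exists (a 1)^T; first exact: adjSO_tr.
by rewrite /a trmxK g1 Y1 !mulmxA mulmxV // mul1mx mulmxK.
Qed.

End Upper.

(** * Absolutely continuous solutions of linear equations over short times *)
Section Gronwall.
Context (R : realType).

Lemma abs_continuous_lip_between (V : normedModType R) (f : R -> V) (a b M : R) : 0 <= M ->
  abs_continuous a b f ->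
  (\forall t \ae (@lebesgue_measure R), t \in `]a, b[ -> loc_lip f a b M t) ->
  forall s t, a <= s <= b -> a <= t <= b -> `|f s - f t| <= M * `|s - t|.
Proof.
move=> M0 acf aef s t; wlog st : s t / t <= s.
  move=> W sab tab; case: (leP t s) => [|/ltW] st; first exact: W.
  by rewrite (distrC s) (distrC (f s)); exact: W.
move=> /andP[as_ sb] /andP[at_ tb]; rewrite [X in _ * X]ger0_norm ?subr_ge0 //.
apply: abs_continuous_loc_lip => //; first exact: abs_continuous_sub acf.
apply: lebesgue_aeS aef => r H; rewrite in_itv /= => /andP[tr rs] e e0.
have [|d d0 Hd] := H _ e e0.
  by rewrite in_itv /= (le_lt_trans at_ tr) (lt_le_trans rs sb).
exists d => // r' /andP[tr' rs']; apply: Hd.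
by rewrite (le_trans at_ tr') (le_trans rs' sb).
Qed.

(** A bound on |Y| by its maximum gives a Lipschitz constant; on an interval short
    enough this in turn bounds the maximum by 2 |Y t0|. *)
Lemma linear_ode_bound p (Y : R -> 'cV[R]_p) (a b C t0 : R) : 0 <= C ->
  abs_continuous a b Y -> a <= t0 <= b -> p%:R * C * (b - a) <= 2^-1 ->
  (\forall t \ae (@lebesgue_measure R), t \in `]a, b[ ->
     exists2 G : 'M[R]_p, `|G| <= C & is_derive (t : R) (1 : R) Y (G *m Y t)) ->
  forall s, a <= s <= b -> `|Y s| <= 2 * `|Y t0| /\
     `|Y s - Y t0| <= p%:R * C * (2 * `|Y t0|) * (b - a).
Proof.
move=> C0 acY t0ab small aeY.
have ab : a <= b by case/andP: t0ab => h1 h2; exact: le_trans h1 h2.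
have [c cab Yc] := abs_continuous_max ab acY.
have L s t : a <= s <= b -> a <= t <= b ->
    `|Y s - Y t| <= p%:R * (C * `|Y c|) * `|s - t|.
  apply: abs_continuous_lip_between => //; first by rewrite !mulr_ge0.
  apply: lebesgue_aeS aeY => r H rab; have [G GC dY] := H rab.
  apply: is_derive_loc_lip dY _; apply: le_trans (mx_norm_mul _ _) _.
  rewrite ler_wpM2l // ler_pM //; apply: Yc.
  by move: rab; rewrite in_itv /= => /andP[/ltW -> /ltW ->].
have dist s t : a <= s <= b -> a <= t <= b -> `|s - t| <= b - a.
  move=> /andP[h1 h2] /andP[h3 h4]; rewrite ler_norml; apply/andP; split; lra.
have Ycb : `|Y c| <= 2 * `|Y t0|.
  have H1 := L c t0 cab t0ab.
  have H2 : p%:R * (C * `|Y c|) * `|c - t0| <= 2^-1 * `|Y c|.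
    have -> : p%:R * (C * `|Y c|) * `|c - t0| = p%:R * C * `|c - t0| * `|Y c| by ring.
    rewrite ler_wpM2r //; apply: le_trans small; rewrite ler_wpM2l ?mulr_ge0 //.
    exact: dist.
  have H3 : `|Y c| <= `|Y c - Y t0| + `|Y t0|.
    by rewrite -{1}(subrK (Y t0) (Y c)); exact: ler_normD.
  lra.
move=> s sab; split; first exact: le_trans (Yc s sab) Ycb.
apply: le_trans (L s t0 sab t0ab) _.
have -> : p%:R * C * (2 * `|Y t0|) * (b - a) = p%:R * (C * (2 * `|Y t0|)) * (b - a).
  by ring.
apply: ler_pM => //; [by rewrite !mulr_ge0| |exact: dist].
by rewrite !ler_wpM2l.
Qed.

End Gronwall.

(** * Velocities of the rolling distribution and upper bound for the affine holonomy *)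
Section Rolling.
Context (R : realType) (m : nat).
Local Notation N := (m + vdim m)%N.
Local Notation K := (@adjSO R m).
Context (nabla : connection R N) (hnabla : levi_civita (carnot_metric R m) nabla).
Local Notation J := (@jacobian_frame R m).
Local Notation Gam := (@Gam R m nabla).

Lemma Gam_continuous (gam : R -> 'cV[R]_N) (e : R) : 0 < e ->
  smooth_on `]- e, e[%classic gam ->
  (fun t => Gam (gam t) ('D_1 gam t)) @ (0 : R) --> Gam (gam 0) ('D_1 gam 0).
Proof.
move=> e0 sg; have I0 : (`]- e, e[%classic : set R) 0.
  by rewrite /= in_itv /= oppr_lt0 e0.
have cg : gam @ (0 : R) --> gam 0 by exact: smooth_on_continuous sg I0.
have cd : 'D_1 gam @ (0 : R) --> 'D_1 gam 0.
  by have [_ H] := sg 1%N; exact: (H 1 0 I0).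
rewrite /Gam; apply: cvg_big => [|i _]; first exact: add_continuous.
have cc : (fun t => 'D_1 gam t i 0) @ (0 : R) --> 'D_1 gam 0 i 0.
  by apply: (@cvg_comp _ _ _ ('D_1 gam) (fun v : 'cV[R]_N => v i 0) _ _ _ cd); exact: coord_continuous.
have cn : (fun t => nabla (gam t) i) @ (0 : R) --> nabla (gam 0) i.
  by apply: (@cvg_comp _ _ _ gam (fun x => nabla x i) _ _ _ cg); exact: continuous_nabla.
exact: cvgZ.
Qed.

(** Parallel transport back to gamma(0) has derivative Gam (gamma 0) (gamma' 0) at
    time 0.  Each vector Y with Y(t) = v solves a linear equation whose matrix is
    close to - G0, its value at 0; by linear_ode_bound, Y is close to v between 0
    and t, so that V(s) = Y(s) + s G0 v has small speed.  The transports for different t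
    are given independently of one another, so that the estimate has to be explicit
    in t. *)
Lemma transport_derivative (gam : R -> 'cV[R]_N) (P : R -> 'M[R]_N) (e : R)
    (v : 'cV[R]_N) : 0 < e ->
  smooth_on `]- e, e[%classic gam ->
  (forall t, t \in `]- e, e[ -> parallel_transport nabla gam t 0 (P t)) ->
  is_derive (0 : R) (1 : R) (fun t => P t *m v) (Gam (gam 0) ('D_1 gam 0) *m v).
Proof.
move=> e0 sg HP; set G0 := Gam _ _.
have P0 : P 0 *m v = v.
  have [|Y [_ Y0 Y1]] := HP 0 _ v; first by rewrite in_itv /= oppr_lt0 e0.
  by rewrite -Y1.
pose C := `|G0| + 1; have C0 : 0 <= C by rewrite addr_ge0.
apply: approx_is_derive => r r0; rewrite P0.
pose A := N%:R * (2 * `|v|) + 1 : R.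
have A0 : 0 < A by rewrite ltr_wpDl // !mulr_ge0.
pose eta := Num.min 1 (r / 2 / A).
have eta0 : 0 < eta by rewrite lt_min ltr01 !divr_gt0.
have /cvgrPdist_le/(_ eta eta0)/nbhs_ballP[d1 /= d10 Hd1] := Gam_continuous e0 sg.
pose B := (N%:R * C) ^+ 2 * (2 * `|v|) + N%:R * C + 1.
have NC0 : 0 <= N%:R * C by rewrite mulr_ge0.
have B0 : 0 < B by rewrite ltr_wpDl // addr_ge0 // mulr_ge0 // exprn_ge0.
pose d := Num.min (Num.min d1 e) (Num.min 1 r / 2 / B).
have d0 : 0 < d by rewrite !lt_min d10 e0 !divr_gt0 // lt_min ltr01 r0.
exists d => // t; rewrite !subr0 => td.
have [td1 te tB] : [/\ `|t| < d1, `|t| < e & `|t| < Num.min 1 r / 2 / B].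
  by move: td; rewrite !lt_min -andbA => /and3P[].
have [|Y [[acY aeY] Y0 Y1]] := HP t _ v.
  by rewrite in_itv /= -ltr_norml.
set a := Num.min t 0 in acY aeY; set b := Num.max t 0 in acY aeY.
have baE : b - a = `|t|.
  rewrite /a /b; case: (leP t 0) => t0; first by rewrite ler0_norm // sub0r.
  by rewrite ger0_norm ?subr0 // ltW.
have at0 : a <= t <= b by rewrite /a /b ge_min lexx le_max lexx.
have a00 : a <= 0 <= b by rewrite /a /b ge_min lexx orbT le_max lexx orbT.
have in_ab s : a <= s <= b -> `|s| <= `|t|.
  move=> /andP[as_ sb]; rewrite -baE ler_norml; move: a00 => /andP[h1 h2].
  apply/andP; split; lra.
have Gs s : a <= s <= b -> `|Gam (gam s) ('D_1 gam s) - G0| <= eta.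
  move=> /in_ab st; rewrite distrC; apply: Hd1.
  by rewrite /ball /= sub0r normrN (le_lt_trans st).
have Gs' s : a <= s <= b -> `|- Gam (gam s) ('D_1 gam s)| <= C.
  move=> sab; rewrite normrN -(subrK G0 (Gam (gam s) _)) addrC.
  apply: le_trans (ler_normD _ _) _; rewrite lerD2l.
  by apply: le_trans (Gs s sab) _; rewrite ge_min lexx.
have aeY' : \forall s \ae (@lebesgue_measure R), s \in `]a, b[ ->
    a <= s <= b /\ is_derive (s : R) (1 : R) Y (- Gam (gam s) ('D_1 gam s) *m Y s).
  apply: lebesgue_aeS aeY => s H sab; have [w dg dY] := H sab.
  split; first by move: sab; rewrite in_itv /= => /andP[/ltW -> /ltW ->].
  have -> : 'D_1 gam s = w by exact: derive_val.
  apply: is_derive_eq dY _; rewrite mulNmx; congr (- _).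
  rewrite /Gam mulmx_suml; apply: eq_bigr => i _; exact: scalemxAl.
have Bt : B * `|t| <= Num.min 1 r / 2.
  by move: tB; rewrite ltr_pdivlMr // mulrC => /ltW.
have NCB : N%:R * C <= B.
  by rewrite /B -addrA addrCA lerDl addr_ge0 // mulr_ge0 // exprn_ge0.
have small : N%:R * C * (b - a) <= 2^-1.
  rewrite baE; apply: (@le_trans _ _ (B * `|t|)); first by rewrite ler_wpM2r.
  apply: le_trans Bt _; rewrite -[leRHS]mul1r ler_wpM2r ?invr_ge0 //.
  by rewrite ge_min lexx.
have bnd := linear_ode_bound C0 acY at0 small _.
have {}bnd s : a <= s <= b -> `|Y s| <= 2 * `|v| /\
    `|Y s - v| <= N%:R * C * (2 * `|v|) * `|t|.
  move=> sab; rewrite -Y0 -baE; apply: bnd => //.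
  apply: lebesgue_aeS aeY' => r' H rab; have [rab' dY] := H rab.
  by exists (- Gam (gam r') ('D_1 gam r')) => //; exact: Gs'.
pose V s := Y s + s *: (G0 *m v).
pose M2 := N%:R * (eta * (2 * `|v|)) + N%:R * (C * (N%:R * C * (2 * `|v|) * `|t|)).
have M20 : 0 <= M2 by rewrite addr_ge0 // !mulr_ge0 // ltW.
have lin_ac : abs_continuous a b (fun s : R => s *: (G0 *m v)).
  apply: (@abs_continuous_lip _ _ _ _ _ `|G0 *m v|) => // s s' _ _.
  by rewrite -scalerBl normrZ mulrC.
have acV : abs_continuous a b V by exact: abs_continuousD.
have HV : `|V 0 - V t| <= M2 * `|0 - t|.
  apply: (abs_continuous_lip_between M20 acV) => //.
  apply: lebesgue_aeS aeY' => s H sab; have [sab' dY] := H sab.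
  have dL := is_derive_scalel (G0 *m v) (is_derive_id s (1 : R)).
  rewrite scale1r in dL.
  have dV : is_derive s (1 : R) V (- Gam (gam s) ('D_1 gam s) *m Y s + G0 *m v).
    exact: is_deriveD dY dL.
  apply: is_derive_loc_lip dV _.
  have -> : - Gam (gam s) ('D_1 gam s) *m Y s + G0 *m v =
    - ((Gam (gam s) ('D_1 gam s) - G0) *m Y s) - G0 *m (Y s - v).
    rewrite mulmxBr mulmxBl mulNmx; move: (_ *m _) (_ *m _) (_ *m _) => X1 X2 X3.
    by apply/matrixP => i j; rewrite !mxE; ring.
  apply: le_trans (ler_normB _ _) _; rewrite normrN.
  have [b1 b2] := bnd s sab'.
  apply: lerD; apply: le_trans (mx_norm_mul _ _) _; rewrite ler_wpM2l //.
    by apply: ler_pM => //; exact: Gs.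
  by apply: ler_pM => //; rewrite lerDl.
move: HV; rewrite /V scale0r addr0 Y1 Y0 sub0r normrN opprD addrA => HV.
apply: le_trans HV _; rewrite ler_wpM2r //.
have e1 : N%:R * (eta * (2 * `|v|)) <= r / 2.
  apply: (@le_trans _ _ (A * eta)).
    have -> : N%:R * (eta * (2 * `|v|)) = N%:R * (2 * `|v|) * eta by ring.
    by rewrite ler_wpM2r ?(ltW eta0) // lerDl.
  by rewrite -ler_pdivlMl // mulrC ge_min lexx orbT.
have e2 : N%:R * (C * (N%:R * C * (2 * `|v|) * `|t|)) <= r / 2.
  have -> : N%:R * (C * (N%:R * C * (2 * `|v|) * `|t|)) =
    (N%:R * C) ^+ 2 * (2 * `|v|) * `|t| by ring.
  apply: (@le_trans _ _ (B * `|t|)).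
    by rewrite ler_wpM2r // /B -addrA lerDl addr_ge0.
  apply: le_trans Bt _; rewrite ler_wpM2r ?invr_ge0 //.
  by rewrite ge_min lexx orbT.
by rewrite [r]splitr; exact: lerD.
Qed.

(** These components of the lift depend neither on the auxiliary curve nor on the
    transports along it. *)
Lemma rolling_lift_value q X w : q.2 \in unitmx ->
  rolling_lift nabla q X w -> w.1.1 = X /\ w.2 = q.2 *m Gam q.1.1 X.
Proof.
move=> Uq [gam [P [e [e0 sg [g0 dg] HP dw]]]].
have d1 := is_derive_fst (is_derive_fst dw).
have d2 := is_derive_snd dw; rewrite /= in d1 d2.
have XE : 'D_1 gam 0 = X by exact: derive_val.
split; first by rewrite -XE; symmetry; exact: derive_val.
apply: mulmx_cV_ext => v.
have := is_derive_mulmx d2 (is_derive_cst v (0 : R) 1).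
rewrite mulmx0 addr0 => d3.
have d4 := transport_derivative v e0 sg HP.
have d5 := is_derive_mulmx (is_derive_cst q.2 (0 : R) 1) d4.
rewrite mul0mx add0r g0 XE in d5.
have E : (fun s => q.2 *m P s *m v) = (fun s => q.2 *m (P s *m v)).
  by apply/funext => s; rewrite mulmxA.
rewrite E in d3.
rewrite -mulmxA -(@derive_val _ _ _ _ _ _ _ d5) -(@derive_val _ _ _ _ _ _ _ d3).
by [].
Qed.

Lemma rolling_space_orth q : rolling_space (carnot_metric R m) q ->
  (q.2 *m J q.1.1)^T *m (q.2 *m J q.1.1) = 1%:M.
Proof.
move=> [AA _]; rewrite trmx_mul mulmxA -[_ *m q.2^T *m q.2]mulmxA AA.
exact: carnot_metric_orthonormal.
Qed.

(** Along a rolling curve, a = O^T A J(x) solves a' = a om(u), and a(0) = 1. *)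
Lemma affine_sub q h : rolling_space (carnot_metric R m) q ->
  affine_holonomy (carnot_metric R m) nabla (horizontal R m) q h ->
  conj_adjSO (q.2 *m J q.1.1) h.2.
Proof.
move=> Qq [_ [c [acc Qc aec c0 c1]]].
set O := q.2 *m J q.1.1; have OO : O^T *m O = 1%:M by exact: rolling_space_orth.
have acx := abs_continuous_fst (abs_continuous_fst acc).
have acA := abs_continuous_snd acc.
pose a t := O^T *m ((c t).2 *m J (c t).1.1).
have aca : abs_continuous 0 1 a.
  apply: abs_continuous_mulmx; first exact: abs_continuous_cst.
  by apply: abs_continuous_mulmx => //; exact: abs_continuous_J.
have Ka : K (a 1).
  apply: adjSO_invariant => //; first by rewrite /a c0 -/O.
  apply: lebesgue_aeS aec => t H t01; have [w dc [X hX lift]] := H t01.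
  have /horizontalP[u XE] := hX; exists u.
  have tt : t \in `[0, 1].
    by move: t01; rewrite !in_itv /= => /andP[/ltW -> /ltW ->].
  have [_ dA] := Qc t tt.
  have Uc : (c t).2 \in unitmx by rewrite unitmxE unitfE gt_eqF.
  have [w11 w2] := rolling_lift_value Uc lift.
  have dx := is_derive_fst (is_derive_fst dc).
  have dA' := is_derive_snd dc.
  have d1 := is_derive_mulmx dA' (is_derive_J dx).
  have d2 := is_derive_mulmx (is_derive_cst O^T t (1 : R)) d1.
  apply: is_derive_eq d2 _; rewrite mul0mx add0r w11 w2 /a -!mulmxA; congr (_ *m _).
  by rewrite -mulmxDr XE usubmx_jac /hor col_mxKu (Gam_hor hnabla).
have OO' : O *m O^T = 1%:M by exact: mulmx1C.
have E : a 1 = O^T *m (h.2 *m O).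
  by rewrite /a c1; congr (_ *m _); exact: esym (mulmxA _ _ _).
exists (a 1) => //; rewrite E.
by rewrite mulmxA OO' mul1mx -mulmxA OO' mulmx1.
Qed.

End Rolling.

(** * Elementary horizontal motions generate adj(SO(1+m)) and all translations *)
Section Words.
Context (R : realType) (m : nat) (hm : (2 <= m)%N).
Local Notation N := (m + vdim m)%N.
Local Notation n := (1 + m)%N.
Local Notation K := (@adjSO R m).
Local Notation J := (@jacobian_frame R m).
Local Notation ax i := (rshift 1 i : 'I_n).

Definition unit_v (i : 'I_m) : 'cV[R]_m := delta_mx i 0.
Definition e_ (i : 'I_m) : 'cV[R]_N := hor (unit_v i).
(** The solution of a' = a om(e_i), a(0) = 1: as om is half a commutator, the
    angle is halved. *)
Definition arot (i : 'I_m) (t : R) : 'M[R]_N := adj (rot i (t / 2)).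

Lemma arotD i s t : arot i (s + t) = arot i s *m arot i t.
Proof. by rewrite /arot mulrDl rotD adjM. Qed.

Lemma arot0 i : arot i 0 = 1%:M.
Proof. by rewrite /arot mul0r rot0 adj1. Qed.

Lemma arotN i t : arot i t *m arot i (- t) = 1%:M.
Proof. by rewrite -arotD subrr arot0. Qed.

Lemma toskew_e i : toskew (e_ i) = (rotF R i).
Proof.
rewrite /toskew /e_ /hor col_mxKu col_mxKd linear0 /rotF.
have -> : (0 : 'I_n) = lshift m 0 by apply: val_inj.
apply/matrixP => a b; rewrite -(fintype.splitK a) -(fintype.splitK b).
case: (fintype.split a) => a' /=; case: (fintype.split b) => b' /=.
- by rewrite block_mxEul !mxE !ord1 !eq_lrshift ?andbF subrr.
- rewrite block_mxEur !mxE !ord1 ?eq_lrshift ?eq_rlshift ?eq_rshift ?eqxx ?andbT /=.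
  by rewrite sub0r.
- rewrite block_mxEdl !mxE !ord1 ?eq_lrshift ?eq_rlshift ?eq_rshift ?eqxx ?andbT /=.
  by rewrite subr0.
by rewrite block_mxEdr !mxE ?eq_rlshift ?andbF subrr.
Qed.

Definition skew_ax (i j : 'I_m) : 'M[R]_n := delta_mx (ax i) (ax j) - delta_mx (ax j) (ax i).

Lemma rot_conjF i j t : i != j ->
  rot j t *m (rotF R i) *m (rot j t)^T = cos t *: (rotF R i) - sin t *: skew_ax i j.
Proof.
move=> ij; have ji : (j == i) = false by rewrite eq_sym (negbTE ij).
have dE := (mul_delta_mx_cond, ax_neq0, ax_neq0', eqxx, mulr1n, mulr0n, ax_eq, negbTE ij, ji).
have PF : (rotP R j) *m (rotF R i) = - delta_mx 0 (ax i).
  by rewrite /rotP /rotF mulmxDl !mulmxBr !dE sub0r subrr addr0.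
have FF : (rotF R j) *m (rotF R i) = - delta_mx (ax j) (ax i).
  by rewrite /rotF mulmxBl !mulmxBr !dE sub0r !subr0.
have FP : (rotF R i) *m (rotP R j) = delta_mx (ax i) 0.
  by rewrite /rotP /rotF mulmxBl !mulmxDr !dE !addr0 subr0.
have FF' : (rotF R i) *m (rotF R j) = - delta_mx (ax i) (ax j).
  by rewrite /rotF mulmxBl !mulmxBr !dE sub0r !subr0.
have PFP : (rotP R j) *m (rotF R i) *m (rotP R j) = 0.
  by rewrite PF /rotP mulNmx mulmxDr !dE addr0 oppr0.
have PFF : (rotP R j) *m (rotF R i) *m (rotF R j) = 0.
  by rewrite PF /rotF mulNmx mulmxBr !dE subrr oppr0.
have FFP : (rotF R j) *m (rotF R i) *m (rotP R j) = 0.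
  by rewrite FF /rotP mulNmx mulmxDr !dE addr0 oppr0.
have FFF : (rotF R j) *m (rotF R i) *m (rotF R j) = 0.
  by rewrite FF /rotF mulNmx mulmxBr !dE subrr oppr0.
rewrite rot_tr /rot cosN sinN scaleNr opprK.
pose Y := rotF R i + (cos t - 1) *: (rotP R j *m rotF R i)
    - sin t *: (rotF R j *m rotF R i).
have AE (X : 'M[R]_n) : Y *m X =
    rotF R i *m X + (cos t - 1) *: (rotP R j *m rotF R i *m X)
    - sin t *: (rotF R j *m rotF R i *m X).
  by rewrite mulmxBl mulmxDl -!scalemxAl.
have -> : (1%:M + (cos t - 1) *: rotP R j - sin t *: rotF R j) *m rotF R i = Y.
  by rewrite mulmxBl mulmxDl mul1mx -!scalemxAl.
rewrite 2!mulmxDr mulmx1 -!scalemxAr !AE /Y.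
rewrite PFP PFF FFP FFF PF FF FP FF' !scaler0 !subr0 !addr0.
by rewrite /rotF /skew_ax; apply/matrixP => a b; rewrite !mxE; ring.
Qed.

Definition v_ i j : 'cV[R]_N := ofskew (skew_ax i j).

(** The rotation in the plane (0, j) mixes e_i with the vertical vector of the
    pair (i, j). *)
Lemma arot_e i j t : i != j ->
  arot j t *m e_ i = cos (t / 2) *: e_ i - sin (t / 2) *: v_ i j.
Proof.
move=> ij; rewrite /arot adjE toskew_e rot_conjF //.
rewrite linearB /= !linearZ /= -toskew_e toskewK.
by [].
Qed.

Lemma arot_ee i t : arot i t *m e_ i = e_ i.
Proof.
apply: (can_inj (@toskewK R m)); rewrite toskew_adj toskew_e.
have FR s : (rotF R i) *m rot i s = rot i s *m (rotF R i).
  rewrite /rot; move: (rotPF R i) (rotFP R i).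
  move: (rotP R i) (rotF R i) => P F PF FP.
  rewrite mulmxBr mulmxDr mulmx1 -!scalemxAr FP.
  by rewrite mulmxBl mulmxDl mul1mx -!scalemxAl PF.
by rewrite -FR -mulmxA rot_tr -rotD subrr rot0 mulmx1.
Qed.

Lemma pair_index_eq (p : pairs m) k : (k == pair_index p) =
  ((val (index_pair k)).1 == (val p).1) && ((val (index_pair k)).2 == (val p).2).
Proof.
rewrite -(can_eq (@index_pairK m)) pair_indexK -val_eqE.
rewrite [X in X == _]surjective_pairing [X in _ == X]surjective_pairing.
exact: xpair_eqE.
Qed.

Lemma pair_index_swap (p : pairs m) k :
  ((val (index_pair k)).1 == (val p).2) && ((val (index_pair k)).2 == (val p).1) = false.
Proof.
apply/negbTE/negP => /andP[/eqP e1 /eqP e2].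
have := valP p; have := valP (index_pair k); rewrite /= e1 e2 => h1 h2.
by have := ltn_trans h1 h2; rewrite ltnn.
Qed.

Lemma v_dgamma (p : pairs m) : v_ (val p).1 (val p).2 = dgamma R p.
Proof.
rewrite /v_ /ofskew /skew_ax /dgamma -[RHS]vsubmxK; congr col_mx.
  have E0 : (0 : 'I_n) = lshift m 0 by apply: val_inj.
  by apply/matrixP => i j; rewrite !mxE !ord1 !eq_lrshift ?andbF subrr.
apply/matrixP => k j; rewrite !mxE !ord1 !eq_rshift eqxx andbT.
by rewrite pair_index_eq pair_index_swap subr0.
Qed.

Lemma J0 : J 0 = 1%:M.
Proof. by rewrite jacobian_frameE !linear0 addr0. Qed.

Lemma Bu_e i : Bmx (usubmx (e_ i)) = Bmx (unit_v i).
Proof. by rewrite /e_ /hor col_mxKu. Qed.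

(** The value of [X_i, X_j] / 2. *)
Definition b_ i j : 'cV[R]_N := Bmx (unit_v i) *m e_ j.

Lemma b_anti i j : b_ i j = - b_ j i.
Proof. by rewrite /b_ -!Bu_e Bmx_anti. Qed.

Lemma Bu_b i j : usubmx (b_ i j) = 0.
Proof. by rewrite /b_ Bmx_mul col_mxKu. Qed.

(** The states (x, y, a) reached from (0, 0, 1) by moving successively along the
    fields X_i for times t: x is the point of the group, y the contact point
    in R^N and a the transport.  Multiplying x on the right by t e_i amounts to
    adding J(x) (t e_i). *)
Inductive word : 'cV[R]_N -> 'cV[R]_N -> 'M[R]_N -> Prop :=
| word1 : word 0 0 1%:M
| word_step x y a i t : word x y a ->
    word (x + J x *m (t *: e_ i)) (y + a *m (t *: e_ i)) (a *m arot i t).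

Lemma J_mul x x' : J (x + J x *m x') = J x *m J x'.
Proof.
have E : usubmx (x + J x *m x') = usubmx x + usubmx x'.
  by rewrite [usubmx _]linearD /= usubmx_jac.
rewrite [LHS]jacobian_frameE E linearD /= !jacobian_frameE.
by rewrite mulmxDl mul1mx mulmxDr mulmx1 BmxB addr0 addrA addrAC.
Qed.

Lemma word_cast x y a x' y' a' : word x y a -> x = x' -> y = y' -> a = a' ->
  word x' y' a'.
Proof. by move=> w <- <- <-. Qed.

(** Left-invariance: words can be concatenated, and the states multiply in the
    semidirect product of the group, R^N and SO(N). *)
Lemma word_mul x y a x' y' a' : word x y a -> word x' y' a' ->
  word (x + J x *m x') (y + a *m y') (a *m a').
Proof.
move=> w w'; elim: w' => [|x2 y2 a2 i t _ IH]; first by rewrite !mulmx0 !addr0 mulmx1.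
apply: word_cast (word_step i t IH) _ _ _.
- by rewrite J_mul mulmxDr addrA mulmxA.
- by rewrite mulmxDr addrA mulmxA.
by rewrite mulmxA.
Qed.

Lemma word_gen i t : word (t *: e_ i) (t *: e_ i) (arot i t).
Proof.
apply: word_cast (word_step i t word1) _ _ _; rewrite ?add0r ?mul1mx //.
by rewrite J0 mul1mx.
Qed.

Lemma arot_period i (k : nat) : arot i (4 * pi *+ k) = 1%:M.
Proof.
elim: k => [|k IH]; first by rewrite mulr0n arot0.
rewrite mulrS arotD IH mulmx1 /arot.
have -> : 4 * pi / 2 = pi + pi :> R by field.
have -> : rot i (pi + pi : R) = 1%:M.
  by rewrite /rot cosDpi sinDpi cospi sinpi opprK oppr0 subrr !scale0r addr0 subr0.
exact: adj1.
Qed.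

Lemma arot_periodN i (k : nat) : arot i (- (4 * pi *+ k)) = 1%:M.
Proof. by have := arotN i (4 * pi *+ k); rewrite arot_period mul1mx. Qed.

Lemma Bmx_self (x : 'cV[R]_N) : Bmx (usubmx x) *m x = 0.
Proof.
have := Bmx_anti x x => /eqP; rewrite -addr_eq0 -mulr2n -scaler_nat scaler_eq0.
by rewrite pnatr_eq0 /= => /eqP.
Qed.

Lemma Bmx_b v i j : Bmx v *m b_ i j = 0.
Proof. by rewrite /b_ mulmxA BmxB mul0mx. Qed.

Lemma J_e s k l r : J (s *: e_ k) *m (r *: e_ l) = r *: e_ l + (s * r) *: b_ k l.
Proof.
rewrite jacobian_frameE mulmxDl mul1mx; congr (_ + _).
by rewrite [usubmx _]linearZ [Bmx _]linearZ /= Bu_e -scalemxAl -scalemxAr scalerA.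
Qed.

Lemma J_b s i j (z : 'cV[R]_N) : J (s *: b_ i j) *m z = z.
Proof.
by rewrite jacobian_frameE [usubmx _]linearZ /= Bu_b scaler0 linear0 addr0 mul1mx.
Qed.

Lemma commutator_base i j T t :
  let x := T *: e_ i + (t *: e_ j + (T * t) *: b_ i j) in
  let x' := - T *: e_ i + (- t *: e_ j + (- T * - t) *: b_ i j) in
  x + J x *m x' = (2 * T * t) *: b_ i j.
Proof.
move=> x x'; rewrite jacobian_frameE mulmxDl mul1mx.
have -> : x' = - x + (2 * T * t) *: b_ i j.
  rewrite /x /x'; move: (e_ i) (e_ j) (b_ i j) => u v w.
  by apply/matrixP => a b; rewrite !mxE; ring.
rewrite mulmxDr mulmxN Bmx_self -scalemxAr Bmx_b scaler0 oppr0 !addr0.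
by rewrite addrA subrr add0r.
Qed.

(** The commutator of the motions (i, T) and (j, t), when T is a period of the
    i-th rotation: the rotations cancel, and a translation remains besides the
    expected central element. *)
Lemma word_commutator i j (T t : R) : arot i T = 1%:M -> arot i (- T) = 1%:M ->
  word ((2 * T * t) *: b_ i j) (T *: (e_ i - arot j t *m e_ i)) 1%:M.
Proof.
move=> aT aT'; have w1 := word_mul (word_gen i T) (word_gen j t).
have w2 := word_mul (word_gen i (- T)) (word_gen j (- t)).
move: w1 w2; rewrite aT aT' !mul1mx !J_e => w1 w2.
apply: word_cast (word_mul w1 w2) _ _ _; last by rewrite arotN.
  exact: commutator_base.
rewrite mulmxDr -!scalemxAr arot_ee; move: (arot j t *m e_ i) => w.
by move: (e_ i) (e_ j) => u v; apply/matrixP => a b; rewrite !mxE; ring.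
Qed.

Lemma exists_other (i : 'I_m) : exists j, i != j.
Proof.
have i0 : (0 < m)%N by exact: leq_trans hm.
have i1 : (1 < m)%N by exact: hm.
case: (eqVneq i (Ordinal i0)) => [->|h]; last by exists (Ordinal i0).
by exists (Ordinal i1).
Qed.

(** The commutators for t and -t together cancel the central part and the vertical
    translation, and leave 2 T (1 - cos (t/2)) e_i.  T may be any multiple of
    4 pi, so that this covers every length. *)
Lemma word_translation_e i s : word 0 (s *: e_ i) 1%:M.
Proof.
have [j ij] := exists_other i.
have key (T t : R) : arot i T = 1%:M -> arot i (- T) = 1%:M ->
    word 0 ((2 * T * (1 - cos (t / 2))) *: e_ i) 1%:M.
  move=> aT aT'; have w1 := word_commutator j t aT aT'.
  have w2 := word_commutator j (- t) aT aT'.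
  apply: word_cast (word_mul w1 w2) _ _ _; rewrite ?mul1mx ?J_b //.
    by rewrite -scalerDl mulrN subrr scale0r.
  rewrite !arot_e // mulNr cosN sinN; move: (e_ i) (v_ i j) => u v.
  by apply/matrixP => a b; rewrite !mxE; ring.
pose k := (Num.truncn `|s|).+1.
have sk : `|s| <= k%:R by rewrite /k ltW // truncnS_gt.
pose T0 : R := 4 * pi *+ k.
have T01 : k%:R <= T0.
  rewrite /T0 -(mulr_natr (4 * pi) k) ler_peMl //.
  have p2 : 2 <= pi :> R by exact: pi_ge2.
  lra.
have T0p : 0 < T0 by apply: lt_le_trans T01; rewrite ltr0n.
pose T := if 0 <= s then T0 else - T0.
have T2 : 2 * T != 0.
  by rewrite /T; case: ifP => _; rewrite mulf_neq0 ?oppr_eq0 ?gt_eqF // pnatr_eq0.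
have sT : 0 <= s / (2 * T) <= 2.
  rewrite /T; case: (leP 0 s) => s0.
    rewrite divr_ge0 ?mulr_ge0 ?(ltW T0p) //= ler_pdivrMr ?mulr_gt0 //.
    apply: le_trans (le_trans (ler_norm s) sk) _; lra.
  have -> : s / (2 * - T0) = - s / (2 * T0) by rewrite mulrN invrN mulrN mulNr.
  rewrite divr_ge0 ?oppr_ge0 ?(ltW s0) ?mulr_ge0 ?(ltW T0p) //=.
  rewrite ler_pdivrMr ?mulr_gt0 // -(ltr0_norm s0).
  apply: le_trans sk _; lra.
pose c := 1 - s / (2 * T).
have [aT aT'] : arot i T = 1%:M /\ arot i (- T) = 1%:M.
  by rewrite /T; case: ifP => _; rewrite ?opprK arot_period arot_periodN.
apply: word_cast (key T (2 * acos c) aT aT') _ _ _ => //.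
congr (_ *: _); rewrite [2 * acos c]mulrC mulfK ?pnatr_eq0 // acosK; last first.
  by rewrite in_itv /= /c; case/andP: sT => h1 h2; apply/andP; split; lra.
by rewrite /c opprB addrC subrK mulrC divfK.
Qed.

Lemma word_translation_D y y' : word 0 y 1%:M -> word 0 y' 1%:M -> word 0 (y + y') 1%:M.
Proof.
by move=> w w'; apply: word_cast (word_mul w w') _ _ _; rewrite ?mulmx0 ?add0r ?mul1mx.
Qed.

(** Conjugating a translation by the motion (j, t) rotates it. *)
Lemma word_translation_rot i j s t : word 0 (s *: (arot j t *m e_ i)) 1%:M.
Proof.
have w1 := word_mul (word_gen j t) (word_translation_e i s).
have w2 := word_gen j (- t).
apply: word_cast (word_mul w1 w2) _ _ _; last by rewrite mulmx1 arotN.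
  rewrite mulmx0 addr0 J_e mulrN.
  have b0 : b_ j j = 0 by rewrite /b_ -Bu_e Bmx_self.
  by rewrite b0 scaler0 addr0 scaleNr subrr.
rewrite mulmx1 -!scalemxAr arot_ee scaleNr addrAC subrr add0r.
by [].
Qed.

Lemma word_translation_dgamma p s : word 0 (s *: dgamma R p) 1%:M.
Proof.
have ij : (val p).1 != (val p).2.
  by rewrite -val_eqE /= gtn_eqF // (valP p).
apply: word_cast (word_translation_rot (val p).1 (val p).2 (- s) pi) _ _ _ => //.
rewrite arot_e // cos_pihalf sin_pihalf scale0r sub0r scale1r v_dgamma.
by rewrite scalerN scaleNr opprK.
Qed.

Lemma dv_e i : dv R i = e_ i.
Proof.
rewrite /dv /e_ /hor -[LHS]vsubmxK; congr col_mx; apply/matrixP => a b.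
  by rewrite !mxE eq_lshift.
by rewrite !mxE eq_rlshift.
Qed.

Lemma word_translation y : word 0 y 1%:M.
Proof.
have sumW (I : finType) (F : I -> 'cV[R]_N) : (forall i, word 0 (F i) 1%:M) ->
    word 0 (\sum_i F i) 1%:M.
  move=> HF; apply: (big_ind (fun y => word 0 y 1%:M)) => //; first exact: word1.
  exact: word_translation_D.
rewrite (point_sum y); apply: word_translation_D; apply: sumW => i.
  by rewrite dv_e; exact: word_translation_e.
exact: word_translation_dgamma.
Qed.

(** As all translations are available, y can be adjusted at will. *)
Lemma word_no_translation x y y' a : word x y a -> word x y' a.
Proof.
move=> w; apply: word_cast (word_mul (word_translation (y' - y)) w) _ _ _.
- by rewrite add0r J0 mul1mx.
- by rewrite mul1mx subrK.
by rewrite mul1mx.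
Qed.

Lemma word_mul0 x a x' a' : word x 0 a -> word x' 0 a' ->
  word (x + J x *m x') 0 (a *m a').
Proof. by move=> w w'; apply: (word_no_translation _ (word_mul w w')). Qed.

Lemma word_gen0 i t : word (t *: e_ i) 0 (arot i t).
Proof. exact: (word_no_translation _ (word_gen i t)). Qed.

(** By word_commutator for T = 4 pi, forgetting the translation. *)
Lemma word_central i j s : word (s *: b_ i j) 0 1%:M.
Proof.
have aT : arot i (4 * pi) = 1%:M by exact: (arot_period i 1).
have aT' : arot i (- (4 * pi)) = 1%:M by exact: (arot_periodN i 1).
have w := word_commutator j (s / (8 * pi)) aT aT'.
apply: word_cast (word_no_translation 0 w) _ _ _ => //; congr (_ *: _).
have p0 : (pi : R) != 0 by exact: lt0r_neq0 (pi_gt0 R).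
by move: (pi : R) p0 => p p0; field.
Qed.

Lemma rotN_conj i j t : i != j ->
  rot j pi *m rot i t *m rot j (- pi) = rot i (- t) :> 'M[R]_n.
Proof.
move=> ij.
have rp s : s = pi \/ s = - pi -> rot j s = 1%:M - 2 *: rotP R j.
  move=> Hs; have [cs ss] : cos s = -1 /\ sin s = 0.
    by case: Hs => ->; rewrite ?cosN ?sinN cospi sinpi ?oppr0.
  by rewrite /rot cs ss scale0r subr0; congr (_ + _); rewrite -scaleNr; congr (_ *: _); ring.
rewrite rp; last by left.
rewrite rp; last by right.
have ji : (j == i) = false by rewrite eq_sym (negbTE ij).
have dE := (mul_delta_mx_cond, ax_neq0, ax_neq0', eqxx, mulr1n, mulr0n, ax_eq, negbTE ij, ji).
have PP : rotP R j *m rotP R i = delta_mx 0 0.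
  by rewrite /rotP mulmxDl !mulmxDr !dE !addr0.
have PP' : rotP R i *m rotP R j = delta_mx 0 0.
  by rewrite /rotP mulmxDl !mulmxDr !dE !addr0.
have PF : rotP R j *m rotF R i = - delta_mx 0 (ax i).
  by rewrite /rotP /rotF mulmxDl !mulmxBr !dE sub0r subrr addr0.
have FP : rotF R i *m rotP R j = delta_mx (ax i) 0.
  by rewrite /rotP /rotF mulmxBl !mulmxDr !dE !addr0 subr0.
have PFP : rotP R j *m rotF R i *m rotP R j = 0.
  by rewrite PF /rotP mulNmx mulmxDr !dE addr0 oppr0.
have PPP : rotP R j *m rotP R i *m rotP R j = delta_mx 0 0.
  by rewrite PP /rotP mulmxDr !dE addr0.
have PJ : rotP R j *m rotP R j = rotP R j by exact: rotPP.
have gen (P A : 'M[R]_n) : P *m P = P ->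
   (1%:M - 2 *: P) *m A *m (1%:M - 2 *: P) =
   A - 2 *: (P *m A) - 2 *: (A *m P) + 4 *: (P *m A *m P).
  move=> PPe; rewrite mulmxBl mul1mx -scalemxAl mulmxBr mulmx1 mulmxBl.
  rewrite -!scalemxAr -!scalemxAl; move: (P *m A) (A *m P) (P *m A *m P) => X Y Z.
  by apply/matrixP => a b; rewrite !mxE; ring.
rewrite gen // /rot cosN sinN.
have lin (P : 'M[R]_n) : P *m (1%:M + (cos t - 1) *: rotP R i - sin t *: rotF R i) =
    P + (cos t - 1) *: (P *m rotP R i) - sin t *: (P *m rotF R i).
  by rewrite mulmxBr mulmxDr mulmx1 -!scalemxAr.
have linr (P Q S : 'M[R]_n) : (Q + (cos t - 1) *: P - sin t *: S) *m rotP R j =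
    Q *m rotP R j + (cos t - 1) *: (P *m rotP R j) - sin t *: (S *m rotP R j).
  by rewrite mulmxBl mulmxDl -!scalemxAl.
rewrite lin !linr PP PP' PF FP mul1mx PJ -PP -PF PPP PFP PP PF.
rewrite /rotF; move: (rotP R j) (rotP R i) => X Y.
by apply/matrixP => a b; rewrite !mxE; ring.
Qed.

Lemma b_ii i : b_ i i = 0.
Proof. by rewrite /b_ -Bu_e Bmx_self. Qed.

(** The group component of g_j(P) g_i(s) g_j(-P) g_i(-s) is central; the last
    factor brings it back to the origin. *)
Lemma conj_base i j P s :
  let x1 := P *: e_ j + J (P *: e_ j) *m (s *: e_ i) in
  let x2 := x1 + J x1 *m (- P *: e_ j) in
  let x3 := x2 + J x2 *m (- s *: e_ i) in
  x3 + J x3 *m ((2 * P * s) *: b_ i j) = 0.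
Proof.
move=> x1 x2 x3.
have J3 (p q r : R) a b c d (z : 'cV[R]_N) :
    J (p *: e_ a + (q *: e_ b + r *: b_ c d)) *m z =
    z + (p *: (Bmx (unit_v a) *m z) + q *: (Bmx (unit_v b) *m z)).
  rewrite jacobian_frameE mulmxDl mul1mx; congr (_ + _).
  have -> : usubmx (p *: e_ a + (q *: e_ b + r *: b_ c d)) =
      p *: unit_v a + q *: unit_v b.
    have uD (u v : 'cV[R]_N) : usubmx (u + v) = usubmx u + usubmx v by rewrite linearD.
    have uZ (u : R) (v : 'cV[R]_N) : usubmx (u *: v) = u *: usubmx v by rewrite linearZ.
    by rewrite !uD !uZ Bu_b scaler0 addr0 /e_ /hor !col_mxKu.
  have BD (u v : 'cV[R]_m) : Bmx (u + v) = Bmx u + Bmx v by rewrite linearD.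
  have BZ (u : R) (v : 'cV[R]_m) : Bmx (u *: v) = u *: Bmx v by rewrite linearZ.
  by rewrite BD !BZ mulmxDl -!scalemxAl.
have x1E : x1 = P *: e_ j + (s *: e_ i + (P * s) *: b_ j i) by rewrite /x1 J_e.
have E2 : x2 = s *: e_ i + (- (2 * P * s)) *: b_ i j.
  rewrite /x2 x1E J3 -!scalemxAr -/(b_ j j) -/(b_ i j) b_ii (b_anti j i).
  move: (e_ i) (e_ j) (b_ i j) => u v w.
  by apply/matrixP => a b; rewrite !mxE; ring.
have E3 : x3 = (- (2 * P * s)) *: b_ i j.
  have -> : x3 = x2 + J x2 *m (- s *: e_ i) by [].
  have J2 (p r : R) a c d (z : 'cV[R]_N) :
      J (p *: e_ a + r *: b_ c d) *m z = z + p *: (Bmx (unit_v a) *m z).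
    have := J3 p 0 r a a c d z; rewrite !scale0r add0r addr0; exact.
  rewrite E2 J2 -!scalemxAr -/(b_ i i) b_ii.
  move: (e_ i) (b_ i j) => u w.
  by apply/matrixP => a b; rewrite !mxE; ring.
by rewrite E3 J_b -scalerDl addNr scale0r.
Qed.

Lemma arot_conj i j s : i != j ->
  arot j (2 * pi) *m arot i s *m arot j (- (2 * pi)) = arot i (- s).
Proof.
move=> ij; have E : 2 * pi / 2 = pi :> R by rewrite [2 * pi]mulrC mulfK // pnatr_eq0.
by rewrite /arot !mulNr E -!adjM rotN_conj.
Qed.

(** With P = 2 pi, conjugation by r_j(P) reverses r_i, so that the word of
    conj_base has transport r_i(-s) r_i(-s) and closes up in the group. *)
Lemma word_rot i t : word 0 0 (arot i t).
Proof.
have [j ij] := exists_other i.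
have [s ->] : exists s, t = - s + - s by exists (- t / 2); field.
have aE := arot_conj s ij.
move: (2 * pi : R) aE => P aE.
have w1 := word_mul0 (word_mul0 (word_gen0 j P) (word_gen0 i s)) (word_gen0 j (- P)).
have w2 := word_mul0 w1 (word_gen0 i (- s)).
apply: word_cast (word_mul0 w2 (word_central i j (2 * P * s))) _ _ _ => //.
  exact: conj_base.
by rewrite [LHS]mulmx1 [X in X *m _]aE; exact: esym (arotD i (- s) (- s)).
Qed.

Lemma word_adjSO k : K k -> word 0 0 k.
Proof.
move=> [c [cc dc] <-]; elim: (SO_rotgen cc dc) => [|i t d _ _ IH].
  by rewrite adj1; exact: word1.
rewrite adjM; have w := word_rot i (t * 2); rewrite /arot mulfK ?pnatr_eq0 // in w.
by apply: word_cast (word_mul0 w IH) _ _ _; rewrite ?mulmx0 ?addr0.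
Qed.

Lemma word_all y k : K k -> word 0 y k.
Proof. by move=> /word_adjSO w; exact: (word_no_translation _ w). Qed.

End Words.

(** * Concatenation of Lipschitz curves tangent to a cone field *)
Section Paths.
Context (R : realType) (V : normedModType R).

Lemma is_derive_affine (f h : R -> V) (a b t d0 : R) w :
  is_derive (a * t + b) (1 : R) f w -> 0 < d0 ->
  (forall s, `|s - t| < d0 -> h s = f (a * s + b)) ->
  is_derive t (1 : R) h (a *: w).
Proof.
move=> /is_derive_approx H d00 hE; apply: approx_is_derive => e e0.
pose A := `|a| + 1; have A0 : 0 < A by rewrite ltr_wpDl.
have [d d_gt0 Hd] := H (e / A) (divr_gt0 e0 A0).
exists (Num.min d0 (d / A)); first by rewrite lt_min d00 divr_gt0.
move=> s; rewrite lt_min => /andP[s0 sd].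
rewrite (hE s s0) (hE t) ?subrr ?normr0 //.
have E : a * s + b - (a * t + b) = a * (s - t) by ring.
have aA : `|a| <= A by rewrite lerDl.
have := Hd (a * s + b); rewrite E normrM scalerA [(s - t) * a]mulrC.
have lt : `|a| * `|s - t| < d.
  apply: (@le_lt_trans _ _ (A * `|s - t|)); first by rewrite ler_wpM2r.
  by rewrite -ltr_pdivlMl // mulrC.
move=> /(_ lt) /le_trans; apply.
rewrite mulrA ler_wpM2r // mulrAC ler_pdivrMr // ler_wpM2l // ltW //.
Qed.

Variables (D : V -> V -> Prop) (P : V -> Prop).
Hypothesis DZ : forall q w (c : R), D q w -> D q (c *: w).

Definition lip_on (f : R -> V) (M : R) := forall s t : R,
  0 <= s <= 1 -> 0 <= t <= 1 -> `|f s - f t| <= M * `|s - t|.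

(** Lipschitz curves differentiable except at finitely many times, which is the
    regularity of concatenations of smooth pieces. *)
Definition tangent_path (f : R -> V) (p q : V) : Prop :=
  [/\ f 0 = p, f 1 = q, exists2 M, 0 <= M & lip_on f M,
      forall t, 0 <= t <= 1 -> P (f t) &
      exists l : seq R, forall t, 0 < t < 1 -> t \notin l ->
        exists2 w, is_derive t (1 : R) f w & D (f t) w].

(** Each half is run at double speed on half of [0, 1]; the junction joins the
    exceptional times. *)
Lemma tangent_path_concat f g p q r : tangent_path f p q -> tangent_path g q r ->
  exists h, tangent_path h p r.
Proof.
move=> [f0 f1 [M M0 fM] Pf [l Hl]] [g0 g1 [M' M'0 gM] Pg [l' Hl']].
pose h t := if t <= 2^-1 then f (2 * t + 0) else g (2 * t + -1).
have h1 t : t <= 2^-1 -> h t = f (2 * t + 0) by rewrite /h => ->.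
have h2 t : 2^-1 <= t -> h t = g (2 * t + -1).
  rewrite /h; case: (leP t 2^-1) => // t2 t2'.
  have -> : t = 2^-1 by apply: le_anti; rewrite t2 t2'.
  by rewrite divff ?pnatr_eq0 // addr0 subrr f1 g0.
have hM : lip_on h (2 * (M + M')).
  move=> s t; wlog st : s t / s <= t.
    move=> W s01 t01; case: (leP s t) => [|/ltW] st; first exact: W.
    by rewrite distrC [`|s - t|]distrC; exact: W.
  move=> /andP[s0 s1] /andP[t0 t1].
  have F a b : 0 <= a <= 2^-1 -> 0 <= b <= 2^-1 -> `|h a - h b| <= 2 * M * `|a - b|.
    move=> /andP[a0 a1] /andP[b0 b1]; rewrite !h1 //.
    have := fM (2 * a + 0) (2 * b + 0).
    have -> : 2 * a + 0 - (2 * b + 0) = 2 * (a - b) by ring.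
    rewrite normrM (ger0_norm (ler0n _ 2)) mulrA [M * 2]mulrC; apply; apply/andP; split; lra.
  have G a b : 2^-1 <= a <= 1 -> 2^-1 <= b <= 1 -> `|h a - h b| <= 2 * M' * `|a - b|.
    move=> /andP[a0 a1] /andP[b0 b1]; rewrite !h2 //.
    have := gM (2 * a + -1) (2 * b + -1).
    have -> : 2 * a + -1 - (2 * b + -1) = 2 * (a - b) by ring.
    rewrite normrM (ger0_norm (ler0n _ 2)) mulrA [M' * 2]mulrC; apply; apply/andP; split; lra.
  have le1 : 2 * M <= 2 * (M + M') by lra.
  have le2 : 2 * M' <= 2 * (M + M') by lra.
  case: (leP t 2^-1) => t2.
    by apply: le_trans (F _ _ _ _) _; rewrite ?s0 ?t0 ?t2 ?(le_trans st) ?ler_wpM2r.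
  case: (leP 2^-1 s) => s2.
    by apply: le_trans (G _ _ _ _) _; rewrite ?s1 ?t1 ?s2 ?(ltW t2) ?ler_wpM2r.
  have -> : h s - h t = (h s - h 2^-1) + (h 2^-1 - h t) by rewrite addrA subrK.
  apply: le_trans (ler_normD _ _) _.
  have -> : `|s - t| = `|s - 2^-1| + `|2^-1 - t|.
    by rewrite !ler0_norm; lra.
  rewrite mulrDr; apply: lerD.
    apply: le_trans (F _ _ _ _) _; rewrite ?ler_wpM2r //; apply/andP; split; lra.
  apply: le_trans (G _ _ _ _) _; rewrite ?ler_wpM2r //; apply/andP; split; lra.
exists h; split.
- by rewrite h1 ?mulr0 ?addr0 // invr_ge0.
- rewrite h2 ?mulr1; last by rewrite invf_le1 ?ler1n.
  by have -> : 2 + -1 = 1 :> R by ring.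
- by exists (2 * (M + M')) => //; rewrite mulr_ge0 // addr_ge0.
- move=> t /andP[t0 t1]; case: (leP t 2^-1) => t2.
    by rewrite h1 //; apply: Pf; apply/andP; split; lra.
  by rewrite h2 ?(ltW t2) //; apply: Pg; apply/andP; split; lra.
exists (2^-1 :: [seq x / 2 | x <- l] ++ [seq (x + 1) / 2 | x <- l']) => t /andP[t0 t1].
rewrite inE mem_cat !negb_or => /and3P[tn tl tl'].
case: (ltgtP t 2^-1) tn => // t2 _.
  have [||w dw Dw] := Hl (2 * t + 0).
  - by apply/andP; split; lra.
  - apply: contra tl => tl; apply/mapP; exists (2 * t + 0) => //; by rewrite addr0 mulrC mulKf ?pnatr_eq0.
  exists (2 *: w); last by rewrite h1 ?(ltW t2) //; exact: DZ.
  apply: (is_derive_affine dw (d0 := 2^-1 - t)); first by rewrite subr_gt0.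
  move=> s; rewrite ltr_distl => /andP[_ st]; rewrite h1 //; lra.
have [||w dw Dw] := Hl' (2 * t + -1).
- by apply/andP; split; lra.
- apply: contra tl' => tl'; apply/mapP; exists (2 * t + -1) => //; by rewrite addrNK mulrC mulKf ?pnatr_eq0.
exists (2 *: w); last by rewrite h2 ?(ltW t2) //; exact: DZ.
apply: (is_derive_affine dw (d0 := t - 2^-1)); first by rewrite subr_gt0.
move=> s; rewrite ltr_distl => /andP[st _]; rewrite h2 //; lra.
Qed.

End Paths.

(** * Words as endpoints of horizontal curves *)
Lemma is_derive_lip (R : realType) p q (f df : R -> 'M[R]_(p, q)) C : 0 <= C ->
  (forall t, is_derive t (1 : R) f (df t)) -> (forall t, `|df t| <= C) ->
  forall s t, `|f s - f t| <= C * `|s - t|.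
Proof.
move=> C0 Hd HC s t; wlog st : s t / s < t.
  move=> W; case: (ltgtP s t) => [|ts|->]; first exact: W.
    by rewrite distrC [`|s - t|]distrC; exact: W.
  by rewrite !subrr !normr0 mulr0.
apply: mx_norm_le => [|i j]; first by rewrite mulr_ge0.
have dij x : is_derive x (1 : R) (fun s => f s i j) (df x i j).
  by move: i j; apply/is_derive_mxP.
have cij : {within `[s, t], continuous (fun s => f s i j)}.
  by apply: derivable_within_continuous => x _; have [] := dij x.
have [c _ E] := @MVT R (fun s => f s i j) (fun s => df s i j) s t st (fun x _ => dij x) cij.
have -> : (f s - f t) i j = - (f t i j - f s i j) by rewrite !mxE opprB.
rewrite normrN E normrM [`|s - t|]distrC ler_wpM2r //.
exact: le_trans (mx_norm_entry _ _ _) (HC c).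
Qed.

Section WordPath.
Context (R : realType) (m : nat) (hm : (2 <= m)%N).
Local Notation N := (m + vdim m)%N.
Local Notation n := (1 + m)%N.
Local Notation K := (@adjSO R m).
Local Notation J := (@jacobian_frame R m).
Local Notation state := ('cV[R]_N * 'cV[R]_N * 'M[R]_N)%type.

(** The velocities of (x, y, a) when x moves along a multiple of some X_i. *)
Definition hvel (q w : state) : Prop := exists c i, let u := c *: unit_v R i in
  w = (J q.1.1 *m hor u, q.2 *m hor u, q.2 *m om u).
Definition inK (q : state) : Prop := K q.2.

Lemma horZ (c : R) (u : 'cV[R]_m) : hor (c *: u) = c *: hor u.
Proof. by rewrite /hor scale_col_mx scaler0. Qed.

Lemma omZ (c : R) (u : 'cV[R]_m) : om (c *: u) = c *: om u.
Proof. by rewrite /om [Bmx _]linearZ /= [(_ *: _)^T]linearZ /= scalerBr. Qed.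

Lemma hvelZ q w (c : R) : hvel q w -> hvel q (c *: w).
Proof.
move=> [r [i ->]]; exists (c * r), i => /=.
rewrite -scalerA; move: (r *: unit_v R i) => u; rewrite horZ omZ -!scalemxAr.
by [].
Qed.

(** Since the generator commutes with the rotation, the derivative of c S c^T is
    c [F, S] c^T up to a factor, which is om_adjoint again. *)
Lemma is_derive_arot (i : 'I_m) (r s : R) : is_derive s (1 : R) (fun t => arot i (t * r))
  (arot i (s * r) *m om (r *: unit_v R i)).
Proof.
pose h t : R := t * r / 2.
have dh : is_derive s (1 : R) h (r / 2).
  have H : is_derive s (1 : R) (fun t => t * (r / 2)) (r / 2).
    have := is_derive_lin (L := fun t : R => t * (r / 2)) _ _ (is_derive_id s (1 : R)).
    rewrite mul1r; apply; first by move=> a u v; rewrite mulrDl /= -mulrA.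
    by move=> x; exact: mulrr_continuous.
  by have -> : h = (fun t => t * (r / 2)) by apply/funext => t; rewrite /h mulrA.
have dc : is_derive s (1 : R) (fun t => cos (h t)) (- sin (h s) * (r / 2)).
  have := is_derive1_comp (f := cos) (g := h) (x := s); exact.
have ds : is_derive s (1 : R) (fun t => sin (h t)) (cos (h s) * (r / 2)).
  have := is_derive1_comp (f := sin) (g := h) (x := s); exact.
have drot : is_derive s (1 : R) (fun t => rot i (h t))
    (- (r / 2) *: (rot i (h s) *m rotF R i)).
  have H := is_deriveB (is_deriveD (is_derive_cst (1%:M : 'M[R]_n) s 1)
     (is_derive_scalel (rotP R i) (is_deriveB dc (is_derive_cst (1 : R) s 1))))
     (is_derive_scalel (rotF R i) ds).
  apply: is_derive_eq H _; rewrite /rot mulmxBl mulmxDl mul1mx -!scalemxAl.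
  rewrite rotPF rotFF; move: (rotP R i) (rotF R i) => P F.
  by apply/matrixP => a b; rewrite !mxE; ring.
apply: (is_derive_adj drot) => z.
rewrite -mulmxA om_adjoint /arot adjE ofskewK; last first.
  rewrite [(_ *: _)^T]linearZ /= linearB /= !trmx_mul !toskew_tr.
  rewrite !mulNmx !mulmxN !opprK -scalerN; congr (_ *: _).
  by rewrite opprB.
rewrite horZ -/(e_ R i) [toskew (_ *: _)]linearZ /= toskew_e.
rewrite [(_ *: _)^T]linearZ /= trmx_mul.
have -> : (rotF R i)^T = - rotF R i.
  by rewrite -toskew_e toskew_tr.
rewrite -/(h s); move: (rot i (h s)) (rotF R i) (toskew z) => c F S.
congr ofskew; transitivity (- (r / 2) *: (c *m F *m S *m c^T - c *m S *m F *m c^T)).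
  rewrite -[r *: F *m S]scalemxAl -[S *m (r *: F)]scalemxAr -scalerBr scalerA.
  rewrite -[c *m (_ *: _)]scalemxAr -[_ *: _ *m c^T]scalemxAl mulmxBr mulmxBl !mulmxA.
  by congr (_ *: _); rewrite mulNr mulrC.
rewrite mulNmx scalerN mulmxN -[c *m S *m (_ *: _)]scalemxAr.
rewrite -[_ *: (c *m F) *m S]scalemxAl -[_ *: _ *m c^T]scalemxAl !mulmxA.
move: (c *m F *m S *m c^T) (c *m S *m F *m c^T) => A B.
by rewrite scalerBr.
Qed.

(** X_i is constant along its integral lines. *)
Lemma J_line (x : 'cV[R]_N) s r i :
  J (x + s *: (J x *m e_ R i)) *m (r *: e_ R i) = J x *m (r *: e_ R i).
Proof.
have -> : x + s *: (J x *m e_ R i) = x + J x *m (s *: e_ R i) by rewrite scalemxAr.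
have -> := J_mul x (s *: e_ R i).
have H := J_e s i i r; rewrite b_ii scaler0 addr0 in H.
by rewrite -[LHS]mulmxA [J (s *: _) *m _]H.
Qed.

Lemma K_arot (i : 'I_m) t : K (arot i t).
Proof. by exists (rot i (t / 2)) => //; split; [exact: rot_orth|exact: rot_det]. Qed.

Lemma gen_path (i : 'I_m) (x y : 'cV[R]_N) a r : K a ->
  exists f, tangent_path hvel inK f (x, y, a)
    (x + J x *m (r *: e_ R i), y + a *m (r *: e_ R i), a *m arot i r).
Proof.
move=> Ka.
pose X s := x + (s * r) *: (J x *m e_ R i).
pose Y s := y + (s * r) *: (a *m e_ R i).
pose A s := a *m arot i (s * r).
have dL (v z : 'cV[R]_N) s : is_derive s (1 : R) (fun s => v + (s * r) *: z) (r *: z).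
  have -> : (fun s => v + (s * r) *: z) = (fun s => v + s *: (r *: z)).
    by apply/funext => s'; rewrite scalerA.
  exact: is_derive_line.
have dA s : is_derive s (1 : R) A (A s *m om (r *: unit_v R i)).
  have H := is_derive_mulmx (is_derive_cst a s 1) (is_derive_arot i r s).
  by apply: is_derive_eq H _; rewrite mul0mx add0r mulmxA.
have KA s : K (A s) by apply: adjSO_mul => //; exact: K_arot.
exists (fun s => (X s, Y s, A s)); split.
- by rewrite /X /Y /A !mul0r !scale0r !addr0 arot0 mulmx1.
- by rewrite /X /Y /A !mul1r !scalemxAr.
- pose MX := `|r *: (J x *m e_ R i)|; pose MY := `|r *: (a *m e_ R i)|.
  pose MA := N%:R * (1 * `|om (r *: unit_v R i)|).
  have MX0 : 0 <= MX by exact: normr_ge0.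
  have MY0 : 0 <= MY by exact: normr_ge0.
  have MA0 : 0 <= MA by rewrite mulr_ge0 // mul1r.
  exists (MX + MY + MA); first by rewrite !addr_ge0.
  move=> s t _ _.
  have l1 : `|X s - X t| <= MX * `|s - t|.
    by apply: (is_derive_lip (df := fun=> r *: (J x *m e_ R i))) => // u; exact: dL.
  have l2 : `|Y s - Y t| <= MY * `|s - t|.
    by apply: (is_derive_lip (df := fun=> r *: (a *m e_ R i))) => // u; exact: dL.
  have l3 : `|A s - A t| <= MA * `|s - t|.
    apply: (is_derive_lip MA0 dA) => u.
    apply: le_trans (mx_norm_mul _ _) _; rewrite ler_wpM2l // ler_wpM2r //.
    exact: adjSO_norm.
  have nE (p : state) M' : `|p.1.1| <= M' -> `|p.1.2| <= M' -> `|p.2| <= M' -> `|p| <= M'.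
    by move=> h1 h2 h3; rewrite [leLHS]prod_normE ge_max h3 andbT [leLHS]prod_normE ge_max h1.
  apply: nE => /=.
  + by apply: le_trans l1 _; rewrite ler_wpM2r // -addrA lerDl addr_ge0.
  + by apply: le_trans l2 _; rewrite ler_wpM2r // addrAC lerDr addr_ge0.
  + by apply: le_trans l3 _; rewrite ler_wpM2r // lerDr addr_ge0.
- by move=> t _; exact: KA.
exists [::] => t _ _.
exists (r *: (J x *m e_ R i), r *: (a *m e_ R i), A t *m om (r *: unit_v R i)).
  by apply: is_derive_pair => //; apply: is_derive_pair; exact: dL.
have E1 : J (X t) *m (r *: e_ R i) = r *: (J x *m e_ R i).
  have H := J_line x (t * r) r i.
  by apply: etrans H _; rewrite -scalemxAr.
have E2 : A t *m (r *: e_ R i) = r *: (a *m e_ R i).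
  have H := arot_ee i (t * r).
  by rewrite -[LHS]scalemxAr; congr (_ *: _); rewrite /A -[LHS]mulmxA H.
by exists r, i; rewrite -E1 -E2 /= -horZ.
Qed.

Lemma word_path x y a : word x y a -> K a /\
  exists f, tangent_path hvel inK f (0, 0, 1%:M) (x, y, a).
Proof.
elim=> [|x' y' a' i t _ [Ka [f Hf]]].
  split; first exact: adjSO1.
  exists (fun=> (0, 0, 1%:M)); split=> //.
  - by exists 0 => // s t _ _; rewrite subrr normr0 mul0r.
  - by move=> t _; exact: adjSO1.
  exists [::] => t _ _; exists 0; first exact: is_derive_cst.
  exists 0, (Ordinal (ltnW hm)) => /=; rewrite scale0r.
  have h0 : hor 0 = 0 :> 'cV[R]_N by rewrite /hor col_mx0.
  have o0 : om 0 = 0 :> 'M[R]_N by rewrite /om linear0 trmx0 subrr.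
  by rewrite h0 o0 !mulmx0.
split; first by apply: adjSO_mul => //; exact: K_arot.
have [g Hg] := gen_path i x' y' t Ka.
exact: (tangent_path_concat hvelZ Hf Hg).
Qed.

Lemma tangent_path_all y k : K k -> exists f, tangent_path hvel inK f (0, 0, 1%:M) (0, y, k).
Proof. by move=> /(word_all hm y)/word_path[]. Qed.

End WordPath.

(** * Lower bounds for the holonomy groups *)
Section Lower.
Context (R : realType) (m : nat) (hm : (2 <= m)%N).
Local Notation N := (m + vdim m)%N.
Local Notation n := (1 + m)%N.
Local Notation K := (@adjSO R m).
Local Notation J := (@jacobian_frame R m).
Local Notation state := ('cV[R]_N * 'cV[R]_N * 'M[R]_N)%type.
Context (nabla : connection R N) (hnabla : levi_civita (carnot_metric R m) nabla).
Local Notation Gam := (@Gam R m nabla).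

(** The converse of frame_ode. *)
Lemma frame_parallel (gam : R -> 'cV[R]_N) (a : R -> 'M[R]_N) (v : 'cV[R]_N) t u :
  is_derive t (1 : R) gam (J (gam t) *m hor u) ->
  is_derive t (1 : R) a (a t *m om u) ->
  is_derive t (1 : R) (fun s => J (gam s) *m ((a s)^T *m v))
    (- (Gam (gam t) (J (gam t) *m hor u) *m (J (gam t) *m ((a t)^T *m v)))).
Proof.
move=> dg da.
have H := is_derive_mulmx (is_derive_J dg)
  (is_derive_mulmx (is_derive_trmx da) (is_derive_cst v t (1 : R))).
apply: is_derive_eq H _; rewrite usubmx_jac /hor col_mxKu -/(hor u).
have G := Gam_hor hnabla (gam t) u.
rewrite trmx_mul om_tr mulmx0 addr0.
move: (a t)^T (J (gam t)) (Bmx u) (om u) G => b j B w E.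
have -> : j *m (- w *m b *m v) = - (j *m w *m (b *m v)).
  by rewrite !mulNmx mulmxN !mulmxA.
rewrite -E mulmxDl opprD addrC [_ *m (j *m _)]mulmxA.
exact: addrNK.
Qed.

Lemma parallel_frame (gam : R -> 'cV[R]_N) (a : R -> 'M[R]_N) (v : 'cV[R]_N) s t :
  abs_continuous s t gam -> abs_continuous s t a ->
  (\forall r \ae (@lebesgue_measure R), r \in `]s, t[ -> exists2 u,
     is_derive (r : R) (1 : R) gam (J (gam r) *m hor u) &
     is_derive (r : R) (1 : R) a (a r *m om u)) ->
  parallel_along nabla gam s t (fun r => J (gam r) *m ((a r)^T *m v)).
Proof.
move=> acg aca aeg; split.
  apply: abs_continuous_mulmx; first exact: abs_continuous_J.
  apply: abs_continuous_mulmx; last exact: abs_continuous_cst.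
  exact: abs_continuous_trmx.
apply: lebesgue_aeS aeg => r H rst; have [u dg da] := H rst.
exists (J (gam r) *m hor u) => //.
apply: is_derive_eq (frame_parallel v dg da) _; congr (- _).
rewrite {1}/Gam mulmx_suml; apply: eq_bigr => i _; exact: esym (scalemxAl _ _ _).
Qed.

Lemma tangent_path_ac (f : R -> state) p q : tangent_path (@hvel R m) (@inK R m) f p q ->
  abs_continuous 0 1 f.
Proof. by move=> [_ _ [M M0 fM] _ _]; exact: abs_continuous_lip M0 fM. Qed.

(** Left translation by x0 moves the starting point from the origin to x0 and
    preserves the horizontal velocities. *)
Lemma tangent_path_left (f : R -> state) p q x0 : tangent_path (@hvel R m) (@inK R m) f p q ->
  let gam t := x0 + J x0 *m (f t).1.1 in
  [/\ abs_continuous 0 1 gam, abs_continuous 0 1 (fun t => (f t).1.2),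
      abs_continuous 0 1 (fun t => (f t).2) &
   \forall t \ae (@lebesgue_measure R), t \in `]0, 1[ -> exists c i,
     let u := c *: unit_v R i in
     [/\ is_derive (t : R) (1 : R) gam (J (gam t) *m hor u),
         is_derive (t : R) (1 : R) (fun t => (f t).1.2) ((f t).2 *m hor u) &
         is_derive (t : R) (1 : R) (fun t => (f t).2) ((f t).2 *m om u)]].
Proof.
move=> pf gam; have acf := tangent_path_ac pf; split.
- apply: abs_continuousD; first exact: abs_continuous_cst.
  apply: abs_continuous_mulmx; first exact: abs_continuous_cst.
  exact: abs_continuous_fst (abs_continuous_fst acf).
- exact: abs_continuous_snd (abs_continuous_fst acf).
- exact: abs_continuous_snd acf.
have [_ _ _ _ [l Hl]] := pf.
apply: lebesgue_aeS (lebesgue_ae_notin l) => t tl t01.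
have t01' : 0 < t < 1 by move: t01; rewrite in_itv.
have [w dw [c [i wE]]] := Hl t t01' tl; exists c, i => /=; move: (c *: unit_v R i) wE => u wE.
have d1 := is_derive_fst (is_derive_fst dw).
have d2 := is_derive_snd (is_derive_fst dw).
have d3 := is_derive_snd dw.
rewrite wE in d1 d2 d3; split=> //.
have H := is_deriveD (is_derive_cst x0 t (1 : R))
  (is_derive_mulmx (is_derive_cst (J x0) t (1 : R)) d1).
apply: is_derive_eq H _; rewrite mul0mx !add0r mulmxA.
by rewrite /gam J_mul.
Qed.

(** The horizontal lift of a word with final state (0, 0, k^T); the transpose
    appears because the transport itself is J a^T J(x)^-1. *)
Lemma holonomy_sup x k : K k ->
  horizontal_holonomy_at nabla (horizontal R m) x (J x *m k *m invmx (J x)).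
Proof.
move=> Kk; have UJ := jacobian_frame_unit x.
have [f pf] := tangent_path_all hm 0 (adjSO_tr Kk).
have [acg _ aca aef] := tangent_path_left x pf.
have [f0 f1 _ _ _] := pf.
exists (fun t => x + J x *m (f t).1.1); split.
- split=> //; apply: lebesgue_aeS aef => t H /H [c [i [dg _ _]]].
  by exists (J (x + J x *m (f t).1.1) *m hor (c *: unit_v R i)) => //; apply/horizontalP; exists (c *: unit_v R i).
- by rewrite f0 mulmx0 addr0.
- by rewrite f1 mulmx0 addr0.
move=> v; rewrite min_l // max_r //.
exists (fun s => J (x + J x *m (f s).1.1) *m ((f s).2^T *m (invmx (J x) *m v))); split.
- apply: parallel_frame => //; apply: lebesgue_aeS aef => t H /H [c [i [dg _ da]]].
  by exists (c *: unit_v R i).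
- by rewrite f0 /= mulmx0 addr0 trmx1 mul1mx mulKVmx.
- by rewrite f1 /= mulmx0 addr0 trmxK !mulmxA.
Qed.

(** The auxiliary curve is a straight line, which is an integral curve of a
    multiple of X_i; the transport along it is explicit. *)
Lemma rolling_lift_gen (q : state) c i : let u := c *: unit_v R i in
  let X := J q.1.1 *m hor u in
  rolling_lift nabla q X (X, q.2 *m X, q.2 *m Gam q.1.1 X).
Proof.
move=> u X; set x := q.1.1 in X *.
pose gam s := x + s *: X.
have Jg s : J (gam s) *m hor u = X.
  rewrite /gam /X horZ.
  have -> : s *: (J x *m (c *: hor (unit_v R i))) = (s * c) *: (J x *m e_ R i).
    by rewrite -scalemxAr scalerA.
  exact: J_line.
have dgam s : is_derive s (1 : R) gam X by exact: is_derive_line.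
pose a s := arot i (s * c).
have da s : is_derive s (1 : R) a (a s *m om u) by exact: is_derive_arot.
have a0 : a 0 = 1%:M by rewrite /a mul0r arot0.
have g0 : gam 0 = x by rewrite /gam scale0r addr0.
have oa s : (a s)^T *m a s = 1%:M by apply: adjSO_orth; exact: K_arot.
have acg s t : abs_continuous s t gam.
  apply: (@abs_continuous_lip _ _ _ _ _ `|X|) => // r r' _ _.
  by apply: (is_derive_lip (df := fun=> X)).
have aca s t : abs_continuous s t a.
  apply: (@abs_continuous_lip _ _ _ _ _ (N%:R * (1 * `|om u|))).
    by rewrite mulr_ge0 // mul1r.
  move=> r r' _ _; apply: (is_derive_lip _ da) => [|r''].
    by rewrite mulr_ge0 // mul1r.
  apply: le_trans (mx_norm_mul _ _) _; rewrite ler_wpM2l // ler_wpM2r //.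
  by apply: adjSO_norm; exact: K_arot.
exists gam, (fun s => J x *m a s *m invmx (J (gam s))), 1; split => //.
- have oT : open (`]-1, 1[%classic : set R) by exact: interval_open.
  apply: smooth_onD => //; first exact: smooth_on_cst.
  by apply: smooth_onZ => //; [exact: smooth_on_id|exact: smooth_on_cst].
- move=> t _ v.
  exists (fun s => J (gam s) *m ((a s)^T *m (a t *m (invmx (J (gam t)) *m v)))); split.
  + apply: parallel_frame => //; apply: lebesgue_aeT => r _.
    by exists u => //; rewrite Jg.
  + by rewrite [_^T *m (_ *m _)]mulmxA oa mul1mx mulKVmx // jacobian_frame_unit.
  + by rewrite a0 trmx1 mul1mx g0 !mulmxA.
have d3 := is_derive_mulmx (is_derive_mulmx (is_derive_cst (J x) (0 : R) 1) (da 0))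
   (is_derive_invJ (dgam 0)).
have d4 := is_derive_mulmx (is_derive_cst q.2 (0 : R) 1) d3.
have d5 : is_derive (0 : R) (1 : R) (fun s => q.2 *m (J x *m a s *m invmx (J (gam s))))
    (q.2 *m Gam x X).
  apply: is_derive_eq d4 _; rewrite !mul0mx !add0r a0 mulmx1 mul1mx g0; congr (_ *m _).
  rewrite usubmx_jac /hor col_mxKu.
  have UJ := jacobian_frame_unit x.
  have G := Gam_hor hnabla x u; rewrite -/X in G.
  rewrite -G mulmxDl mulmxN jac_Bmx mulmxK // -{1}(Bmx_jac u x) mulmxK //.
  exact: addrK.
have H := is_derive_line q.1.2 (q.2 *m X) (0 : R).
exact: is_derive_pair (is_derive_pair (dgam 0) H) d5.
Qed.

(** The word with final state (0, y, k) gives the rolling motion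
    (x, xhat, A) = (x0 x(t), xhat0 + O y(t), O a(t) J(x)^-1); y is chosen such
    that its endpoint is the image of the starting point under h. *)
Lemma affine_sup q h : rolling_space (carnot_metric R m) q ->
  conj_adjSO (q.2 *m J q.1.1) h.2 ->
  affine_holonomy (carnot_metric R m) nabla (horizontal R m) q h.
Proof.
move=> Qq [k Kk hE]; have OO := rolling_space_orth Qq.
move: Qq hE OO; case: q => -[x xh] A /= [AA dA].
set O := A *m J x => hE OO; have OO' : O *m O^T = 1%:M by exact: mulmx1C.
have UJ := jacobian_frame_unit x.
have AE : A = O *m invmx (J x) by rewrite /O mulmxK.
have dO : 0 < \det O by rewrite /O det_mulmx jacobian_frame_det mulr1.
clearbody O.
split.
  split => /=; rewrite -hE.
    rewrite !trmx_mul trmxK !mulmxA -[_ *m O^T *m O]mulmxA OO mulmx1.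
    by rewrite -[_ *m k^T *m k]mulmxA adjSO_orth // mulmx1 OO'.
  rewrite !det_mulmx (adjSO_det Kk) mulr1 mulrC -det_mulmx OO det1 //.
pose y := O^T *m (h.2 *m xh + h.1 - xh).
have [f pf] := tangent_path_all hm y Kk.
have [acg acy aca aef] := tangent_path_left x pf.
have [f0 f1 _ fK _] := pf.
pose gam t := x + J x *m (f t).1.1.
pose A_ t := O *m (f t).2 *m invmx (J (gam t)).
exists (fun t => (gam t, xh + O *m (f t).1.2, A_ t)); split.
- apply: abs_continuous_pair; first apply: abs_continuous_pair => //.
    apply: abs_continuousD; first exact: abs_continuous_cst.
    by apply: abs_continuous_mulmx => //; exact: abs_continuous_cst.
  apply: abs_continuous_mulmx; last exact: abs_continuous_invJ.
  by apply: abs_continuous_mulmx => //; exact: abs_continuous_cst.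
- move=> t; rewrite in_itv /= => /fK Kf; split => /=.
    rewrite /A_ !trmx_mul !mulmxA -[_ *m O^T *m O]mulmxA OO mulmx1.
    by rewrite -[_ *m _^T *m (f t).2]mulmxA (adjSO_orth Kf) mulmx1.
  rewrite /A_ !det_mulmx (adjSO_det Kf) det_inv !jacobian_frame_det.
  by rewrite invr1 !mulr1.
- apply: lebesgue_aeS aef => t H /H [c [i]]; set u := c *: _ => -[dg dy da].
  pose X := J (gam t) *m hor u.
  exists (X, A_ t *m X, A_ t *m Gam (gam t) X); last first.
    exists X; first by apply/horizontalP; exists u.
    exact: (rolling_lift_gen (gam t, xh + O *m (f t).1.2, A_ t) c i).
  apply: is_derive_pair; first apply: is_derive_pair => //.
    have H1 := is_deriveD (is_derive_cst xh t (1 : R))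
      (is_derive_mulmx (is_derive_cst O t (1 : R)) dy).
    apply: is_derive_eq H1 _; rewrite mul0mx !add0r /A_ /X !mulmxA mulmxKV //.
    exact: jacobian_frame_unit.
  have H2 := is_derive_mulmx (is_derive_mulmx (is_derive_cst O t (1 : R)) da)
    (is_derive_invJ dg).
  apply: is_derive_eq H2 _; rewrite mul0mx add0r usubmx_jac /hor col_mxKu -/(hor u).
  have UJt := jacobian_frame_unit (gam t).
  have G := Gam_hor hnabla (gam t) u.
  have key : om u *m invmx (J (gam t)) - Bmx u = invmx (J (gam t)) *m Gam (gam t) X.
    apply: (can_inj (mulKmx UJt)); rewrite [RHS]mulKVmx // mulmxBr mulmxA -G jac_Bmx.
    by rewrite mulmxDl mulmxK // -[X in _ + X *m _](Bmx_jac u (gam t)) mulmxK // addrK.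
  by rewrite [ O *m (_ *m om u)]mulmxA -[_ *m om u *m _]mulmxA -mulmxDr key mulmxA.
- by rewrite /A_ /gam f0 /= !mulmx0 !addr0 mulmx1 -AE.
rewrite /A_ /gam f1 /= !mulmx0 !addr0 /y; congr (_, _, _).
  by rewrite mulmxA OO' mul1mx addrC subrK.
by rewrite -hE AE !mulmxA -[_ *m O^T *m O]mulmxA OO mulmx1.
Qed.

End Lower.

(** * Conclusion *)
Section Conclusion.
Context (R : realType) (m : nat) (hm : (2 <= m)%N).
Local Notation N := (m + vdim m)%N.
Local Notation J := (@jacobian_frame R m).
Context (nabla : connection R N) (hnabla : levi_civita (carnot_metric R m) nabla).

Lemma affine_holonomyE q : rolling_space (carnot_metric R m) q ->
  affine_holonomy (carnot_metric R m) nabla (horizontal R m) q =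
  affine_conj (q.2 *m J q.1.1).
Proof.
move=> Qq; apply/seteqP; split=> h; first exact: affine_sub.
exact: affine_sup.
Qed.

Lemma horizontal_holonomyE x F : orthonormal_frame (carnot_metric R m) x F ->
  exists2 O : 'M[R]_N, O^T *m O = 1%:M &
    horizontal_holonomy nabla (horizontal R m) x F = conj_adjSO O.
Proof.
move=> FF; have UJ := jacobian_frame_unit x.
pose Q := invmx (J x) *m F.
have QQ : Q^T *m Q = 1%:M.
  rewrite -[RHS]FF /carnot_metric /Q trmx_mul !mulmxA //.
have QQ' : Q *m Q^T = 1%:M by exact: mulmx1C.
have FE : F = J x *m Q by rewrite /Q mulKVmx.
have UF : F \in unitmx by rewrite FE unitmx_mul UJ; case/mulmx1_unit: QQ => _ ->.
have FV : invmx F = Q^T *m invmx (J x).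
  apply: (can_inj (mulKmx UF)); rewrite mulmxV // FE mulmxA -[_ *m Q *m Q^T]mulmxA.
  by rewrite QQ' mulmx1 mulmxV.
exists Q^T; first by rewrite trmxK.
apply/seteqP; split=> C.
  move=> [P HP <-]; have [k Kk ->] := holonomy_sub hnabla HP.
  by exists k => //; rewrite trmxK FV FE !mulmxA mulmxKV // mulmxKV.
move=> [k Kk <-]; exists (J x *m k *m invmx (J x)); first exact: holonomy_sup.
by rewrite trmxK FV FE !mulmxA mulmxKV // mulmxKV.
Qed.

End Conclusion.

Theorem proposition4p9 (R : realType) (m : nat) (hm : (2 <= m)%N)
    (nabla : connection R (m + vdim m))
    (hnabla : levi_civita (carnot_metric R m) nabla) :
  (forall q : 'cV[R]_(m + vdim m) * 'cV[R]_(m + vdim m) * 'M[R]_(m + vdim m),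
     rolling_space (carnot_metric R m) q ->
     inhabited (lie_subgroup (2 * (m + vdim m)) (SE R (m + vdim m))
       (affine_holonomy (carnot_metric R m) nabla (horizontal R m) q))) /\
  (forall (x : 'cV[R]_(m + vdim m)) (F : 'M[R]_(m + vdim m)),
     orthonormal_frame (carnot_metric R m) x F ->
     exists L : lie_subgroup (m + vdim m) (SO R (m + vdim m))
                  (horizontal_holonomy nabla (horizontal R m) x F),
       compact (identity_component L)).
Proof.
split=> [q Qq | x F FF].
  rewrite affine_holonomyE //; apply: affine_conj_lie => //.
  exact: rolling_space_orth.
by have [C CC ->] := horizontal_holonomyE hm hnabla FF; exact: conj_adjSO_lie.
Qed.
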